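(* Let $\mathcal{X}$ be a complex Banach space and let $A,B\in\mathcal{B}(\mathcal{X})$ be arbitrary. If $f$ is a holomorphic function in an open neighborhood of $\sigma(A)\cup\sigma(B)$, then $$\mathscr{R}(\delta_{f(A),f(B)})\subseteq\overline{\mathscr{R}(\delta_{A,B})}\quad\text{and}\quad\mathscr{N}(\delta_{f(A),f(B)})\supseteq\mathscr{N}(\delta_{A,B}).$$ If, additionally, $f$ is injective (on that open neighborhood), then $$\overline{\mathscr{R}(\delta_{f(A),f(B)})}=\overline{\mathscr{R}(\delta_{A,B})}\quad\text{and}\quad\mathscr{N}(\delta_{f(A),f(B)})=\mathscr{N}(\delta_{A,B}).$$
   Context: $\mathcal{B}(\mathcal{X})$ is the Banach algebra of all bounded linear operators on $\mathcal{X}$; $\sigma(A)$ is the spectrum of $A$. For $A,B\in\mathcal{B}(\mathcal{X})$, the generalized derivation $\delta_{A,B}\colon\mathcal{B}(\mathcal{X})\to\mathcal{B}(\mathcal{X})$ is $\delta_{A,B}(X)=AX-XB$. $\mathscr{N}(T)$ and $\mathscr{R}(T)$ denote the null space and the range of an operator $T$, and the bar denotes norm closure in $\mathcal{B}(\mathcal{X})$. The operators $f(A)$, $f(B)$ are defined by the Riesz (holomorphic) functional calculus. *)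

(* Defs.v *)
From Stdlib Require Import Reals Lra List Permutation.
From Stdlib Require Import FunctionalExtensionality PropExtensionality ProofIrrelevance.
From Stdlib Require Import ClassicalEpsilon.
From Coquelicot Require Import Coquelicot.
Import ListNotations.
Open Scope R_scope.

Record BOp (X : CompleteNormedModule C_AbsRing) : Type := mkBOp {
  bop_fun :> X -> X;
  bop_linear : is_linear bop_fun
}.
Arguments mkBOp {X} _ _.
Arguments bop_fun {X} _ _.
Arguments bop_linear {X} _.

Lemma minus_plus_plus {G : AbelianGroup} (x y u v : G) :
  minus (plus x y) (plus u v) = plus (minus x u) (minus y v).
Proof.
unfold minus; rewrite opp_plus, <- !plus_assoc; f_equal.
rewrite !plus_assoc; f_equal; apply plus_comm.
Qed.

Section BOp_structure.

Context {X : CompleteNormedModule C_AbsRing}.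
Implicit Types S T : BOp X.

Lemma bop_ext S T : (forall x, S x = T x) -> S = T.
Proof.
destruct S as [s Hs], T as [t Ht]; simpl; intros E.
assert (s = t) by (apply functional_extensionality; exact E).
subst t; f_equal; apply proof_irrelevance.
Qed.

Lemma bop_plus_linear S T : is_linear (fun x => plus (S x) (T x)).
Proof.
exact (is_linear_comp _ _ (is_linear_prod _ _ (bop_linear S) (bop_linear T))
  is_linear_plus).
Qed.

Lemma bop_scal_linear (c : C) T : is_linear (fun x => scal c (T x)).
Proof.
exact (is_linear_comp _ _ (bop_linear T) (is_linear_scal_r (V := X) c Cmult_comm)).
Qed.

Lemma bop_opp_linear T : is_linear (fun x => opp (T x)).
Proof. exact (is_linear_comp _ _ (bop_linear T) is_linear_opp). Qed.

Lemma bop_comp_linear S T : is_linear (fun x => S (T x)).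
Proof. exact (is_linear_comp _ _ (bop_linear T) (bop_linear S)). Qed.

Definition bop_plus S T := mkBOp _ (bop_plus_linear S T).
Definition bop_scal (c : C) T := mkBOp _ (bop_scal_linear c T).
Definition bop_opp T := mkBOp _ (bop_opp_linear T).
Definition bop_zero : BOp X := mkBOp _ is_linear_zero.
Definition bop_id : BOp X := mkBOp _ is_linear_id.
Definition bop_comp S T := mkBOp _ (bop_comp_linear S T).

Definition opnorm T : R :=
  real (Glb_Rbar (fun M => 0 <= M /\ forall x, norm (T x) <= M * norm x)).

Lemma opnorm_spec T :
  is_glb_Rbar (fun M => 0 <= M /\ forall x, norm (T x) <= M * norm x)
    (Finite (opnorm T)) /\ 0 <= opnorm T.
Proof.
unfold opnorm; set (E := fun M => _).
pose proof (Glb_Rbar_correct E) as [H1 H2].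
destruct (bop_linear T) as [_ _ [M [M0 HM]]].
assert (EM : E M) by (split; [lra|exact HM]).
assert (H0 : Rbar_le 0 (Glb_Rbar E)).
{ apply H2; intros x [x0 _]; exact x0. }
specialize (H1 M EM) as H1M.
destruct (Glb_Rbar E) as [g| |]; simpl in *; try easy.
Qed.

Lemma opnorm_ge_0 T : 0 <= opnorm T.
Proof. apply opnorm_spec. Qed.

Lemma opnorm_le T M :
  0 <= M -> (forall x, norm (T x) <= M * norm x) -> opnorm T <= M.
Proof.
intros M0 HM; destruct (opnorm_spec T) as [[H _] _].
exact (H M (conj M0 HM)).
Qed.

Lemma opnorm_bound T x : norm (T x) <= opnorm T * norm x.
Proof.
destruct (opnorm_spec T) as [[_ H] T0].
destruct (Req_dec (norm x) 0) as [Ex|Nx].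
{ destruct (bop_linear T) as [_ _ [M [_ HM]]].
  specialize (HM x); rewrite Ex in *; lra. }
assert (Px : 0 < norm x) by (pose proof (norm_ge_0 (V := X) x); lra).
specialize (H (Finite (norm (T x) / norm x))).
assert (Hle : norm (T x) / norm x <= opnorm T).
{ apply H; intros M [M0 HM]; simpl.
  apply Rmult_le_reg_r with (norm x); auto.
  unfold Rdiv; rewrite Rmult_assoc, Rinv_l, Rmult_1_r; auto. }
apply Rmult_le_compat_r with (r := norm x) in Hle; [|lra].
unfold Rdiv in Hle; rewrite Rmult_assoc, Rinv_l, Rmult_1_r in Hle; auto.
Qed.

Definition BOp_AbelianMonoid_mixin : AbelianMonoid.mixin_of (BOp X).
Proof.
refine (AbelianMonoid.Mixin (BOp X) bop_plus bop_zero _ _ _).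
- intros; apply bop_ext; intros; exact (plus_comm (G := X) _ _).
- intros; apply bop_ext; intros; exact (plus_assoc (G := X) _ _ _).
- intros; apply bop_ext; intros; exact (plus_zero_r (G := X) _).
Defined.

Canonical BOp_AbelianMonoid :=
  AbelianMonoid.Pack (BOp X) BOp_AbelianMonoid_mixin (BOp X).

Definition BOp_AbelianGroup_mixin : AbelianGroup.mixin_of BOp_AbelianMonoid.
Proof.
refine (AbelianGroup.Mixin BOp_AbelianMonoid bop_opp _).
intros; apply bop_ext; intros; exact (plus_opp_r (G := X) _).
Defined.

Canonical BOp_AbelianGroup :=
  AbelianGroup.Pack (BOp X) (AbelianGroup.Class _ _ BOp_AbelianGroup_mixin) (BOp X).

Definition BOp_ModuleSpace_mixin : ModuleSpace.mixin_of C_Ring BOp_AbelianGroup.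
Proof.
refine (ModuleSpace.Mixin C_Ring BOp_AbelianGroup bop_scal _ _ _ _).
- intros; apply bop_ext; intros; simpl; exact (scal_assoc _ _ _).
- intros; apply bop_ext; intros; exact (scal_one (V := X) _).
- intros; apply bop_ext; intros; exact (scal_distr_l (V := X) _ _ _).
- intros; apply bop_ext; intros; exact (scal_distr_r (V := X) _ _ _).
Defined.

Canonical BOp_ModuleSpace :=
  ModuleSpace.Pack C_Ring (BOp X) (ModuleSpace.Class _ _ _ BOp_ModuleSpace_mixin) (BOp X).

Lemma opnorm_triangle S T : opnorm (plus S T) <= opnorm S + opnorm T.
Proof.
apply opnorm_le.
- pose proof (opnorm_ge_0 S); pose proof (opnorm_ge_0 T); lra.
- intros x; simpl; eapply Rle_trans; [apply (norm_triangle (V := X))|].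
  pose proof (opnorm_bound S x); pose proof (opnorm_bound T x); lra.
Qed.

Lemma opnorm_scal (c : C) T : opnorm (scal c T) <= Cmod c * opnorm T.
Proof.
apply opnorm_le.
- apply Rmult_le_pos; [apply Cmod_ge_0|apply opnorm_ge_0].
- intros x; simpl; eapply Rle_trans; [apply (norm_scal (V := X))|].
  rewrite Rmult_assoc; apply Rmult_le_compat_l;
    [apply Cmod_ge_0|apply opnorm_bound].
Qed.

Lemma opnorm_opp T : opnorm (opp T) = opnorm T.
Proof.
assert (H : forall U : BOp X, opnorm (opp U) <= opnorm U).
{ intros U; apply opnorm_le; [apply opnorm_ge_0|]; intros x; simpl.
  rewrite (norm_opp (V := X)); apply opnorm_bound. }
apply Rle_antisym; auto.
rewrite <- (opp_opp T) at 1; apply H.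
Qed.

Lemma opnorm_eq_0 T : opnorm T = 0 -> T = zero.
Proof.
intros E; apply bop_ext; intros x; simpl; apply (norm_eq_zero (V := X)).
pose proof (opnorm_bound T x); pose proof (norm_ge_0 (V := X) (T x)).
rewrite E in *; lra.
Qed.

Definition BOp_ball S (e : R) T : Prop := opnorm (minus T S) < e.

Definition BOp_UniformSpace_mixin : UniformSpace.mixin_of (BOp X).
Proof.
refine (UniformSpace.Mixin (BOp X) (zero : BOp X) BOp_ball _ _ _); unfold BOp_ball.
- intros T e; rewrite minus_eq_zero.
  apply Rle_lt_trans with 0; [|apply cond_pos].
  apply opnorm_le; [lra|]; intros x; simpl; rewrite (norm_zero (V := X)); lra.
- intros S T e H; rewrite <- opnorm_opp, opp_minus; exact H.
- intros S T U e1 e2 H1 H2; rewrite (minus_trans T).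
  eapply Rle_lt_trans; [apply opnorm_triangle|]; lra.
Defined.

Canonical BOp_UniformSpace :=
  UniformSpace.Pack (BOp X) BOp_UniformSpace_mixin (BOp X).

Canonical BOp_NormedModuleAux :=
  NormedModuleAux.Pack C_AbsRing (BOp X)
    (NormedModuleAux.Class C_AbsRing (BOp X)
       (ModuleSpace.class _ BOp_ModuleSpace) BOp_UniformSpace_mixin) (BOp X).

Definition BOp_NormedModule_mixin : NormedModule.mixin_of C_AbsRing BOp_NormedModuleAux.
Proof.
refine (NormedModule.Mixin C_AbsRing BOp_NormedModuleAux opnorm 1 _ _ _ _ _).
- exact opnorm_triangle.
- exact opnorm_scal.
- intros S T e H; exact H.
- intros S T e H; rewrite Rmult_1_l; exact H.
- exact opnorm_eq_0.
Defined.

Canonical BOp_NormedModule :=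
  NormedModule.Pack C_AbsRing (BOp X)
    (NormedModule.Class _ _ _ BOp_NormedModule_mixin) (BOp X).

Lemma BOp_complete (F : (BOp X -> Prop) -> Prop) :
  ProperFilter F -> cauchy F ->
  exists T : BOp X, forall eps : posreal, F (ball T eps).
Proof.
intros FF HF.
set (Fx := fun x : X => filtermap (fun T : BOp X => T x) F).
assert (FxP : forall x, ProperFilter (Fx x)) by (intros x; now apply filtermap_proper_filter).
assert (near : forall (e : posreal), exists T0 : BOp X,
  F (fun T => opnorm (minus T T0) < e)).
{ intros e; destruct (HF e) as [T0 HT0]; now exists T0. }
assert (pw : forall (T0 T : BOp X) (x : X) (e : R),
  opnorm (minus T T0) < e -> norm (minus (T x) (T0 x)) <= e * norm x).
{ intros T0 T x e H.
  eapply Rle_trans; [apply (opnorm_bound (minus T T0) x)|].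
  apply Rmult_le_compat_r; [apply (norm_ge_0 (V := X))|lra]. }
assert (FxC : forall x, cauchy (Fx x)).
{ intros x e.
  assert (P : 0 < norm x + 1) by (pose proof (norm_ge_0 (V := X) x); lra).
  assert (Pe : 0 < e / (norm x + 1)) by (apply Rdiv_lt_0_compat; [apply cond_pos|lra]).
  destruct (near (mkposreal _ Pe)) as [T0 HT0]; exists (T0 x).
  unfold Fx, filtermap; revert HT0; apply filter_imp; simpl; intros T HT; apply (norm_compat1 (V := X)).
  eapply Rle_lt_trans; [apply (pw T0 T x _ HT)|].
  apply Rlt_le_trans with (e / (norm x + 1) * (norm x + 1)).
  - apply Rmult_lt_compat_l; [auto|lra].
  - right; field; lra. }
set (L := fun x => lim (Fx x)).
assert (HL : forall x (e : posreal), F (fun T => norm (minus (T x) (L x)) < e)).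
{ intros x e.
  assert (Pn : 0 < norm_factor (V := X)) by apply norm_factor_gt_0.
  assert (Pe : 0 < e / norm_factor (V := X))
    by (apply Rdiv_lt_0_compat; [apply cond_pos|auto]).
  generalize (complete_cauchy (Fx x) (FxP x) (FxC x) (mkposreal _ Pe)).
  apply (filter_imp (F := F)); intros T HT.
  eapply Rlt_le_trans; [apply (norm_compat2 (V := X) _ _ _ HT)|]; simpl; right; field; lra. }
assert (small : forall y : X, (forall e : posreal, norm y <= e) -> y = zero).
{ intros y Hy; apply (norm_eq_zero (V := X)); apply Rle_antisym; [|apply (norm_ge_0 (V := X))].
  apply le_epsilon; intros e He; specialize (Hy (mkposreal e He)); simpl in Hy; lra. }
assert (diff : forall y z : X, minus y z = zero -> y = z).
{ intros y z H; apply (plus_reg_r (G := X) (opp z)).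
  rewrite (plus_opp_r (G := X) z); exact H. }
assert (dist : forall y z w : X, norm (minus y z) <= norm (minus w y) + norm (minus w z)).
{ intros y z w; rewrite (minus_trans w y z).
  eapply Rle_trans; [apply (norm_triangle (V := X))|].
  apply Rplus_le_compat_r, Req_le.
  rewrite <- (opp_minus (G := X) w y); apply (norm_opp (V := X)). }
assert (Lplus : forall x y, L (plus x y) = plus (L x) (L y)).
{ intros x y; apply diff, small; intros e.
  assert (P3 : 0 < e / 3) by (pose proof (cond_pos e); lra).
  destruct (filter_ex _ (filter_and _ _ (HL (plus x y) (mkposreal _ P3))
    (filter_and _ _ (HL x (mkposreal _ P3)) (HL y (mkposreal _ P3)))))
    as [T [H1 [H2 H3]]]; simpl in *.
  eapply Rle_trans; [apply (dist _ _ (T (plus x y)))|].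
  assert (norm (minus (T (plus x y)) (plus (L x) (L y)))
     <= norm (minus (T x) (L x)) + norm (minus (T y) (L y))); [|lra].
  rewrite (linear_plus _ (bop_linear T)).
  eapply Rle_trans; [|apply (norm_triangle (V := X))]; right; f_equal.
  apply (minus_plus_plus (G := X)). }
assert (Lscal : forall k x, L (scal k x) = scal k (L x)).
{ intros k x; apply diff, small; intros e.
  assert (P2 : 0 < e / 2) by (pose proof (cond_pos e); lra).
  assert (Pk : 0 < Cmod k + 1) by (pose proof (Cmod_ge_0 k); lra).
  assert (Pe : 0 < e / 2 / (Cmod k + 1)) by (apply Rdiv_lt_0_compat; lra).
  destruct (filter_ex _ (filter_and _ _ (HL (scal k x) (mkposreal _ P2))
    (HL x (mkposreal _ Pe)))) as [T [H1 H2]]; simpl in *.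
  replace (pos e) with (e / 2 + e / 2) by field.
  eapply Rle_trans; [apply (dist _ _ (T (scal k x)))|].
  apply Rplus_le_compat; [left; exact H1|].
  rewrite (linear_scal _ (bop_linear T)).
  eapply Rle_trans; [right; apply (f_equal (norm (V := X)));
    symmetry; exact (scal_minus_distr_l (V := X) k (T x) (L x))|].
  eapply Rle_trans; [apply (norm_scal (V := X))|].
  apply Rle_trans with ((Cmod k + 1) * (e / 2 / (Cmod k + 1))).
  - apply Rmult_le_compat; [apply Cmod_ge_0|apply (norm_ge_0 (V := X))| |].
    + change (abs k) with (Cmod k); lra.
    + left; exact H2.
  - right; field; lra. }
assert (Lnear : forall (e : posreal) (T0 : BOp X),
  F (fun T => opnorm (minus T T0) < e) ->
  forall x, norm (minus (L x) (T0 x)) <= e * norm x).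
{ intros e T0 HT0 x; apply le_epsilon; intros d Hd.
  destruct (filter_ex _ (filter_and _ _ HT0 (HL x (mkposreal d Hd)))) as [T [H1 H2]].
  simpl in H2.
  eapply Rle_trans; [apply (dist _ _ (T x))|].
  pose proof (pw T0 T x _ H1); lra. }
assert (Llin : is_linear L).
{ split; auto.
  destruct (near (mkposreal 1 Rlt_0_1)) as [T0 HT0].
  pose proof (Lnear _ _ HT0) as H; simpl in H.
  exists (1 + opnorm T0); split; [pose proof (opnorm_ge_0 T0); lra|]; intros x.
  replace (L x) with (plus (minus (L x) (T0 x)) (T0 x)).
  - eapply Rle_trans; [apply (norm_triangle (V := X))|].
    specialize (H x); pose proof (opnorm_bound T0 x); lra.
  - unfold minus; rewrite <- plus_assoc, plus_opp_l; apply plus_zero_r. }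
exists (mkBOp L Llin); intros e.
assert (P4 : 0 < e / 4) by (pose proof (cond_pos e); lra).
destruct (near (mkposreal _ P4)) as [T0 HT0].
pose proof (Lnear _ _ HT0) as H; revert HT0; apply filter_imp; simpl in *; intros T HT.
change (opnorm (minus T (mkBOp L Llin)) < e).
apply Rle_lt_trans with (e / 4 + e / 4); [|pose proof (cond_pos e); lra].
rewrite (minus_trans T0); eapply Rle_trans; [apply opnorm_triangle|].
apply Rplus_le_compat; [lra|].
rewrite <- opnorm_opp, opp_minus.
apply opnorm_le; [lra|]; intros x; apply (H x).
Qed.

Definition BOp_lim (F : (BOp X -> Prop) -> Prop) : BOp X :=
  epsilon (inhabits (zero : BOp X)) (fun T => forall eps : posreal, F (ball T eps)).

Definition BOp_CompleteSpace_mixin : CompleteSpace.mixin_of BOp_UniformSpace.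
Proof.
refine (CompleteSpace.Mixin BOp_UniformSpace BOp_lim _ _).
- intros F FF HF.
  exact (epsilon_spec (inhabits (zero : BOp X))
    (fun T : BOp X => forall eps : posreal, F (ball T eps)) (BOp_complete F FF HF)).
- intros F G H1 H2.
  assert (E : F = G).
  { apply functional_extensionality; intros P; apply propositional_extensionality.
    split; [apply H2|apply H1]. }
  rewrite E; intros eps; apply ball_center.
Defined.

Canonical BOp_CompleteSpace :=
  CompleteSpace.Pack (BOp X)
    (CompleteSpace.Class _ BOp_UniformSpace_mixin BOp_CompleteSpace_mixin) (BOp X).

Canonical BOp_CompleteNormedModule :=
  CompleteNormedModule.Pack C_AbsRing (BOp X)
    (CompleteNormedModule.Class C_AbsRing (BOp X)
       (NormedModule.class _ BOp_NormedModule) BOp_CompleteSpace_mixin) (BOp X).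

End BOp_structure.

(* A complex Banach space as a real one, since [RInt] takes its values in
   complete normed modules over [R]. *)
Section Restriction.

Variable V : CompleteNormedModule C_AbsRing.

Definition realify_ModuleSpace_mixin :
  ModuleSpace.mixin_of R_Ring (CompleteNormedModule.AbelianGroup C_AbsRing V).
Proof.
refine (ModuleSpace.Mixin R_Ring (CompleteNormedModule.AbelianGroup C_AbsRing V)
  (fun (r : R) (v : V) => scal (RtoC r) v) _ _ _ _).
- intros x y u; rewrite scal_assoc; f_equal.
  change (RtoC (x * y)) with (RtoC (Rmult x y)); now rewrite RtoC_mult.
- intros u; exact (scal_one (V := V) u).
- intros x u v; exact (scal_distr_l (V := V) (RtoC x) u v).
- intros x y u; change (plus x y) with (Rplus x y); rewrite RtoC_plus.
  exact (scal_distr_r (V := V) (RtoC x) (RtoC y) u).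
Defined.

Definition realify_NormedModuleAux : NormedModuleAux R_AbsRing :=
  NormedModuleAux.Pack R_AbsRing V
    (NormedModuleAux.Class R_AbsRing V
       (ModuleSpace.Class R_Ring V
         (AbelianGroup.class (CompleteNormedModule.AbelianGroup C_AbsRing V))
         realify_ModuleSpace_mixin)
       (UniformSpace.class (CompleteNormedModule.UniformSpace C_AbsRing V))) V.

Definition realify_NormedModule_mixin :
  NormedModule.mixin_of R_AbsRing realify_NormedModuleAux.
Proof.
refine (NormedModule.Mixin R_AbsRing realify_NormedModuleAux
  (fun v : V => norm v) (norm_factor (V := V)) _ _ _ _ _).
- intros x y; apply (norm_triangle (V := V)).
- intros r x; change (abs r) with (Rabs r); rewrite <- Cmod_R.
  exact (norm_scal (V := V) (RtoC r) x).
- intros x y e; apply (norm_compat1 (V := V)).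
- intros x y e; apply (norm_compat2 (V := V)).
- intros x; apply (norm_eq_zero (V := V)).
Defined.

Definition realify : CompleteNormedModule R_AbsRing :=
  CompleteNormedModule.Pack R_AbsRing V
    (CompleteNormedModule.Class R_AbsRing V
       (NormedModule.Class R_AbsRing V
         (NormedModuleAux.class R_AbsRing realify_NormedModuleAux)
         realify_NormedModule_mixin)
       (CompleteSpace.mixin _
         (CompleteSpace.class (CompleteNormedModule.CompleteSpace C_AbsRing V)))) V.

End Restriction.

Section Spectrum.

Context {X : CompleteNormedModule C_AbsRing}.
Implicit Types S T : BOp X.

Definition is_inverse T S : Prop :=
  bop_comp S T = bop_id /\ bop_comp T S = bop_id.

Definition spectrum T (z : C) : Prop :=
  ~ exists S, is_inverse (minus (scal z bop_id) T) S.

(* The inverse of [z I - T]; arbitrary when [z] lies in the spectrum. *)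
Definition resolvent T (z : C) : BOp X :=
  epsilon (inhabits bop_zero) (is_inverse (minus (scal z bop_id) T)).

End Spectrum.

(* A segment [(a, b)] is oriented from [a] to [b]. *)
Definition segment_point (s : C * C) (t : R) : C :=
  (fst s + RtoC t * (snd s - fst s))%C.

Definition segment_integral {V : CompleteNormedModule C_AbsRing}
    (g : C -> V) (s : C * C) : V :=
  RInt (V := realify V)
    (fun t => scal (snd s - fst s)%C (g (segment_point s t))) 0 1.

Definition contour_integral {V : CompleteNormedModule C_AbsRing}
    (g : C -> V) (G : list (C * C)) : V :=
  fold_right (fun s v => plus (segment_integral g s) v) zero G.

(* Contours are polygonal cycles: finitely many oriented segments such that
   every point is an initial point as often as it is a terminal point. *)
Definition is_contour (G : list (C * C)) : Prop :=
  Permutation (map fst G) (map snd G).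

Definition winding_number (G : list (C * C)) (w : C) : C :=
  (/ (2 * PI * Ci) *
     contour_integral (V := C_CompleteNormedModule) (fun z => / (z - w)) G)%C.

Definition surrounds (K Omega : C -> Prop) (G : list (C * C)) : Prop :=
  is_contour G /\
  (forall s t, In s G -> 0 <= t <= 1 ->
     Omega (segment_point s t) /\ ~ K (segment_point s t)) /\
  (forall w, K w -> winding_number G w = RtoC 1) /\
  (forall w, ~ Omega w -> winding_number G w = RtoC 0).

Definition holomorphic_on (Omega : C -> Prop) (f : C -> C) : Prop :=
  open Omega /\
  forall z, Omega z -> ex_derive (K := C_AbsRing) (V := C_NormedModule) f z.

Section Calculus.

Context {X : CompleteNormedModule C_AbsRing}.
Implicit Types A B T Y : BOp X.

(* [f(T)] is the integral of [f(z) (z - T)^-1 dz / (2 i pi)] along a contour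
   surrounding the spectrum of [T] in [Omega].  Such contours exist when [Omega]
   is an open neighborhood of the spectrum and, for [f] holomorphic on [Omega],
   Cauchy's theorem makes the integral independent of the one selected. *)
Definition riesz (Omega : C -> Prop) (f : C -> C) T : BOp X :=
  let G := epsilon (inhabits nil) (surrounds (spectrum T) Omega) in
  scal (/ (2 * PI * Ci))%C
    (contour_integral (fun z => scal (f z) (resolvent T z)) G).

Definition gderiv A B Y : BOp X := minus (bop_comp A Y) (bop_comp Y B).

Definition null_space (D : BOp X -> BOp X) Y : Prop := D Y = zero.

Definition range (D : BOp X -> BOp X) Y : Prop := exists Z, D Z = Y.

Definition norm_closure (E : BOp X -> Prop) Y : Prop :=
  forall eps : posreal, exists Z, E Z /\ norm (minus Z Y) < eps.

End Calculus.

(* Main.v *)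
Require Import Defs.
From Stdlib Require Import Reals Lra Lia ZArith List Permutation FinFun.
From Stdlib Require Import ClassicalEpsilon Classical.
From Coquelicot Require Import Coquelicot.
Import ListNotations.
Open Scope R_scope.

(* Let P(z) and Q(z) be inverse to alpha(z) - M and alpha(z) - N.  Then
     P(z) Y - Y Q(z) = delta_{M,N}(P(z) Y Q(z)) = P(z) delta_{M,N}(Y) Q(z),
   so if A and B are the integrals of phi(z) P(z) and phi(z) Q(z) along one contour,
   the range of delta_{A,B} lies in that of delta_{M,N} and the null space of
   delta_{M,N} in that of delta_{A,B}; no closure is needed.
   With alpha(z) = z, P and Q the resolvents of A and B and phi = f, this gives the
   inclusions for (f(A), f(B)), once the two Riesz integrals are moved to a common
   contour around both spectra by Cauchy's theorem.
   For injective f the roles are exchanged by taking alpha = f, phi(z) = z f'(z) and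
   P(z) = (f(z) - f(A))^-1, which is the function 1 / (f(z) - f(.)) of A; the
   integral of phi P along an outer contour is A by the residue formula
     1/(2 i pi) int z f'(z) / (f(z) - f(w)) dz = w,   valid because f' has no zero.
   Cauchy's theorem for cycles rests on grid contours: on a contour around the points
   where the winding number of G is nonzero, Cauchy's formula turns the integral of F
   along G into one against the winding number, which vanishes there. *)

(** * Linear identities in modules over [C] *)

(** The second part keeps the calculus on [Omega]: instead of an inverse function being applied to
    f(A), A is recovered by an integral over z in [Omega] whose kernel inverts f(z) - f(A). The
    price is a pair of nested contours. f(A) is an integral along [G1], and so is 1 / (f(z) - f(.))
    evaluated at A; this function has a pole at z, so the calculus along [G1] is multiplicative for
    it only if z is off [G1] and [G1] does not wind around z. The outer contour [G2] therefore has
    to surround the whole hull of [G1], not only the spectra. Integrals take values in an arbitrary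
    Banach space, since the same theorems serve scalar kernels and operator-valued resolvents.
    Cauchy's formula is first shown for primitives, where it needs only Fubini and Cauchy's theorem
    in a box; this makes differentiable functions infinitely differentiable, and so the difference
    quotient of F at w differentiable at w as well. The formula along a general cycle is then
    Cauchy's theorem for that quotient. *)

Inductive vexp : Type :=
| VVar (n : nat)
| VZero
| VPlus (e1 e2 : vexp)
| VOpp (e : vexp)
| VScal (c : C) (e : vexp).

Section Vexp.

Context {V : ModuleSpace C_Ring}.

Fixpoint veval (env : list V) (e : vexp) : V :=
  match e with
  | VVar n => nth n env zero
  | VZero => zero
  | VPlus e1 e2 => plus (veval env e1) (veval env e2)
  | VOpp e => opp (veval env e)
  | VScal c e => scal c (veval env e)
  end.

Fixpoint vcoef (e : vexp) (k : nat) : C :=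
  match e with
  | VVar n => if Nat.eqb n k then RtoC 1 else RtoC 0
  | VZero => RtoC 0
  | VPlus e1 e2 => (vcoef e1 k + vcoef e2 k)%C
  | VOpp e => (- vcoef e k)%C
  | VScal c e => (c * vcoef e k)%C
  end.

Fixpoint vcomb (f : nat -> C) (env : list V) : V :=
  match env with
  | nil => zero
  | cons v env' => plus (scal (f O) v) (vcomb (fun n => f (S n)) env')
  end.

Lemma vcomb_ext f g env :
  (forall n, (n < length env)%nat -> f n = g n) -> vcomb f env = vcomb g env.
Proof.
revert f g; induction env as [|v env IH]; simpl; intros f g H; [easy|].
rewrite (H O) by lia; f_equal; apply IH; intros n Hn; apply H; lia.
Qed.

Lemma vcomb_zero env : vcomb (fun _ => RtoC 0) env = zero.
Proof.
induction env as [|v env IH]; simpl; [easy|].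
rewrite IH, plus_zero_r; exact (scal_zero_l v).
Qed.

Lemma vcomb_plus f g env :
  vcomb (fun n => f n + g n)%C env = plus (vcomb f env) (vcomb g env).
Proof.
revert f g; induction env as [|v env IH]; simpl; intros f g.
{ now rewrite plus_zero_r. }
rewrite (IH (fun n => f (S n)) (fun n => g (S n))).
rewrite (scal_distr_r (f O) (g O) v : scal (f O + g O)%C v = _).
rewrite <- !plus_assoc; f_equal; rewrite !plus_assoc; f_equal; apply plus_comm.
Qed.

Lemma vcomb_scal c f env : vcomb (fun n => c * f n)%C env = scal c (vcomb f env).
Proof.
revert f; induction env as [|v env IH]; simpl; intros f.
{ now rewrite scal_zero_r. }
rewrite (IH (fun n => f (S n))), scal_distr_l; f_equal.
exact (eq_sym (scal_assoc c (f O) v)).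
Qed.

Lemma vcomb_var n env :
  vcomb (fun k => if Nat.eqb n k then RtoC 1 else RtoC 0) env = nth n env zero.
Proof.
revert n; induction env as [|v env IH]; intros [|n]; simpl; try easy.
- rewrite vcomb_zero, plus_zero_r; exact (scal_one v).
- rewrite IH; transitivity (plus zero (nth n env zero)); [f_equal; exact (scal_zero_l v)|].
  apply plus_zero_l.
Qed.

Lemma veval_comb env e : veval env e = vcomb (vcoef e) env.
Proof.
induction e; simpl.
- symmetry; apply vcomb_var.
- symmetry; apply vcomb_zero.
- rewrite IHe1, IHe2; symmetry; apply vcomb_plus.
- rewrite IHe, <- (scal_opp_one (vcomb (vcoef e) env)).
  rewrite <- (vcomb_scal (opp one)); apply vcomb_ext; intros.
  change (- RtoC 1 * vcoef e n = - vcoef e n)%C; ring.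
- rewrite IHe; symmetry; apply vcomb_scal.
Qed.

(** Soundness of the reflection behind [vec]: an identity between linear combinations follows from
    one scalar identity per atom, which [ring] or [field] can settle. *)
Lemma veval_eq env e1 e2 :
  (forall n, (n < length env)%nat -> vcoef e1 n = vcoef e2 n) ->
  veval env e1 = veval env e2.
Proof. intros H; rewrite !veval_comb; now apply vcomb_ext. Qed.

End Vexp.

Ltac vec_mem x l :=
  lazymatch l with
  | nil => constr:(false)
  | cons x _ => constr:(true)
  | cons _ ?l' => vec_mem x l'
  end.
Ltac vec_atoms t l :=
  lazymatch t with
  | @plus _ ?a ?b => let l1 := vec_atoms a l in vec_atoms b l1
  | @minus _ ?a ?b => let l1 := vec_atoms a l in vec_atoms b l1
  | @opp _ ?a => vec_atoms a l
  | @zero _ => l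
  | @scal _ _ ?c ?a => vec_atoms a l
  | _ => let b := vec_mem t l in
         lazymatch b with true => l | false => constr:(cons t l) end
  end.
Ltac vec_index x l :=
  lazymatch l with
  | cons x _ => constr:(O)
  | cons _ ?l' => let n := vec_index x l' in constr:(S n)
  end.
Ltac vec_reify t l :=
  lazymatch t with
  | @plus _ ?a ?b =>
      let e1 := vec_reify a l in let e2 := vec_reify b l in constr:(VPlus e1 e2)
  | @minus _ ?a ?b =>
      let e1 := vec_reify a l in let e2 := vec_reify b l in constr:(VPlus e1 (VOpp e2))
  | @opp _ ?a => let e := vec_reify a l in constr:(VOpp e)
  | @zero _ => constr:(VZero)
  | @scal _ _ ?c ?a => let e := vec_reify a l in constr:(VScal c e)
  | _ => let n := vec_index t l in constr:(VVar n)
  end.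
(* Reduces an equation in the module [V] to the equations between coefficients. *)
Ltac vec_with V tac :=
  lazymatch goal with
  | |- ?a = ?b =>
      let T := constr:(ModuleSpace.sort C_Ring V) in
      let l0 := constr:(@nil T) in
      let l1 := vec_atoms a l0 in
      let l2 := vec_atoms b l1 in
      let e1 := vec_reify a l2 in
      let e2 := vec_reify b l2 in
      (* The goal may mix operations of several convertible structures. The first [change] restates
         it with the operations of [V], the second folds it into [veval]. *)
      let x1 := eval cbv [veval List.nth] in (@veval V l2 e1) in
      let x2 := eval cbv [veval List.nth] in (@veval V l2 e2) in
      change (x1 = x2);
      change (@veval V l2 e1 = @veval V l2 e2);
      refine (@veval_eq V l2 e1 e2 _);
      let n := fresh "n" in let Hn := fresh "Hn" in
      intros n Hn; simpl in Hn;
      repeat first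
        [ exfalso; clear - Hn; lia
        | destruct n as [|n]; [cbn [vcoef Nat.eqb]; clear Hn; tac|] ]
  end.
Ltac vec V := cbv beta; vec_with V ltac:(change (@mult C_AbsRing) with Cmult;
   change (@plus C_AbsRing) with Cplus; try ring).

(** * Continuity and complex differentiability *)

Lemma locally_Cmod (z : C) (P : C -> Prop) :
  locally (T := C_UniformSpace) z P <->
  exists d, 0 < d /\ forall w, Cmod (w - z) < d -> P w.
Proof.
rewrite locally_C; split.
- intros [d Hd]; exists d; split; [apply cond_pos|exact Hd].
- intros [d [d0 Hd]]; exists (mkposreal d d0); exact Hd.
Qed.

Lemma open_Cmod (D : C -> Prop) (z : C) :
  open D -> D z -> exists d, 0 < d /\ forall w, Cmod (w - z) < d -> D w.
Proof. intros HD Hz; apply locally_Cmod, HD, Hz. Qed.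

Lemma continuous_norm {T : UniformSpace} {K : AbsRing} {V : NormedModule K} (f : T -> V) x :
  continuous f x <->
  forall eps, 0 < eps -> locally x (fun y => norm (minus (f y) (f x)) < eps).
Proof.
unfold continuous; rewrite (filterlim_locally_ball_norm f (f x)); split.
- intros H eps He; exact (H (mkposreal eps He)).
- intros H eps; exact (H eps (cond_pos eps)).
Qed.

Lemma continuous_C_norm {V : CompleteNormedModule C_AbsRing} (f : C -> V) (z : C) :
  continuous (T := C_UniformSpace) f z <->
  forall eps, 0 < eps -> exists d, 0 < d /\
    forall w, Cmod (w - z) < d -> norm (minus (f w) (f z)) < eps.
Proof.
pose proof (continuous_norm (T := C_UniformSpace) (V := V) f z) as E; split; intros H.
- intros eps He; apply locally_Cmod, (proj1 E H eps He).
- apply (proj2 E); intros eps He; apply locally_Cmod, (H eps He).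
Qed.

Lemma continuous_lipschitz {K K' : AbsRing} {U : NormedModule K} {V : NormedModule K'}
    (f : U -> V) x M :
  (forall y, norm (minus (f y) (f x)) <= M * norm (minus y x)) -> continuous f x.
Proof.
intros H; apply continuous_norm; intros eps He.
assert (P : 0 < Rabs M + 1) by (pose proof (Rabs_pos M); lra).
assert (Pe : 0 < eps / (Rabs M + 1)) by (apply Rdiv_lt_0_compat; lra).
generalize (locally_ball_norm (V := U) x (mkposreal _ Pe)); apply filter_imp.
intros y Hy; unfold ball_norm in Hy; simpl in Hy.
eapply Rle_lt_trans; [apply H|].
apply Rle_lt_trans with ((Rabs M + 1) * norm (minus y x)).
- apply Rmult_le_compat_r; [apply norm_ge_0|]; pose proof (Rle_abs M); lra.
- apply Rmult_lt_compat_l with (r := Rabs M + 1) in Hy; [|lra].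
  replace ((Rabs M + 1) * (eps / (Rabs M + 1))) with eps in Hy by (field; lra); lra.
Qed.

(* Coquelicot states these for the uniform structure of the absolute ring, which
   is not convertible to the product structure of [C]. *)
Lemma continuous_AbsRing_C {T : UniformSpace} (k : T -> C) x :
  continuous (U := C_UniformSpace) k x <->
  continuous (U := AbsRing_UniformSpace C_AbsRing) k x.
Proof.
split; intros H P HP; apply H; now apply locally_C.
Qed.

Lemma continuous_scal_C {T : UniformSpace} {V : NormedModule C_AbsRing}
    (k : T -> C) (f : T -> V) x :
  continuous (U := C_UniformSpace) k x -> continuous f x ->
  continuous (fun y => scal (k y) (f y)) x.
Proof. intros Hk; apply (continuous_scal (K := C_AbsRing)); now apply continuous_AbsRing_C. Qed.

Lemma continuous_mult_C {T : UniformSpace} (f g : T -> C) x :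
  continuous (U := C_UniformSpace) f x -> continuous (U := C_UniformSpace) g x ->
  continuous (U := C_UniformSpace) (fun y => f y * g y)%C x.
Proof. exact (continuous_scal_C (V := C_NormedModule) f g x). Qed.

Lemma continuous_minus_C {T : UniformSpace} (f g : T -> C) x :
  continuous (U := C_UniformSpace) f x -> continuous (U := C_UniformSpace) g x ->
  continuous (U := C_UniformSpace) (fun y => f y - g y)%C x.
Proof. exact (continuous_minus (V := C_NormedModule) f g x). Qed.

Lemma Cmod_minus_sym (z w : C) : Cmod (z - w) = Cmod (w - z).
Proof. rewrite <- Cmod_opp; f_equal; ring. Qed.

Lemma Cmod_triangle_minus (z w u : C) : Cmod (z - u) <= Cmod (z - w) + Cmod (w - u).
Proof. replace (z - u)%C with ((z - w) + (w - u))%C by ring; apply Cmod_triangle. Qed.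

Lemma Cmod_eq_minus (z w : C) : Cmod (z - w) = 0 -> z = w.
Proof.
intros H; apply Cmod_eq_0 in H.
replace z with ((z - w) + w)%C by ring; rewrite H; ring.
Qed.

Lemma norm_scal_C {V : NormedModule C_AbsRing} (c : C) (v : V) :
  norm (scal c v) <= Cmod c * norm v.
Proof. exact (norm_scal (K := C_AbsRing) (V := V) c v). Qed.

Lemma is_derive_norm {V : NormedModule C_AbsRing} (f : C -> V) (z : C) (l : V) :
  is_derive (K := C_AbsRing) f z l <->
  forall eps, 0 < eps -> exists d, 0 < d /\ forall w, Cmod (w - z) < d ->
    norm (minus (minus (f w) (f z)) (scal (w - z)%C l)) <= eps * Cmod (w - z).
Proof.
split.
- intros [_ H] eps He; apply locally_Cmod, locally_C.
  apply (H z (fun P HP => HP) (mkposreal eps He)).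
- intros H; split; [exact (is_linear_scal_l (K := C_AbsRing) (V := V) l)|].
  intros y Hy; apply (is_filter_lim_locally_unique (V := AbsRing_NormedModule C_AbsRing)) in Hy.
  subst y; intros eps; apply locally_C, locally_Cmod, (H eps (cond_pos eps)).
Qed.

Lemma is_derive_continuous {V : NormedModule C_AbsRing} (f : C -> V) (z : C) (l : V) :
  is_derive (K := C_AbsRing) f z l -> continuous (T := C_UniformSpace) f z.
Proof.
intros H P HP; apply locally_C.
exact (ex_derive_continuous (K := C_AbsRing) f z (ex_intro _ l H) P HP).
Qed.

Lemma is_derive_ext_C {V : NormedModule C_AbsRing} (f g : C -> V) (z : C) (l : V) d :
  0 < d -> (forall w, Cmod (w - z) < d -> f w = g w) ->
  is_derive (K := C_AbsRing) f z l -> is_derive (K := C_AbsRing) g z l.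
Proof.
intros d0 Hd; apply (is_derive_ext_loc (K := C_AbsRing)).
apply locally_C, locally_Cmod; now exists d.
Qed.

(** Two linear approximations of the same increment differ by at most [eps * d] at distance [d], and
    their difference is [d] times [l1 - l2]. *)
Lemma is_derive_C_unique {V : NormedModule C_AbsRing} (f : C -> V) (z : C) (l1 l2 : V) :
  is_derive (K := C_AbsRing) f z l1 -> is_derive (K := C_AbsRing) f z l2 -> l1 = l2.
Proof.
intros H1 H2.
assert (E : norm (minus l1 l2) = 0).
{ apply Rle_antisym; [|apply norm_ge_0].
  apply le_epsilon; intros eps He; rewrite Rplus_0_l.
  destruct (proj1 (is_derive_norm _ _ _) H1 (eps / 2)) as [d1 [P1 D1]]; [lra|].
  destruct (proj1 (is_derive_norm _ _ _) H2 (eps / 2)) as [d2 [P2 D2]]; [lra|].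
  set (d := Rmin d1 d2 / 2).
  assert (Pd : 0 < d) by (unfold d; pose proof (Rmin_pos d1 d2 P1 P2); lra).
  assert (Ed : Cmod ((z + RtoC d) - z) = d).
  { replace ((z + RtoC d) - z)%C with (RtoC d) by ring.
    rewrite Cmod_R; apply Rabs_right; lra. }
  specialize (D1 (z + RtoC d)%C); specialize (D2 (z + RtoC d)%C).
  rewrite Ed in D1, D2.
  pose proof (Rmin_l d1 d2); pose proof (Rmin_r d1 d2).
  assert (d < d1) by (unfold d in *; lra). assert (d < d2) by (unfold d in *; lra).
  specialize (D1 H3); specialize (D2 H4).
  replace ((z + RtoC d) - z)%C with (RtoC d) in D1, D2 by ring.
  set (D := minus (f (z + RtoC d)%C) (f z)) in *.
  assert (N : norm (scal (RtoC d) (minus l1 l2)) <= eps * d).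
  { replace (scal (RtoC d) (minus l1 l2)) with
      (plus (minus D (scal (RtoC d) l2)) (opp (minus D (scal (RtoC d) l1)))) by vec V.
    eapply Rle_trans; [apply norm_triangle|]; rewrite norm_opp; lra. }
  assert (S : minus l1 l2 = scal (RtoC (/ d)) (scal (RtoC d) (minus l1 l2))).
  { rewrite scal_assoc; change (mult (RtoC (/ d)) (RtoC d)) with (RtoC (/ d) * RtoC d)%C.
    rewrite <- RtoC_mult, Rinv_l by lra; symmetry; apply (scal_one (V := V)). }
  rewrite S; eapply Rle_trans; [apply norm_scal_C|].
  rewrite Cmod_R, Rabs_right.
  2: { apply Rle_ge, Rlt_le, Rinv_0_lt_compat, Pd. }
  apply Rmult_le_reg_l with d; auto.
  rewrite <- Rmult_assoc, Rinv_r, Rmult_1_l by lra; lra. }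
apply norm_eq_zero in E.
replace l1 with (plus (minus l1 l2) l2) by vec V.
rewrite E; apply plus_zero_l.
Qed.

Lemma is_derive_scal_C {V : NormedModule C_AbsRing} (k : C -> C) (f : C -> V) (z dk : C) (df : V) :
  is_derive (K := C_AbsRing) (V := C_NormedModule) k z dk ->
  is_derive (K := C_AbsRing) f z df ->
  is_derive (K := C_AbsRing) (fun w => scal (k w) (f w)) z
    (plus (scal dk (f z)) (scal (k z) df)).
Proof.
intros Hk Hf.
(* The product rule wants [k] to take values in the ring as a module over itself. The defining
   estimate is the same up to conversion, so [proj2 Hk] transfers. *)
assert (Hk' : filterdiff (K := C_AbsRing) (U := AbsRing_NormedModule C_AbsRing)
   (V := AbsRing_NormedModule C_AbsRing) k
   (locally (T := AbsRing_UniformSpace C_AbsRing) z) (fun y => scal y dk)).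
{ split; [exact (is_linear_scal_l (K := C_AbsRing) (V := AbsRing_NormedModule C_AbsRing) dk)|].
  exact (proj2 Hk). }
generalize (filterdiff_scal_fct (K := C_AbsRing) (U := AbsRing_NormedModule C_AbsRing) (V := V)
  z k f _ _ Cmult_comm Hk' Hf).
intros H; unfold is_derive; eapply filterdiff_ext_lin; [exact H|].
intros y; change (scal y dk) with (y * dk)%C.
rewrite scal_distr_l, !scal_assoc; f_equal; f_equal; apply Cmult_comm.
Qed.

Lemma is_derive_scal_const_C {V : NormedModule C_AbsRing} (c : C) (f : C -> V) (z : C) (l : V) :
  is_derive (K := C_AbsRing) f z l ->
  is_derive (K := C_AbsRing) (fun w => scal c (f w)) z (scal c l).
Proof.
intros Hf; apply is_derive_norm; intros eps He.
assert (P : 0 < Cmod c + 1) by (pose proof (Cmod_ge_0 c); lra).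
assert (Pe : 0 < eps / (Cmod c + 1)) by (apply Rdiv_lt_0_compat; lra).
destruct (proj1 (is_derive_norm _ _ _) Hf _ Pe) as [d [d0 Hd]].
exists d; split; auto; intros w Hw; specialize (Hd w Hw).
replace (minus _ _) with (scal c (minus (minus (f w) (f z)) (scal (w - z)%C l))) by vec V.
eapply Rle_trans; [apply norm_scal_C|].
apply Rle_trans with ((Cmod c + 1) * (eps / (Cmod c + 1) * Cmod (w - z))).
- apply Rmult_le_compat; auto; [apply Cmod_ge_0|apply norm_ge_0|lra].
- right; field; lra.
Qed.

Lemma is_derive_mult_C (f g : C -> C) (z df dg : C) :
  is_derive (K := C_AbsRing) (V := C_NormedModule) f z df ->
  is_derive (K := C_AbsRing) (V := C_NormedModule) g z dg ->
  is_derive (K := C_AbsRing) (V := C_NormedModule) (fun w => f w * g w)%C z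
    (df * g z + f z * dg)%C.
Proof. exact (is_derive_scal_C (V := C_NormedModule) f g z df dg). Qed.

Lemma is_derive_comp_C {V : NormedModule C_AbsRing} (f : C -> V) (g : C -> C) (z dg : C) (df : V) :
  is_derive (K := C_AbsRing) f (g z) df ->
  is_derive (K := C_AbsRing) (V := C_NormedModule) g z dg ->
  is_derive (K := C_AbsRing) (fun w => f (g w)) z (scal dg df).
Proof.
intros Hf Hg; apply (is_derive_comp (K := C_AbsRing)); [exact Hf|].
split; [exact (is_linear_scal_l (K := C_AbsRing) (V := AbsRing_NormedModule C_AbsRing) dg)|].
exact (proj2 Hg).
Qed.

Lemma is_derive_id_C (z : C) :
  is_derive (K := C_AbsRing) (V := C_NormedModule) (fun w => w) z (RtoC 1).
Proof.
apply is_derive_norm; intros eps He; exists 1; split; [lra|]; intros w _.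
match goal with |- norm ?x <= _ => replace x with (RtoC 0) end.
- change (norm (RtoC 0)) with (Cmod (RtoC 0)); rewrite Cmod_0.
  apply Rmult_le_pos; [lra|apply Cmod_ge_0].
- change (RtoC 0 = (w - z) - (w - z) * 1)%C; ring.
Qed.

Lemma is_derive_const_C (c z : C) :
  is_derive (K := C_AbsRing) (V := C_NormedModule) (fun _ => c) z (RtoC 0).
Proof. exact (is_derive_const (K := C_AbsRing) (V := C_NormedModule) c z). Qed.

Lemma is_derive_minus_C (f g : C -> C) (z df dg : C) :
  is_derive (K := C_AbsRing) (V := C_NormedModule) f z df ->
  is_derive (K := C_AbsRing) (V := C_NormedModule) g z dg ->
  is_derive (K := C_AbsRing) (V := C_NormedModule) (fun w => f w - g w)%C z (df - dg)%C.
Proof. exact (is_derive_minus (K := C_AbsRing) (V := C_NormedModule) f g z df dg). Qed.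

Lemma is_derive_eq {V : NormedModule C_AbsRing} (f : C -> V) (z : C) (l l' : V) :
  is_derive (K := C_AbsRing) f z l -> l = l' -> is_derive (K := C_AbsRing) f z l'.
Proof. intros H <-; exact H. Qed.

Ltac Ceq := cbv beta; match goal with |- @eq _ ?a ?b => change (@eq C a b) end.

Lemma is_derive_inv_C (z : C) : z <> RtoC 0 ->
  is_derive (K := C_AbsRing) (V := C_NormedModule) Cinv z (- / (z * z))%C.
Proof.
intros Hz; apply is_derive_norm; intros eps He.
assert (Pz : 0 < Cmod z) by now apply Cmod_gt_0.
(* The remainder is [(w - z)^2 / (w z^2)]. The first bound gives [|w| >= |z| / 2], hence a remainder
   of at most [2 |w - z|^2 / |z|^3]; the second makes this at most [eps |w - z|]. *)
set (d := Rmin (Cmod z / 2) (eps * (Cmod z * Cmod z * Cmod z) / 2)).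
assert (P3 : 0 < Cmod z * Cmod z * Cmod z) by (repeat apply Rmult_lt_0_compat; auto).
exists d; split.
{ apply Rmin_pos; [lra|]; pose proof (Rmult_lt_0_compat _ _ He P3); lra. }
intros w Hw.
assert (H1 : Cmod (w - z) < Cmod z / 2) by (eapply Rlt_le_trans; [exact Hw|apply Rmin_l]).
assert (H2 : Cmod (w - z) < eps * (Cmod z * Cmod z * Cmod z) / 2)
  by (eapply Rlt_le_trans; [exact Hw|apply Rmin_r]).
assert (Pw : Cmod z / 2 <= Cmod w).
{ pose proof (Cmod_triangle (w) (z - w)).
  replace (w + (z - w))%C with z in H by ring.
  rewrite (Cmod_minus_sym z w) in H; lra. }
assert (Hw0 : w <> RtoC 0) by (apply Cmod_gt_0; lra).
match goal with |- norm ?x <= _ =>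
  replace x with ((w - z) * (w - z) / (w * (z * z)))%C end.
2: { change ((w - z) * (w - z) / (w * (z * z)) = (/ w - / z) - (w - z) * (- / (z * z)))%C.
     now field. }
change (norm ((w - z) * (w - z) / (w * (z * z)))%C)
  with (Cmod ((w - z) * (w - z) / (w * (z * z)))%C).
rewrite Cmod_div, !Cmod_mult.
2: { repeat apply Cmult_neq_0; auto. }
rewrite (Rmult_comm eps); unfold Rdiv; rewrite Rmult_assoc.
apply Rmult_le_compat_l; [apply Cmod_ge_0|].
assert (Pden : 0 < Cmod w * (Cmod z * Cmod z)) by (repeat apply Rmult_lt_0_compat; lra).
apply Rmult_le_reg_r with (Cmod w * (Cmod z * Cmod z)); auto.
rewrite Rmult_assoc, Rinv_l, Rmult_1_r by lra.
apply Rle_trans with (eps * (Cmod z * Cmod z * Cmod z) / 2); [lra|].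
unfold Rdiv; rewrite (Rmult_assoc eps); apply Rmult_le_compat_l; [lra|].
apply Rmult_le_compat_r with (r := Cmod z * Cmod z) in Pw; [lra|].
apply Rmult_le_pos; lra.
Qed.

Lemma continuous_inv_C {T : UniformSpace} (f : T -> C) x :
  continuous (U := C_UniformSpace) f x -> f x <> RtoC 0 ->
  continuous (U := C_UniformSpace) (fun y => / f y)%C x.
Proof.
intros Hf H0.
apply (continuous_comp (U := T) (V := C_UniformSpace) (W := C_UniformSpace) f Cinv); auto.
exact (is_derive_continuous (V := C_NormedModule) _ _ _ (is_derive_inv_C _ H0)).
Qed.

(** * Segments *)

Definition on_segment (s : C * C) (z : C) : Prop :=
  exists t, 0 <= t <= 1 /\ z = segment_point s t.

Lemma segment_point_minus (s : C * C) t t' :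
  (segment_point s t' - segment_point s t = RtoC (t' - t) * (snd s - fst s))%C.
Proof. unfold segment_point; rewrite RtoC_minus; ring. Qed.

Lemma continuous_segment_point (s : C * C) t :
  continuous (U := C_UniformSpace) (segment_point s) t.
Proof.
apply (continuous_lipschitz (U := R_NormedModule) (V := C_NormedModule)
  _ t (Cmod (snd s - fst s))).
intros y.
change (Cmod (segment_point s y - segment_point s t) <=
  Cmod (snd s - fst s) * Rabs (y - t)).
rewrite segment_point_minus, Cmod_mult, Cmod_R; lra.
Qed.

Definition segment_rev (s : C * C) : C * C := (snd s, fst s).

Lemma on_segment_rev s z : on_segment (segment_rev s) z <-> on_segment s z.
Proof.
assert (H : forall s, on_segment (segment_rev s) z -> on_segment s z).
{ intros [a b] [t [Ht E]]; exists (1 - t); split; [lra|]; rewrite E.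
  unfold segment_point; simpl; rewrite RtoC_minus; ring. }
split; [apply H|]; intros Hz; apply H; destruct s; exact Hz.
Qed.

Section SegmentIntegral.

Context {V : CompleteNormedModule C_AbsRing}.
Implicit Types g h : C -> V.

(** Continuity at the points of [D] as a function on the whole plane, which is stronger than
    continuity of the restriction to [D]. *)
Definition cont_on (D : C -> Prop) g : Prop :=
  forall z, D z -> continuous (T := C_UniformSpace) g z.

Lemma continuous_segment_integrand g s t :
  continuous (T := C_UniformSpace) g (segment_point s t) ->
  continuous (U := realify V)
    (fun t => scal (snd s - fst s)%C (g (segment_point s t)) : V) t.
Proof.
intros H; apply (continuous_scal_r (V := V) (snd s - fst s)%C).
apply (continuous_comp (U := R_UniformSpace) (V := C_UniformSpace) (segment_point s) g); auto.
apply continuous_segment_point.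
Qed.

(** Kept beside the stronger [cont_on] for iterated integrals: an inner integral is controlled only
    at parameters on the outer segment, not in a neighborhood of it in the plane. *)
Definition integrable g s : Prop :=
  ex_RInt (V := realify V) (fun t => scal (snd s - fst s)%C (g (segment_point s t))) 0 1.

Lemma ex_segment_integral g s : cont_on (on_segment s) g -> integrable g s.
Proof.
intros H; apply (ex_RInt_continuous (V := realify V)); intros t.
rewrite Rmin_left, Rmax_right by lra; intros Ht.
apply continuous_segment_integrand, H; now exists t.
Qed.

Lemma segment_integral_ext g h s :
  (forall z, on_segment s z -> g z = h z) -> segment_integral g s = segment_integral h s.
Proof.
intros H; apply (RInt_ext (V := realify V)); intros t.
rewrite Rmin_left, Rmax_right by lra; intros Ht.
rewrite H; [easy|]; exists t; split; [lra|easy].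
Qed.

Lemma segment_integral_plus g h s :
  integrable g s -> integrable h s ->
  segment_integral (fun z => plus (g z) (h z)) s =
  plus (segment_integral g s) (segment_integral h s).
Proof.
intros Hg Hh; unfold segment_integral.
etransitivity; [|apply (RInt_plus (V := realify V)); assumption].
apply (RInt_ext (V := realify V)); intros t _.
exact (scal_distr_l (V := V) _ _ _).
Qed.

Lemma integrable_plus g h s :
  integrable g s -> integrable h s -> integrable (fun z => plus (g z) (h z)) s.
Proof.
intros Hg Hh; unfold integrable.
apply (ex_RInt_ext (V := realify V) (fun t : R => plus
  (scal (snd s - fst s)%C (g (segment_point s t)))
  (scal (snd s - fst s)%C (h (segment_point s t))))).
- intros t _; exact (eq_sym (scal_distr_l (V := V) _ _ _)).
- exact (ex_RInt_plus (V := realify V) _ _ _ _ Hg Hh).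
Qed.

Lemma norm_segment_integral_le g s M :
  cont_on (on_segment s) g -> (forall z, on_segment s z -> norm (g z) <= M) ->
  norm (segment_integral g s) <= Cmod (snd s - fst s) * M.
Proof.
intros Hg HM; unfold segment_integral.
replace (Cmod (snd s - fst s) * M) with ((1 - 0) * (Cmod (snd s - fst s) * M)) by ring.
apply (norm_RInt_le_const (V := realify V)
  (fun t => scal (snd s - fst s)%C (g (segment_point s t)))); [lra| |].
- intros t Ht; eapply Rle_trans; [exact (norm_scal_C (V := V) _ _)|].
  apply Rmult_le_compat_l; [apply Cmod_ge_0|]; apply HM; now exists t.
- exact (RInt_correct (V := realify V) _ _ _ (ex_segment_integral _ _ Hg)).
Qed.

Lemma segment_integral_rev g s : cont_on (on_segment s) g ->
  segment_integral g (segment_rev s) = opp (segment_integral g s).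
Proof.
intros Hg; unfold segment_integral.
set (f := fun t => scal (snd s - fst s)%C (g (segment_point s t))).
pose proof (ex_segment_integral _ _ Hg) as Hf; fold f in Hf.
etransitivity; [|exact (eq_sym (opp_RInt_swap (V := realify V) f 0 1 Hf))].
(* The bounds are written as images of 0 and 1 under [t -> 1 - t], the shape in which
   [RInt_comp_lin] applies. *)
replace (RInt (V := realify V) f 1 0) with
  (RInt (V := realify V) f (- (1) * 0 + 1) (- (1) * 1 + 1)) by (f_equal; ring).
rewrite <- (RInt_comp_lin (V := realify V)).
2: { replace (- (1) * 0 + 1) with 1 by ring; replace (- (1) * 1 + 1) with 0 by ring.
     exact (ex_RInt_swap (V := realify V) _ _ _ Hf). }
apply (RInt_ext (V := realify V)); intros t _.
change (scal (snd (segment_rev s) - fst (segment_rev s))%C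
    (g (segment_point (segment_rev s) t)) = scal (RtoC (- (1))) (f (- (1) * t + 1))).
unfold f.
replace (segment_point (segment_rev s) t) with (segment_point s (- (1) * t + 1)).
- simpl; vec V; rewrite RtoC_opp; ring.
- unfold segment_point; simpl; rewrite RtoC_plus, RtoC_mult, RtoC_opp; ring.
Qed.

Lemma segment_integral_split g a b t : 0 <= t <= 1 ->
  cont_on (on_segment (a, b)) g ->
  let c := segment_point (a, b) t in
  segment_integral g (a, b) = plus (segment_integral g (a, c)) (segment_integral g (c, b)).
Proof.
intros Ht Hg c; unfold segment_integral; simpl fst; simpl snd.
set (f := fun t => scal (b - a)%C (g (segment_point (a, b) t))).
pose proof (ex_segment_integral _ _ Hg) as Hf; simpl in Hf; fold f in Hf.
assert (H1 : ex_RInt (V := realify V) f 0 t)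
  by exact (ex_RInt_Chasles_1 (V := realify V) f 0 t 1 Ht Hf).
assert (H2 : ex_RInt (V := realify V) f t 1)
  by exact (ex_RInt_Chasles_2 (V := realify V) f 0 t 1 Ht Hf).
etransitivity; [exact (eq_sym (RInt_Chasles (V := realify V) f 0 t 1 H1 H2))|].
assert (E1 : RInt (V := realify V) f 0 t = RInt (V := realify V) f (t * 0 + 0) (t * 1 + 0))
  by (f_equal; ring).
assert (E2 : RInt (V := realify V) f t 1 =
    RInt (V := realify V) f ((1 - t) * 0 + t) ((1 - t) * 1 + t)) by (f_equal; ring).
f_equal.
- rewrite E1, <- (RInt_comp_lin (V := realify V)).
  2: { now replace (t * 0 + 0) with 0 by ring; replace (t * 1 + 0) with t by ring. }
  apply (RInt_ext (V := realify V)); intros u _.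
  change (scal (RtoC t) (f (t * u + 0)) = scal (c - a)%C (g (segment_point (a, c) u))).
  unfold f.
  replace (segment_point (a, c) u) with (segment_point (a, b) (t * u + 0)).
  + unfold c, segment_point; simpl; vec V.
  + unfold c, segment_point; simpl; rewrite RtoC_plus, RtoC_mult; ring.
- rewrite E2, <- (RInt_comp_lin (V := realify V)).
  2: { now replace ((1 - t) * 0 + t) with t by ring; replace ((1 - t) * 1 + t) with 1 by ring. }
  apply (RInt_ext (V := realify V)); intros u _.
  change (scal (RtoC (1 - t)) (f ((1 - t) * u + t)) = scal (b - c)%C (g (segment_point (c, b) u))).
  unfold f.
  replace (segment_point (c, b) u) with (segment_point (a, b) ((1 - t) * u + t)).
  + unfold c, segment_point; simpl; vec V; rewrite RtoC_minus; ring.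
  + unfold c, segment_point; simpl; rewrite RtoC_plus, RtoC_mult, RtoC_minus; ring.
Qed.

Lemma segment_integral_derive (F : C -> V) g s :
  (forall z, on_segment s z -> is_derive (K := C_AbsRing) F z (g z)) ->
  cont_on (on_segment s) g ->
  segment_integral g s = minus (F (snd s)) (F (fst s)).
Proof.
intros HF Hg.
assert (E : is_RInt (V := realify V)
  (fun t => scal (snd s - fst s)%C (g (segment_point s t))) 0 1
  (minus (F (segment_point s 1)) (F (segment_point s 0)))).
{ apply (is_RInt_derive (V := realify V) (fun t => F (segment_point s t))).
  2: { intros t; rewrite Rmin_left, Rmax_right by lra; intros Ht.
       apply continuous_segment_integrand, Hg; now exists t. }
  intros t; rewrite Rmin_left, Rmax_right by lra; intros Ht.
  split.
  { exact (is_linear_scal_l (K := R_AbsRing) (V := realify V)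
      (scal (snd s - fst s)%C (g (segment_point s t)))). }
  intros y Hy; apply (is_filter_lim_locally_unique (V := R_NormedModule)) in Hy; subst y.
  intros eps.
  (* The speed of the parametrization. The tolerance is divided by [m + 1], since a degenerate
     segment has [m = 0]. *)
  set (m := Cmod (snd s - fst s)).
  assert (Pm : 0 < m + 1) by (pose proof (Cmod_ge_0 (snd s - fst s)); unfold m; lra).
  assert (Pe : 0 < eps / (m + 1)) by (apply Rdiv_lt_0_compat; [apply cond_pos|lra]).
  destruct (proj1 (is_derive_norm _ _ _) (HF (segment_point s t) (ex_intro _ t (conj Ht eq_refl)))
    _ Pe) as [d [Pd Hd]].
  assert (L : locally (T := R_UniformSpace) t
     (fun y => Cmod (segment_point s y - segment_point s t) < d)).
  { apply (continuous_segment_point s t (fun w => Cmod (w - segment_point s t) < d)).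
    apply locally_Cmod; now exists d. }
  revert L; apply filter_imp; intros y Hy; specialize (Hd _ Hy).
  rewrite segment_point_minus, Cmod_mult, Cmod_R in Hd; fold m in Hd.
  change (norm (minus (minus (F (segment_point s y)) (F (segment_point s t)))
    (scal (RtoC (y - t)) (scal (snd s - fst s)%C (g (segment_point s t))))) <=
    eps * Rabs (y - t)).
  replace (scal (RtoC (y - t)) (scal (snd s - fst s)%C (g (segment_point s t)))) with
    (scal (RtoC (y - t) * (snd s - fst s))%C (g (segment_point s t))) by vec V.
  eapply Rle_trans; [exact Hd|].
  replace (eps / (m + 1) * (Rabs (y - t) * m)) with ((eps * Rabs (y - t)) * (m / (m + 1)))
    by (field; lra).
  rewrite <- (Rmult_1_r (eps * Rabs (y - t))) at 2.
  apply Rmult_le_compat_l.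
  - apply Rmult_le_pos; [left; apply cond_pos|apply Rabs_pos].
  - apply Rmult_le_reg_r with (m + 1); auto.
    unfold Rdiv; rewrite Rmult_assoc, Rinv_l by lra; lra. }
replace (segment_point s 1) with (snd s) in E by (unfold segment_point; ring).
replace (segment_point s 0) with (fst s) in E by (unfold segment_point; ring).
exact (is_RInt_unique (V := realify V) _ _ _ _ E).
Qed.

Lemma segment_integral_const (v : V) s :
  segment_integral (fun _ => v) s = scal (snd s - fst s)%C v.
Proof.
unfold segment_integral; rewrite (RInt_const (V := realify V)).
change (scal (RtoC (1 - 0)) (scal (snd s - fst s)%C v) = scal (snd s - fst s)%C v).
vec V; rewrite RtoC_minus; ring.
Qed.

End SegmentIntegral.

Lemma Riemann_sum_linear {V W : NormedModule R_AbsRing} (L : V -> W) (f : R -> V) ptd :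
  is_linear L -> L (Riemann_sum f ptd) = Riemann_sum (fun t => L (f t)) ptd.
Proof.
intros HL; unfold Riemann_sum; destruct ptd as [h l]; simpl.
generalize (h, zero : R); induction l as [|x l IH]; intros p; simpl.
- exact (linear_zero L HL).
- rewrite (linear_plus _ HL), (linear_scal _ HL); f_equal; apply IH.
Qed.

(** A bounded linear map commutes with Riemann sums and is continuous, so it passes to their limit.
    This is how multiplication by a fixed operator, and later [gderiv] itself, goes under the
    integral sign. *)
Lemma is_RInt_linear {V W : NormedModule R_AbsRing} (L : V -> W) (f : R -> V) a b l :
  is_linear L -> is_RInt f a b l -> is_RInt (fun t => L (f t)) a b (L l).
Proof.
intros HL H; unfold is_RInt in *.
eapply (filterlim_ext (fun ptd => L (scal (sign (b - a)) (Riemann_sum f ptd)))).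
{ intros ptd; rewrite (linear_scal _ HL); f_equal; now apply Riemann_sum_linear. }
eapply filterlim_comp; [exact H|].
exact (linear_cont L _ HL).
Qed.

Lemma is_linear_realify {V W : CompleteNormedModule C_AbsRing} (L : V -> W) :
  is_linear L -> is_linear (K := R_AbsRing) (U := realify V) (V := realify W) L.
Proof.
intros [H1 H2 H3]; split; [exact H1| |exact H3].
intros k v; exact (H2 (RtoC k) v).
Qed.

Lemma segment_integral_linear {V W : CompleteNormedModule C_AbsRing} (L : V -> W) (g : C -> V) s :
  is_linear L -> cont_on (on_segment s) g ->
  segment_integral (fun z => L (g z)) s = L (segment_integral g s).
Proof.
intros HL Hg; apply (is_RInt_unique (V := realify W)).
apply (is_RInt_ext (V := realify W)
  (fun t => L (scal (snd s - fst s)%C (g (segment_point s t))))).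
{ intros t _; exact (linear_scal _ HL _ _). }
apply (is_RInt_linear (V := realify V) (W := realify W) L); [now apply is_linear_realify|].
exact (RInt_correct (V := realify V) _ _ _ (ex_segment_integral _ _ Hg)).
Qed.

(** * Iterated integrals *)

(** Compactness of [[a, b]]: the product neighborhoods given by joint continuity at the points
    [(x, t)] have radii bounded below along a subcover. Both [g x' y] and [g x y] are compared with
    [g x t], hence [eps / 2] for each. *)
Lemma tube {T : UniformSpace} {V : NormedModule R_AbsRing} (g : T -> R -> V) (x : T) a b eps :
  0 < eps ->
  (forall y, a <= y <= b -> continuous (fun p : T * R => g (fst p) (snd p)) (x, y)) ->
  locally x (fun x' => forall y, a <= y <= b -> norm (minus (g x' y) (g x y)) <= eps).
Proof.
intros He Hg.
assert (H : forall y, exists d : posreal, a <= y <= b -> forall x' y',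
  ball x d x' -> ball y d y' -> norm (minus (g x' y') (g x y)) < eps / 2).
{ intros y; destruct (classic (a <= y <= b)) as [Hy|Hy].
  - destruct (proj1 (continuous_norm _ _) (Hg y Hy) (eps / 2)) as [d Hd]; [lra|].
    exists d; intros _ x' y' Hx' Hy'; exact (Hd (x', y') (conj Hx' Hy')).
  - exists (mkposreal 1 Rlt_0_1); tauto. }
apply choice in H; destruct H as [d Hd].
destruct (compactness_value_1d a b d) as [e He'].
exists e; intros x' Hx' y Hy.
specialize (He' y Hy); apply NNPP in He'; destruct He' as [t [Ht [Hyt Het]]].
assert (B : ball t (d t) y) by exact Hyt.
pose proof (Hd t Ht x' y (ball_le x _ _ Het x' Hx') B) as H1.
pose proof (Hd t Ht x y (ball_center x (d t)) B) as H2.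
rewrite (minus_trans (g x t)).
eapply Rle_trans; [apply norm_triangle|].
rewrite <- (norm_opp (minus (g x t) (g x y))), opp_minus; lra.
Qed.

Section Fubini.

Context {V : CompleteNormedModule R_AbsRing}.
Implicit Types g : R -> R -> V.

Let continuous2 g := forall x y, continuous (fun p : R * R => g (fst p) (snd p)) (x, y).

Lemma continuous2_l g x : continuous2 g -> forall y, continuous (g x) y.
Proof.
intros Hg y.
apply (continuous_comp_2 (fun _ => x) (fun y => y) g y); [|apply continuous_id|apply Hg].
apply continuous_const.
Qed.

Lemma continuous2_swap g : continuous2 g -> continuous2 (fun x y => g y x).
Proof.
intros Hg x y.
apply (continuous_comp_2 snd fst g (x, y)); [apply continuous_snd|apply continuous_fst|apply Hg].
Qed.

Lemma ex_RInt_continuous2 g x a b : continuous2 g -> ex_RInt (g x) a b.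
Proof. intros Hg; apply ex_RInt_continuous; intros y _; now apply continuous2_l. Qed.

Lemma continuous_RInt_param g a b x :
  continuous2 g -> continuous (fun x => RInt (g x) a b) x.
Proof.
intros Hg; apply (proj2 (continuous_norm (V := V) _ x)); intros eps He.
assert (P : 0 < Rabs (b - a) + 1) by (pose proof (Rabs_pos (b - a)); lra).
assert (Pe : 0 < eps / (Rabs (b - a) + 1)) by (apply Rdiv_lt_0_compat; lra).
generalize (tube g x (Rmin a b) (Rmax a b) _ Pe (fun y _ => Hg x y)).
apply filter_imp; intros x' Hx'.
match goal with |- norm ?u < _ =>
  replace u with (RInt (fun y => minus (g x' y) (g x y)) a b)
    by (apply (RInt_minus (V := V)); now apply ex_RInt_continuous2) end.
eapply Rle_lt_trans.
- apply (norm_RInt_le_const_abs (V := V) (fun y => minus (g x' y) (g x y)) a b _ _ Hx').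
  apply RInt_correct, ex_RInt_continuous; intros y _.
  apply (continuous_minus (V := V)); now apply continuous2_l.
- apply Rlt_le_trans with ((Rabs (b - a) + 1) * (eps / (Rabs (b - a) + 1))).
  + apply Rmult_lt_compat_r; lra.
  + right; field; lra.
Qed.

(** The error of the linear approximation is the double integral of [g s y - g x y] for [s] between
    [x] and [x']; by [tube] this difference is small uniformly in [y]. *)
Lemma is_derive_RInt_upper g x : continuous2 g ->
  is_derive (fun x => RInt (fun y => RInt (fun s => g s y) 0 x) 0 1) x (RInt (g x) 0 1).
Proof.
intros Hg; split.
{ exact (is_linear_scal_l (K := R_AbsRing) (V := V) _). }
intros x0 Hx0; apply (is_filter_lim_locally_unique (V := R_NormedModule)) in Hx0; subst x0.
intros eps.
assert (C2 := continuous2_swap g Hg).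
assert (Cp : forall a b y, continuous (fun y => RInt (fun s => g s y) a b) y)
  by (intros a b y; now apply (continuous_RInt_param (fun y s => g s y))).
assert (Ex : forall a b, ex_RInt (fun y => RInt (fun s => g s y) a b) 0 1)
  by (intros a b; apply ex_RInt_continuous; intros; apply Cp).
destruct (tube g x 0 1 eps (cond_pos eps) (fun y _ => Hg x y)) as [d Hd].
exists d; intros x' Hx'.
assert (E : minus (minus (RInt (fun y => RInt (fun s => g s y) 0 x') 0 1)
    (RInt (fun y => RInt (fun s => g s y) 0 x) 0 1)) (scal (minus x' x) (RInt (g x) 0 1)) =
  RInt (fun y => RInt (fun s => minus (g s y) (g x y)) x x') 0 1).
{ symmetry; etransitivity.
  2: { apply (f_equal2 (minus (G := V))).
       - apply (RInt_minus (V := V) (fun y => RInt (fun s => g s y) 0 x')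
           (fun y => RInt (fun s => g s y) 0 x)); auto.
       - apply (RInt_scal (V := V) (g x) 0 1 (x' - x)); now apply ex_RInt_continuous2. }
  symmetry; etransitivity.
  { symmetry; apply (RInt_minus (V := V)).
    - apply (ex_RInt_minus (V := V)); auto.
    - apply (ex_RInt_scal (V := V)); now apply ex_RInt_continuous2. }
  apply (RInt_ext (V := V)); intros y _.
  symmetry; etransitivity.
  { apply (RInt_minus (V := V)).
    - now apply (ex_RInt_continuous2 (fun y s => g s y)).
    - apply ex_RInt_const. }
  rewrite (RInt_const (V := V)); apply (f_equal2 (minus (G := V))); [|easy].
  rewrite <- (RInt_Chasles (V := V) (fun s => g s y) 0 x x').
  2, 3: now apply (ex_RInt_continuous2 (fun y s => g s y)).
  rewrite (plus_comm (G := V)); unfold minus.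
  rewrite <- (plus_assoc (G := V)), (plus_opp_r (G := V)).
  symmetry; apply (plus_zero_r (G := V)). }
match goal with |- norm ?u <= _ =>
  replace u with (RInt (fun y => RInt (fun s => minus (g s y) (g x y)) x x') 0 1)
    by exact (eq_sym E) end.
match goal with |- _ <= ?u => replace u with (Rabs (1 - 0) * (Rabs (x' - x) * eps)) end.
2: { rewrite Rminus_0_r, Rabs_R1, Rmult_1_l, Rmult_comm; reflexivity. }
assert (Cm : forall y, forall s, continuous (fun s => minus (g s y) (g x y)) s).
{ intros y s; apply (continuous_minus (V := V)); [|apply continuous_const].
  now apply (continuous2_l (fun y s => g s y)). }
apply (norm_RInt_le_const_abs (V := V) (fun y => RInt (fun s => minus (g s y) (g x y)) x x') 0 1).
- intros y; rewrite Rmin_left, Rmax_right by lra; intros Hy.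
  apply (norm_RInt_le_const_abs (V := V) (fun s => minus (g s y) (g x y)) x x').
  + intros s Hs; apply Hd; auto.
    change (Rabs (s - x) < d).
    apply Rle_lt_trans with (Rabs (x' - x)); [|exact Hx'].
    revert Hs; unfold Rmin, Rmax; destruct (Rle_dec x x'); intros; split_Rabs; lra.
  + apply RInt_correct, ex_RInt_continuous; intros; apply Cm.
- apply RInt_correct, ex_RInt_continuous; intros y _.
  apply (continuous_RInt_param (fun y s => minus (g s y) (g x y))).
  intros u v; simpl.
  apply (continuous_minus (V := V) (fun p : R * R => g (snd p) (fst p)) (fun p : R * R => g x (fst p))).
  + apply C2.
  + apply (continuous_comp fst (g x)); [apply continuous_fst|now apply continuous2_l].
Qed.

(** With the upper limit 1 of the outer variable replaced by [x], both sides become functions of [x]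
    that vanish at 0 and have the same derivative. *)
Lemma RInt_swap_continuous2 g : continuous2 g ->
  RInt (fun x => RInt (g x) 0 1) 0 1 = RInt (fun y => RInt (fun x => g x y) 0 1) 0 1.
Proof.
intros Hg.
set (F1 := fun x => RInt (fun x => RInt (g x) 0 1) 0 x).
set (F2 := fun x => RInt (fun y => RInt (fun s => g s y) 0 x) 0 1).
assert (D1 : forall x, is_derive F1 x (RInt (g x) 0 1)).
{ intros x; apply (is_derive_RInt (fun x => RInt (g x) 0 1) F1 0).
  - exists (mkposreal 1 Rlt_0_1); intros x' _; apply RInt_correct.
    apply ex_RInt_continuous; intros; now apply continuous_RInt_param.
  - now apply continuous_RInt_param. }
assert (D2 : forall x, is_derive F2 x (RInt (g x) 0 1))
  by (intros; now apply is_derive_RInt_upper).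
assert (I : is_RInt (fun _ => zero : V) 0 1 (minus (minus (F1 1) (F2 1)) (minus (F1 0) (F2 0)))).
{ apply (is_RInt_derive (fun x => minus (F1 x) (F2 x)) (fun _ => zero)).
  - intros x _.
    assert (D := is_derive_minus (K := R_AbsRing) (V := V) F1 F2 x _ _ (D1 x) (D2 x)).
    rewrite (minus_eq_zero (G := V)) in D; exact D.
  - intros; apply continuous_const. }
assert (Z : RInt (fun _ => zero : V) 0 1 = zero)
  by exact (eq_trans (RInt_const (V := V) 0 1 zero) (scal_zero_r (V := V) _)).
apply is_RInt_unique in I; rewrite Z in I; clear Z.
assert (Z1 : F1 0 = zero) by apply RInt_point.
assert (Z2 : F2 0 = zero).
{ unfold F2; etransitivity; [apply RInt_ext; intros y _; apply RInt_point|].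
  exact (eq_trans (RInt_const (V := V) 0 1 zero) (scal_zero_r (V := V) _)). }
rewrite Z1, Z2 in I.
change (F1 1 = F2 1).
apply (plus_reg_r (G := V) (opp (F2 1))); rewrite (plus_opp_r (G := V)).
etransitivity; [|symmetry; exact I].
assert (Z : forall v : V, minus v (minus zero zero) = v).
{ intros v; unfold minus; rewrite (plus_opp_r (G := V)).
  etransitivity; [apply (f_equal (plus v)), (opp_zero (G := V))|apply (plus_zero_r (G := V))]. }
symmetry; apply Z.
Qed.

End Fubini.

Definition clamp (x : R) : R := Rmax 0 (Rmin x 1).

Lemma clamp_in x : 0 <= clamp x <= 1.
Proof. unfold clamp, Rmax, Rmin; repeat destruct Rle_dec; lra. Qed.

Lemma clamp_id x : 0 <= x <= 1 -> clamp x = x.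
Proof. unfold clamp, Rmax, Rmin; repeat destruct Rle_dec; lra. Qed.

Lemma continuous_clamp x : continuous clamp x.
Proof.
apply (continuous_lipschitz (U := R_NormedModule) (V := R_NormedModule) _ x 1); intros y.
change (Rabs (clamp y - clamp x) <= 1 * Rabs (y - x)).
unfold clamp, Rmax, Rmin; repeat destruct Rle_dec; split_Rabs; lra.
Qed.

Lemma continuous2_clamp {V : CompleteNormedModule R_AbsRing} (g : R -> R -> V) :
  (forall x y, 0 <= x <= 1 -> 0 <= y <= 1 ->
     continuous (fun p : R * R => g (fst p) (snd p)) (x, y)) ->
  forall x y, continuous (fun p : R * R => g (clamp (fst p)) (clamp (snd p))) (x, y).
Proof.
intros Hg x y.
apply (continuous_comp_2 (fun p : R * R => clamp (fst p)) (fun p : R * R => clamp (snd p)) g).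
- apply (continuous_comp fst clamp); [apply continuous_fst|apply continuous_clamp].
- apply (continuous_comp snd clamp); [apply continuous_snd|apply continuous_clamp].
- apply Hg; apply clamp_in.
Qed.

(* Clamping the parameters to [0, 1] reduces the claim to an everywhere
   continuous integrand. *)
Lemma RInt_fubini {V : CompleteNormedModule R_AbsRing} (g : R -> R -> V) :
  (forall x y, 0 <= x <= 1 -> 0 <= y <= 1 ->
     continuous (fun p : R * R => g (fst p) (snd p)) (x, y)) ->
  RInt (fun x => RInt (g x) 0 1) 0 1 = RInt (fun y => RInt (fun x => g x y) 0 1) 0 1.
Proof.
intros Hg.
transitivity (RInt (fun x => RInt (fun y => g (clamp x) (clamp y)) 0 1) 0 1).
{ apply RInt_ext; intros x; rewrite Rmin_left, Rmax_right by lra; intros Hx.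
  apply RInt_ext; intros y; rewrite Rmin_left, Rmax_right by lra; intros Hy.
  rewrite !clamp_id by lra; easy. }
rewrite RInt_swap_continuous2.
- apply RInt_ext; intros y; rewrite Rmin_left, Rmax_right by lra; intros Hy.
  apply RInt_ext; intros x; rewrite Rmin_left, Rmax_right by lra; intros Hx.
  rewrite !clamp_id by lra; easy.
- now apply continuous2_clamp.
Qed.

(** * Contours *)

Definition on_contour (G : list (C * C)) (z : C) : Prop :=
  exists s, In s G /\ on_segment s z.

Definition contour_length (G : list (C * C)) : R :=
  fold_right (fun s l => Cmod (snd s - fst s) + l) 0 G.

Lemma contour_length_ge_0 G : 0 <= contour_length G.
Proof.
induction G as [|s G IH]; simpl; [lra|]; pose proof (Cmod_ge_0 (snd s - fst s)); lra.
Qed.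

Lemma on_contour_cons s G z : on_contour (s :: G) z <-> on_segment s z \/ on_contour G z.
Proof.
split.
- intros [r [[->|Hr] Hz]]; [now left|right; now exists r].
- intros [Hz|[r [Hr Hz]]]; [exists s|exists r]; simpl; auto.
Qed.

Lemma on_contour_app G G' z : on_contour (G ++ G') z <-> on_contour G z \/ on_contour G' z.
Proof.
induction G as [|s G IH]; simpl.
- split; [now right|intros [[r [[] _]]|H]; exact H].
- rewrite !on_contour_cons, IH; tauto.
Qed.

Lemma on_contour_rev G z : on_contour (map segment_rev G) z <-> on_contour G z.
Proof.
induction G as [|s G IH]; simpl; [tauto|].
rewrite !on_contour_cons, IH, on_segment_rev; tauto.
Qed.

Section ContourIntegral.

Context {V : CompleteNormedModule C_AbsRing}.
Implicit Types g h : C -> V.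

Lemma cont_on_cons g s G : cont_on (on_contour (s :: G)) g ->
  cont_on (on_segment s) g /\ cont_on (on_contour G) g.
Proof.
intros H; split; intros z Hz; apply H, on_contour_cons; [now left|now right].
Qed.

Lemma contour_integral_ext g h G :
  (forall z, on_contour G z -> g z = h z) -> contour_integral g G = contour_integral h G.
Proof.
induction G as [|s G IH]; simpl; intros H; [easy|]; f_equal.
- apply segment_integral_ext; intros z Hz; apply H, on_contour_cons; now left.
- apply IH; intros z Hz; apply H, on_contour_cons; now right.
Qed.

Definition contour_integrable g G : Prop := forall s, In s G -> integrable g s.

Lemma cont_on_integrable g G : cont_on (on_contour G) g -> contour_integrable g G.
Proof.
intros Hg s Hs; apply ex_segment_integral; intros z Hz; apply Hg; now exists s.
Qed.

Lemma contour_integral_plus g h G :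
  contour_integrable g G -> contour_integrable h G ->
  contour_integral (fun z => plus (g z) (h z)) G =
  plus (contour_integral g G) (contour_integral h G).
Proof.
induction G as [|s G IH]; simpl; intros Hg Hh.
{ symmetry; apply (plus_zero_r (G := V)). }
rewrite segment_integral_plus, IH; [vec V|..].
- intros r Hr; apply Hg; now right.
- intros r Hr; apply Hh; now right.
- apply Hg; now left.
- apply Hh; now left.
Qed.

Lemma contour_integral_zero G : contour_integral (fun _ => zero : V) G = zero.
Proof.
induction G as [|s G IH]; simpl; [easy|].
rewrite IH, segment_integral_const; vec V.
Qed.

Lemma contour_integral_app g G G' :
  contour_integral g (G ++ G') = plus (contour_integral g G) (contour_integral g G').
Proof.
induction G as [|s G IH]; simpl; [symmetry; apply (plus_zero_l (G := V))|].
rewrite IH; apply (plus_assoc (G := V)).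
Qed.

Lemma contour_integral_rev g G : cont_on (on_contour G) g ->
  contour_integral g (map segment_rev G) = opp (contour_integral g G).
Proof.
induction G as [|s G IH]; simpl; intros Hg; [symmetry; apply (opp_zero (G := V))|].
apply cont_on_cons in Hg; destruct Hg.
rewrite segment_integral_rev, IH by auto; vec V.
Qed.

Lemma contour_integral_permutation g G G' :
  Permutation G G' -> contour_integral g G = contour_integral g G'.
Proof.
induction 1; simpl; try congruence.
vec V.
Qed.

Lemma norm_contour_integral_le g G M :
  cont_on (on_contour G) g -> (forall z, on_contour G z -> norm (g z) <= M) ->
  norm (contour_integral g G) <= contour_length G * M.
Proof.
induction G as [|s G IH]; simpl; intros Hg HM.
{ eapply Rle_trans; [right; exact (norm_zero (V := V))|lra]. }
apply cont_on_cons in Hg; destruct Hg as [Hs HG].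
eapply Rle_trans; [apply (norm_triangle (V := V))|].
rewrite Rmult_plus_distr_r; apply Rplus_le_compat.
- apply norm_segment_integral_le; auto; intros; apply HM, on_contour_cons; now left.
- apply IH; auto; intros; apply HM, on_contour_cons; now right.
Qed.

(** The increments of [P] add up to its sum over the terminal points minus its sum over the initial
    points, and these lists are permutations of each other. Closedness of a cycle enters Cauchy's
    theorem through this. *)
Lemma is_contour_telescope (P : C -> V) g G : is_contour G ->
  (forall s, In s G -> segment_integral g s = minus (P (snd s)) (P (fst s))) ->
  contour_integral g G = zero.
Proof.
intros HG H.
set (S := fun l : list C => fold_right (fun z v => plus (P z) v) (zero : V) l).
assert (E : contour_integral g G = minus (S (map snd G)) (S (map fst G))).
{ clear HG; induction G as [|s G IH]; simpl; [symmetry; apply (minus_eq_zero (G := V))|].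
  rewrite H, IH; [|intros r Hr; apply H; now right|now left].
  symmetry; apply (minus_plus_plus (G := V)). }
assert (Sp : forall l l', Permutation l l' -> S l = S l').
{ induction 1; simpl; try congruence; vec V. }
rewrite E, (Sp _ _ HG); apply (minus_eq_zero (G := V)).
Qed.

Lemma contour_integral_derive (F : C -> V) g G : is_contour G ->
  (forall z, on_contour G z -> is_derive (K := C_AbsRing) F z (g z)) ->
  cont_on (on_contour G) g ->
  contour_integral g G = zero.
Proof.
intros HG HF Hg; apply (is_contour_telescope F); auto.
intros s Hs; apply segment_integral_derive; intros z Hz; [apply HF|apply Hg]; now exists s.
Qed.

Lemma contour_bounded g G : cont_on (on_contour G) g ->
  exists M, 0 < M /\ forall z, on_contour G z -> norm (g z) <= M.
Proof.
induction G as [|s G IH]; intros Hg.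
{ exists 1; split; [lra|]; intros z [r [[] _]]. }
apply cont_on_cons in Hg; destruct Hg as [Hs HG].
destruct (IH HG) as [M [M0 HM]].
destruct (continuity_ab_maj (fun t => norm (g (segment_point s t))) 0 1) as [x [Hx _]]; [lra| |].
{ intros t Ht; apply continuity_pt_filterlim.
  apply (continuous_comp (U := R_UniformSpace) (V := V) (W := R_UniformSpace)
    (fun t => g (segment_point s t)) norm).
  - apply (continuous_comp (U := R_UniformSpace) (V := C_UniformSpace) (segment_point s) g).
    + apply continuous_segment_point.
    + apply Hs; now exists t.
  - exact (filterlim_norm (V := V) _). }
exists (Rmax M (norm (g (segment_point s x)))); split.
{ eapply Rlt_le_trans; [exact M0|apply Rmax_l]. }
intros z Hz; apply on_contour_cons in Hz; destruct Hz as [[t [Ht ->]]|Hz].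
- eapply Rle_trans; [apply Hx, Ht|apply Rmax_r].
- eapply Rle_trans; [apply HM, Hz|apply Rmax_l].
Qed.

End ContourIntegral.

Lemma contour_integral_linear {V W : CompleteNormedModule C_AbsRing}
    (L : V -> W) (g : C -> V) G :
  is_linear L -> cont_on (on_contour G) g ->
  contour_integral (fun z => L (g z)) G = L (contour_integral g G).
Proof.
intros HL; induction G as [|s G IH]; simpl; intros Hg.
{ symmetry; exact (linear_zero (K := C_AbsRing) (U := V) (V := W) L HL). }
apply cont_on_cons in Hg; destruct Hg.
rewrite segment_integral_linear, IH by auto.
symmetry; exact (linear_plus _ HL _ _).
Qed.

Lemma contour_integral_scal {V : CompleteNormedModule C_AbsRing} (c : C) (g : C -> V) G :
  cont_on (on_contour G) g ->
  contour_integral (fun z => scal c (g z)) G = scal c (contour_integral g G).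
Proof.
apply (contour_integral_linear (fun v => scal c v)).
exact (is_linear_scal_r (V := V) c Cmult_comm).
Qed.

Lemma contour_integral_scal_l {V : CompleteNormedModule C_AbsRing} (k : C -> C) (v : V) G :
  cont_on (V := C_CompleteNormedModule) (on_contour G) k ->
  contour_integral (fun z => scal (k z) v) G =
  scal (contour_integral (V := C_CompleteNormedModule) k G) v.
Proof.
apply (contour_integral_linear (V := C_CompleteNormedModule) (fun c => scal c v)).
assert (H := is_linear_scal_l (K := C_AbsRing) (V := V) v).
destruct H as [H1 H2 H3]; split; assumption.
Qed.

(** The function [/ (z - w)] is continuous on the contour, hence bounded there by some [M > 0], and
    [/ M] is a lower bound for the distance. *)
Lemma contour_dist G w : ~ on_contour G w ->
  exists d, 0 < d /\ forall z, on_contour G z -> d <= Cmod (z - w).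
Proof.
intros Hw.
destruct (contour_bounded (V := C_CompleteNormedModule) (fun z => / (z - w))%C G) as [M [M0 HM]].
{ intros z Hz; apply continuous_inv_C.
  - apply continuous_minus_C; [apply continuous_id|apply continuous_const].
  - intros E; apply Hw; replace w with z; auto.
    apply Cmod_eq_minus; rewrite E; apply Cmod_0. }
exists (/ M); split; [now apply Rinv_0_lt_compat|]; intros z Hz.
assert (Hzw : (z - w)%C <> RtoC 0).
{ intros E; apply Hw; replace w with z; auto.
  apply Cmod_eq_minus; rewrite E; apply Cmod_0. }
assert (P : 0 < Cmod (z - w)) by now apply Cmod_gt_0.
specialize (HM z Hz); change (Cmod (/ (z - w)) <= M) in HM; rewrite Cmod_inv in HM by auto.
rewrite <- (Rinv_inv (Cmod (z - w))); apply Rinv_le_contravar; auto.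
now apply Rinv_0_lt_compat.
Qed.

Lemma contour_complement_open G w : ~ on_contour G w ->
  exists d, 0 < d /\ forall w', Cmod (w' - w) < d -> ~ on_contour G w'.
Proof.
intros Hw; destruct (contour_dist G w Hw) as [d [d0 Hd]].
exists d; split; auto; intros w' Hw' H; specialize (Hd _ H); lra.
Qed.

Definition continuous2 {V : CompleteNormedModule C_AbsRing} (k : C -> C -> V) (z w : C) : Prop :=
  continuous (T := prod_UniformSpace C_UniformSpace C_UniformSpace)
    (fun p : C * C => k (fst p) (snd p)) (z, w).

Section ContourFubini.

Context {V : CompleteNormedModule C_AbsRing}.
Implicit Types k : C -> C -> V.

Lemma continuous2_slice_l k z w : continuous2 k z w -> continuous (T := C_UniformSpace) (k z) w.
Proof.
intros H; apply (continuous_comp_2 (U := C_UniformSpace) (V := C_UniformSpace)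
  (W := C_UniformSpace) (fun _ => z) (fun w => w) k w).
- apply continuous_const.
- apply continuous_id.
- exact H.
Qed.

Lemma continuous2_swap_C k z w : continuous2 k z w -> continuous2 (fun w z => k z w) w z.
Proof.
intros H; unfold continuous2; apply (continuous_comp_2
  (U := prod_UniformSpace C_UniformSpace C_UniformSpace)
  (V := C_UniformSpace) (W := C_UniformSpace) snd fst k (w, z)).
- apply (continuous_snd (U := C_UniformSpace) (V := C_UniformSpace)).
- apply (continuous_fst (U := C_UniformSpace) (V := C_UniformSpace)).
- exact H.
Qed.

Section TwoSegments.

Variables (k : C -> C -> V) (s s' : C * C).
Hypothesis Hk : forall z w, on_segment s z -> on_segment s' w -> continuous2 k z w.

Let a := (snd s - fst s)%C.
Let b := (snd s' - fst s')%C.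
Let g (x y : R) : V := scal (a * b)%C (k (segment_point s x) (segment_point s' y)).

(** Moving the outer factor [a] inside turns the iterated segment integral into an iterated [RInt]
    of the single function [g] on the unit square, where [RInt_fubini] applies. *)
Lemma segment_integral_param_RInt x : 0 <= x <= 1 ->
  scal a (segment_integral (k (segment_point s x)) s') = RInt (V := realify V) (g x) 0 1.
Proof.
intros Hx; etransitivity.
{ symmetry; refine (segment_integral_linear (fun v : V => scal a v) _ s' _ _).
  - exact (is_linear_scal_r (V := V) a Cmult_comm).
  - intros w Hw; apply continuous2_slice_l, Hk; [now exists x|exact Hw]. }
apply (RInt_ext (V := realify V)); intros y _; unfold g; fold b; vec V.
Qed.

Lemma continuous_two_segments x y : 0 <= x <= 1 -> 0 <= y <= 1 ->
  continuous (U := realify V) (fun p : R * R => g (fst p) (snd p)) (x, y).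
Proof.
intros Hx Hy.
apply (continuous_scal_r (V := V) (a * b)%C).
apply (continuous_comp_2 (V := C_UniformSpace) (W := C_UniformSpace)
  (fun p : R * R => segment_point s (fst p))
  (fun p : R * R => segment_point s' (snd p)) k).
- apply (continuous_comp (V := R_UniformSpace) (W := C_UniformSpace) fst).
  + apply continuous_fst.
  + apply continuous_segment_point.
- apply (continuous_comp (V := R_UniformSpace) (W := C_UniformSpace) snd).
  + apply continuous_snd.
  + apply continuous_segment_point.
- apply Hk; [now exists x|now exists y].
Qed.

(** For [z] off the segment [s] the function [k z] may fail to be integrable, so continuity in the
    plane is out of reach. Integrability is read off the parameter instead, after clamping. *)
Lemma integrable_param : integrable (fun z => segment_integral (k z) s') s.
Proof.
apply (ex_RInt_ext (V := realify V)
  (fun x => RInt (V := realify V) (fun y => g (clamp x) (clamp y)) 0 1)).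
- intros x; rewrite Rmin_left, Rmax_right by lra; intros Hx.
  fold a; rewrite segment_integral_param_RInt by lra.
  apply (RInt_ext (V := realify V)); intros y; rewrite Rmin_left, Rmax_right by lra; intros Hy.
  rewrite !clamp_id by lra; easy.
- apply (ex_RInt_continuous (V := realify V)); intros x _.
  apply (continuous_RInt_param (V := realify V) (fun x y => g (clamp x) (clamp y))).
  apply (continuous2_clamp (V := realify V)), continuous_two_segments.
Qed.

End TwoSegments.

Lemma segment_integral_fubini k s s' :
  (forall z w, on_segment s z -> on_segment s' w -> continuous2 k z w) ->
  segment_integral (fun z => segment_integral (k z) s') s =
  segment_integral (fun w => segment_integral (fun z => k z w) s) s'.
Proof.
intros Hk.
assert (Hk' : forall w z, on_segment s' w -> on_segment s z ->
  continuous2 (fun w z => k z w) w z)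
  by (intros; now apply continuous2_swap_C, Hk).
unfold segment_integral at 1; etransitivity.
{ apply (RInt_ext (V := realify V)); intros x; rewrite Rmin_left, Rmax_right by lra; intros Hx.
  apply (segment_integral_param_RInt k s s' Hk); lra. }
rewrite (RInt_fubini (V := realify V)).
2: { intros; now apply (continuous_two_segments k s s' Hk). }
unfold segment_integral at 1.
apply (RInt_ext (V := realify V)); intros y; rewrite Rmin_left, Rmax_right by lra; intros Hy.
symmetry; etransitivity; [apply (segment_integral_param_RInt _ s' s Hk'); lra|].
apply (RInt_ext (V := realify V)); intros x _; f_equal; apply Cmult_comm.
Qed.

Lemma segment_contour_integral_fubini k s G :
  (forall z w, on_segment s z -> on_contour G w -> continuous2 k z w) ->
  integrable (fun z => contour_integral (k z) G) s /\
  segment_integral (fun z => contour_integral (k z) G) s =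
  contour_integral (fun w => segment_integral (fun z => k z w) s) G.
Proof.
induction G as [|r G IH]; simpl; intros Hk.
{ split; [|rewrite segment_integral_const; vec V].
  apply ex_segment_integral; intros z _; apply continuous_const. }
assert (Hr : forall z w, on_segment s z -> on_segment r w -> continuous2 k z w)
  by (intros; apply Hk; [easy|]; apply on_contour_cons; now left).
destruct IH as [IH1 IH2].
{ intros; apply Hk; [easy|]; apply on_contour_cons; now right. }
pose proof (integrable_param k s r Hr) as I.
split; [now apply integrable_plus|].
rewrite segment_integral_plus, IH2 by auto; f_equal.
now apply segment_integral_fubini.
Qed.

Lemma contour_integral_fubini k G G' :
  (forall z w, on_contour G z -> on_contour G' w -> continuous2 k z w) ->
  contour_integral (fun z => contour_integral (k z) G') G =
  contour_integral (fun w => contour_integral (fun z => k z w) G) G'.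
Proof.
induction G as [|s G IH]; simpl; intros Hk.
{ symmetry; apply contour_integral_zero. }
assert (Hs : forall z w, on_segment s z -> on_contour G' w -> continuous2 k z w)
  by (intros; apply Hk; [|easy]; apply on_contour_cons; now left).
assert (HG : forall z w, on_contour G z -> on_contour G' w -> continuous2 k z w)
  by (intros; apply Hk; [|easy]; apply on_contour_cons; now right).
rewrite contour_integral_plus, IH by
  (try exact HG; intros r Hr;
   first
     [ apply (integrable_param (fun w z => k z w) r s); intros w z Hw Hz;
       apply continuous2_swap_C, Hs; [easy|now exists r]
     | apply (segment_contour_integral_fubini (fun w z => k z w) r G); intros w z Hw Hz;
       apply continuous2_swap_C, HG; [easy|now exists r] ]).
f_equal; now apply segment_contour_integral_fubini.
Qed.

End ContourFubini.

(** * Integrals of Cauchy type *)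

Section CauchyType.

Context {V : CompleteNormedModule C_AbsRing}.

(** Differentiation under the integral sign: a second order remainder that is uniform along [G]
    integrates to at most the length of [G] times [M |w' - w|^2]. *)
Lemma is_derive_contour_integral (k : C -> C -> V) (dk : C -> V) G w d M :
  0 < d ->
  (forall w', Cmod (w' - w) < d -> cont_on (on_contour G) (k w')) ->
  cont_on (on_contour G) dk ->
  (forall w' z, Cmod (w' - w) < d -> on_contour G z ->
     norm (minus (minus (k w' z) (k w z)) (scal (w' - w)%C (dk z))) <=
       M * (Cmod (w' - w) * Cmod (w' - w))) ->
  is_derive (K := C_AbsRing) (fun w' => contour_integral (k w') G) w (contour_integral dk G).
Proof.
intros d0 Hk Hdk HM; apply is_derive_norm; intros eps He.
set (N := contour_length G * Rabs M + 1).
assert (PN : 0 < N).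
{ pose proof (Rmult_le_pos _ _ (contour_length_ge_0 G) (Rabs_pos M)); unfold N; lra. }
exists (Rmin d (eps / N)); split.
{ apply Rmin_pos; auto; now apply Rdiv_lt_0_compat. }
intros w' Hw'.
assert (H1 : Cmod (w' - w) < d) by (eapply Rlt_le_trans; [exact Hw'|apply Rmin_l]).
assert (H2 : Cmod (w' - w) < eps / N) by (eapply Rlt_le_trans; [exact Hw'|apply Rmin_r]).
assert (C0 : cont_on (on_contour G) (k w)).
{ apply Hk; replace (w - w)%C with (RtoC 0) by ring; now rewrite Cmod_0. }
assert (C1 := Hk w' H1).
assert (C2 : forall c (g : C -> V), cont_on (on_contour G) g ->
  cont_on (on_contour G) (fun z => scal c (g z))).
{ intros c g Hg z Hz; apply (continuous_scal_r (V := V)), Hg, Hz. }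
assert (C3 : cont_on (on_contour G) (fun z => plus (scal (- RtoC 1)%C (k w z))
   (scal (- (w' - w))%C (dk z)))).
{ intros z Hz; apply (continuous_plus (V := V)); now apply C2. }
set (e := fun z => plus (k w' z) (plus (scal (- RtoC 1)%C (k w z))
   (scal (- (w' - w))%C (dk z)))).
assert (E : minus (minus (contour_integral (k w') G) (contour_integral (k w) G))
    (scal (w' - w)%C (contour_integral dk G)) = contour_integral e G).
{ symmetry; unfold e; etransitivity.
  { apply (contour_integral_plus (k w')); apply cont_on_integrable; assumption. }
  etransitivity.
  { apply f_equal; apply (contour_integral_plus (fun z => scal (- RtoC 1)%C (k w z))
      (fun z => scal (- (w' - w))%C (dk z))); apply cont_on_integrable; now apply C2. }
  rewrite (contour_integral_scal (- RtoC 1) (k w)), (contour_integral_scal _ dk) by assumption.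
  vec V. }
match goal with |- norm ?u <= _ =>
  replace u with (contour_integral e G) by exact (eq_sym E) end.
eapply Rle_trans.
- apply (norm_contour_integral_le e G (Rabs M * (Cmod (w' - w) * Cmod (w' - w)))).
  + intros z Hz; apply (continuous_plus (V := V)); [now apply C1|now apply C3].
  + intros z Hz; unfold e.
    replace (plus _ _) with (minus (minus (k w' z) (k w z)) (scal (w' - w)%C (dk z)))
      by vec V.
    eapply Rle_trans; [now apply HM|].
    apply Rmult_le_compat_r; [|apply Rle_abs].
    apply Rmult_le_pos; apply Cmod_ge_0.
- rewrite <- !Rmult_assoc; apply Rmult_le_compat_r; [apply Cmod_ge_0|].
  apply Rle_trans with (N * (eps / N)); [|right; field; lra].
  apply Rmult_le_compat; try apply Cmod_ge_0; [|unfold N; lra|lra].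
  apply Rmult_le_pos; [apply contour_length_ge_0|apply Rabs_pos].
Qed.

(* With [x = / (z - w')], [y = / (z - w)] and [h = w' - w]. *)
Lemma pow_increment_le n M : 0 <= M -> exists B, forall x y h : C,
  Cmod x <= M -> Cmod y <= M -> (x - y = h * x * y)%C ->
  Cmod (x ^ n - y ^ n - h * (RtoC (INR n) * y ^ (S n))) <= B * (Cmod h * Cmod h).
Proof.
intros HM; induction n as [|n [B HB]].
{ exists 0; intros x y h _ _ _; right; rewrite Rmult_0_l, <- Cmod_0; f_equal; simpl; ring. }
(* The remainder for [S n] is [x] times the remainder for [n] plus [h^2 (n + 1) x y^(n + 2)]; the
   two summands of the witness bound these two terms. *)
exists (M * Rabs B + INR (S n) * (M * M ^ (S (S n)))); intros x y h Hx Hy E.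
replace (x ^ S n - y ^ S n - h * (RtoC (INR (S n)) * y ^ S (S n)))%C with
  (x * (x ^ n - y ^ n - h * (RtoC (INR n) * y ^ S n)) +
   h * h * (RtoC (INR (S n)) * (x * y ^ (S (S n)))))%C.
2: { rewrite S_INR, RtoC_plus; simpl.
     replace (h * h * ((RtoC (INR n) + 1) * (x * (y * (y * y ^ n)))))%C with
       (h * (RtoC (INR n) + 1) * y * y ^ n * (h * x * y))%C by ring.
     rewrite <- E.
     replace (x * (x ^ n - y ^ n - h * (RtoC (INR n) * (y * y ^ n))) +
       h * (RtoC (INR n) + 1) * y * y ^ n * (x - y))%C with
       (x * x ^ n - x * y ^ n + h * x * y * y ^ n - h * (RtoC (INR n) + 1) * y * y * y ^ n)%C
       by ring.
     rewrite <- E; ring. }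
eapply Rle_trans; [apply Cmod_triangle|].
rewrite Rmult_plus_distr_r; apply Rplus_le_compat.
- rewrite Cmod_mult, Rmult_assoc; apply Rmult_le_compat; auto; try apply Cmod_ge_0.
  eapply Rle_trans; [now apply HB|]; apply Rmult_le_compat_r; [|apply Rle_abs].
  apply Rmult_le_pos; apply Cmod_ge_0.
- rewrite !Cmod_mult, Cmod_pow, Cmod_R.
  rewrite (Rabs_right (INR (S n))) by (apply Rle_ge, pos_INR).
  rewrite (Rmult_comm (_ * (_ * _)) (_ * _)).
  apply Rmult_le_compat_l; [apply Rmult_le_pos; apply Cmod_ge_0|].
  apply Rmult_le_compat_l; [apply pos_INR|].
  apply Rmult_le_compat; auto; [apply Cmod_ge_0|apply pow_le, Cmod_ge_0|].
  apply pow_incr; split; [apply Cmod_ge_0|exact Hy].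
Qed.

Lemma continuous_kernel n w z : z <> w ->
  continuous (T := C_UniformSpace) (U := C_UniformSpace) (fun z => (/ (z - w)) ^ n)%C z.
Proof.
intros Hz; induction n as [|n IH]; simpl; [apply continuous_const|].
apply continuous_mult_C; auto; apply continuous_inv_C.
- apply continuous_minus_C; [apply continuous_id|apply continuous_const].
- intros E; apply Hz, Cmod_eq_minus; rewrite E; apply Cmod_0.
Qed.

(** Within half the distance [d] from [w] to the contour all kernels are at most [2 / d], which
    makes the remainder of [pow_increment_le] uniform. The derivative has the same form with
    exponent [S n], so the lemma can be iterated. *)
Lemma is_derive_cauchy_type n (u : C -> V) G w :
  cont_on (on_contour G) u -> ~ on_contour G w ->
  is_derive (K := C_AbsRing)
    (fun w => contour_integral (fun z => scal ((/ (z - w)) ^ n)%C (u z)) G) w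
    (contour_integral (fun z => scal (RtoC (INR n) * (/ (z - w)) ^ (S n))%C (u z)) G).
Proof.
intros Hu Hw.
destruct (contour_dist G w Hw) as [d [d0 Hd]].
destruct (contour_bounded u G Hu) as [N [N0 HN]].
assert (D2 : forall w' z, Cmod (w' - w) < d / 2 -> on_contour G z -> d / 2 <= Cmod (z - w')).
{ intros w' z Hw' Hz; specialize (Hd z Hz); pose proof (Cmod_triangle_minus z w' w); lra. }
assert (P : forall w' z, Cmod (w' - w) < d / 2 -> on_contour G z -> z <> w').
{ intros w' z Hw' Hz ->; specialize (D2 w' w' Hw' Hz); revert D2.
  replace (w' - w')%C with (RtoC 0) by ring; rewrite Cmod_0; lra. }
assert (P0 : forall w' z, Cmod (w' - w) < d / 2 -> on_contour G z -> (z - w')%C <> RtoC 0).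
{ intros w' z Hw' Hz E; apply (P w' z Hw' Hz), Cmod_eq_minus; rewrite E; apply Cmod_0. }
assert (W0 : Cmod (w - w) < d / 2) by (replace (w - w)%C with (RtoC 0) by ring; rewrite Cmod_0; lra).
assert (Q : 0 <= / (d / 2)) by (apply Rlt_le, Rinv_0_lt_compat; lra).
destruct (pow_increment_le n (/ (d / 2)) Q) as [B HB].
apply (is_derive_contour_integral
  (fun w z => scal ((/ (z - w)) ^ n)%C (u z)) _ G w (d / 2) (Rabs B * N)); [lra| | |].
- intros w' Hw' z Hz; apply (continuous_scal_C (V := V)); [|now apply Hu].
  now apply continuous_kernel, P.
- intros z Hz; apply (continuous_scal_C (V := V)); [|now apply Hu].
  apply continuous_mult_C; [apply continuous_const|].
  now apply continuous_kernel, P.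
- intros w' z Hw' Hz.
  replace (minus _ _) with (scal ((/ (z - w')) ^ n - (/ (z - w)) ^ n -
     (w' - w) * (RtoC (INR n) * (/ (z - w)) ^ (S n)))%C (u z)) by vec V.
  eapply Rle_trans; [apply (norm_scal_C (V := V))|].
  replace (Rabs B * N * (Cmod (w' - w) * Cmod (w' - w))) with
    ((Rabs B * (Cmod (w' - w) * Cmod (w' - w))) * N) by ring.
  apply Rmult_le_compat; [apply Cmod_ge_0|apply (norm_ge_0 (V := V))| |now apply HN].
  assert (I : forall w', Cmod (w' - w) < d / 2 -> Cmod (/ (z - w')) <= / (d / 2)).
  { intros v Hv; rewrite Cmod_inv by now apply P0.
    apply Rinv_le_contravar; [lra|now apply D2]. }
  eapply Rle_trans; [apply HB; [now apply I|now apply I|]|].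
  + field; split; now apply P0.
  + apply Rmult_le_compat_r; [|apply Rle_abs].
    apply Rmult_le_pos; apply Cmod_ge_0.
Qed.

End CauchyType.

(** * Cauchy's theorem in a box *)

Definition box (a b z : C) : Prop :=
  fst a <= fst z <= fst b /\ snd a <= snd z <= snd b.

Lemma fst_segment_point s t :
  fst (segment_point s t) = fst (fst s) + t * (fst (snd s) - fst (fst s)).
Proof. unfold segment_point; simpl; ring. Qed.

Lemma snd_segment_point s t :
  snd (segment_point s t) = snd (fst s) + t * (snd (snd s) - snd (fst s)).
Proof. unfold segment_point; simpl; ring. Qed.

Lemma convex_combination_between x y lo hi t : 0 <= t <= 1 ->
  lo <= x <= hi -> lo <= y <= hi -> lo <= x + t * (y - x) <= hi.
Proof. intros; nra. Qed.

Lemma box_segment a b s z : box a b (fst s) -> box a b (snd s) -> on_segment s z -> box a b z.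
Proof.
intros [H1 H2] [H3 H4] [t [Ht ->]]; unfold box.
rewrite fst_segment_point, snd_segment_point; split; now apply convex_combination_between.
Qed.

Definition triangle_contour (a b c : C) : list (C * C) := [(a, b); (b, c); (c, a)].

Lemma is_contour_triangle a b c : is_contour (triangle_contour a b c).
Proof.
unfold is_contour, triangle_contour; simpl; apply (Permutation_cons_append [b; c] a).
Qed.

Lemma box_triangle a b p q r z : box a b p -> box a b q -> box a b r ->
  on_contour (triangle_contour p q r) z -> box a b z.
Proof.
intros Hp Hq Hr [s [Hs Hz]]; revert Hs Hz; unfold triangle_contour; simpl.
intros [<-|[<-|[<-|[]]]]; apply box_segment; auto.
Qed.

Lemma dist_segment s z : on_segment s z -> Cmod (z - fst s) <= Cmod (snd s - fst s).
Proof.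
intros [t [Ht ->]].
replace (segment_point s t - fst s)%C with (RtoC t * (snd s - fst s))%C
  by (unfold segment_point; ring).
rewrite Cmod_mult, Cmod_R, Rabs_right by lra.
rewrite <- (Rmult_1_l (Cmod (snd s - fst s))) at 2.
apply Rmult_le_compat_r; [apply Cmod_ge_0|lra].
Qed.

Lemma dist_triangle p q r z : on_contour (triangle_contour p q r) z ->
  Cmod (z - p) <= contour_length (triangle_contour p q r).
Proof.
unfold triangle_contour; intros [s [Hs Hz]]; simpl in Hs |- *.
pose proof (Cmod_ge_0 (q - p)); pose proof (Cmod_ge_0 (r - q)); pose proof (Cmod_ge_0 (p - r)).
apply dist_segment in Hz.
destruct Hs as [<-|[<-|[<-|[]]]]; simpl in Hz.
- lra.
- pose proof (Cmod_triangle_minus z q p); lra.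
- pose proof (Cmod_triangle_minus z r p); pose proof (Cmod_triangle_minus p q r).
  rewrite (Cmod_minus_sym p q), (Cmod_minus_sym q r) in *; rewrite (Cmod_minus_sym r p) in *; lra.
Qed.

Section Goursat.

Context {V : CompleteNormedModule C_AbsRing}.
Variables (F : C -> V) (lo hi : C).
Hypothesis HF : forall z, box lo hi z -> ex_derive (K := C_AbsRing) F z.

Lemma Goursat_cont_on (D : C -> Prop) : (forall z, D z -> box lo hi z) -> cont_on D F.
Proof.
intros HD z Hz; destruct (HF z (HD z Hz)) as [l Hl]; exact (is_derive_continuous _ _ _ Hl).
Qed.

(** Each segment between two midpoints is traversed once in either direction and cancels; the six
    half sides reassemble the triangle. *)
Lemma triangle_subdivide p q r :
  box lo hi p -> box lo hi q -> box lo hi r ->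
  let m1 := segment_point (p, q) (1 / 2) in
  let m2 := segment_point (q, r) (1 / 2) in
  let m3 := segment_point (r, p) (1 / 2) in
  contour_integral F (triangle_contour p q r) =
  plus (plus (contour_integral F (triangle_contour p m1 m3)) (contour_integral F (triangle_contour m1 q m2)))
       (plus (contour_integral F (triangle_contour m3 m2 r)) (contour_integral F (triangle_contour m2 m3 m1))).
Proof.
intros Hp Hq Hr m1 m2 m3.
assert (T : 0 <= 1 / 2 <= 1) by lra.
assert (B : forall x y, box lo hi x -> box lo hi y -> cont_on (on_segment (x, y)) F).
{ intros x y Hx Hy; apply Goursat_cont_on; intros z; now apply box_segment. }
assert (M : forall x y, box lo hi x -> box lo hi y -> box lo hi (segment_point (x, y) (1 / 2))).
{ intros x y Hx Hy; apply (box_segment lo hi (x, y)); auto; now exists (1 / 2). }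
assert (H1 := M p q Hp Hq); assert (H2 := M q r Hq Hr); assert (H3 := M r p Hr Hp).
fold m1 in H1; fold m2 in H2; fold m3 in H3.
unfold triangle_contour; simpl.
pose proof (segment_integral_split F p q _ T (B p q Hp Hq)) as S1.
pose proof (segment_integral_split F q r _ T (B q r Hq Hr)) as S2.
pose proof (segment_integral_split F r p _ T (B r p Hr Hp)) as S3.
fold m1 in S1; fold m2 in S2; fold m3 in S3; cbv zeta in S1, S2, S3.
rewrite S1, S2, S3.
pose proof (segment_integral_rev F (m1, m3) (B _ _ H1 H3)) as R1.
pose proof (segment_integral_rev F (m2, m1) (B _ _ H2 H1)) as R2.
pose proof (segment_integral_rev F (m3, m2) (B _ _ H3 H2)) as R3.
unfold segment_rev in R1, R2, R3; simpl in R1, R2, R3.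
rewrite R1, R2, R3; vec V.
Qed.

Lemma length_triangle_subdivide p q r :
  let m1 := segment_point (p, q) (1 / 2) in
  let m2 := segment_point (q, r) (1 / 2) in
  let m3 := segment_point (r, p) (1 / 2) in
  let l := contour_length (triangle_contour p q r) / 2 in
  contour_length (triangle_contour p m1 m3) = l /\ contour_length (triangle_contour m1 q m2) = l /\
  contour_length (triangle_contour m3 m2 r) = l /\ contour_length (triangle_contour m2 m3 m1) = l.
Proof.
intros m1 m2 m3 l.
assert (H : forall x y u v : C, (v - u = RtoC (1 / 2) * (y - x))%C ->
  Cmod (v - u) = Cmod (y - x) / 2).
{ intros x y u v ->; rewrite Cmod_mult, Cmod_R, Rabs_right; lra. }
assert (H' : forall x y u v : C, (v - u = RtoC (1 / 2) * (y - x))%C ->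
  Cmod (u - v) = Cmod (y - x) / 2).
{ intros x y u v E; rewrite Cmod_minus_sym; now apply H. }
assert (E2 : RtoC (1 / 2) = (1 / 2)%C) by (rewrite RtoC_div; [easy|lra]).
assert (N2 : RtoC 2 <> RtoC 0) by (intros E; apply RtoC_inj in E; lra).
unfold l, triangle_contour; simpl contour_length.
repeat split.
- rewrite (H p q p m1), (H q r m1 m3) , (H r p m3 p); [lra|..];
    unfold m1, m2, m3, segment_point; simpl fst; simpl snd; rewrite E2; field; auto.
- rewrite (H p q m1 q), (H q r q m2) , (H r p m2 m1); [lra|..];
    unfold m1, m2, m3, segment_point; simpl fst; simpl snd; rewrite E2; field; auto.
- rewrite (H p q m3 m2), (H q r m2 r) , (H r p r m3); [lra|..];
    unfold m1, m2, m3, segment_point; simpl fst; simpl snd; rewrite E2; field; auto.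
- rewrite (H' p q m3 m2), (H' q r m1 m3) , (H' r p m2 m1); [lra|..];
    unfold m1, m2, m3, segment_point; simpl fst; simpl snd; rewrite E2; field; auto.
Qed.

End Goursat.

Lemma half_pow_small L eps : 0 < eps -> exists n, L * (1 / 2) ^ n < eps.
Proof.
intros He.
assert (P : 0 < Rabs L + 1) by (pose proof (Rabs_pos L); lra).
destruct (pow_lt_1_zero (1 / 2)) with (y := eps / (Rabs L + 1)) as [n Hn].
- rewrite Rabs_right; lra.
- now apply Rdiv_lt_0_compat.
- exists n; specialize (Hn n (Nat.le_refl n)).
  assert (P2 : 0 < (1 / 2) ^ n) by (apply pow_lt; lra).
  rewrite Rabs_right in Hn by lra.
  apply Rle_lt_trans with ((Rabs L + 1) * (1 / 2) ^ n).
  + apply Rmult_le_compat_r; [lra|]; pose proof (Rle_abs L); lra.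
  + apply Rmult_lt_compat_l with (r := Rabs L + 1) in Hn; auto.
    replace ((Rabs L + 1) * (eps / (Rabs L + 1))) with eps in Hn by (field; lra); lra.
Qed.

(** With [c n] the tail [2 L / 2^n] of the geometric series, [x n - c n] increases and [x n + c n]
    decreases. The limit is the supremum of the lower ends. *)
Lemma geometric_limit_R (x : nat -> R) L lo hi :
  (forall n, Rabs (x (S n) - x n) <= L * (1 / 2) ^ n) -> (forall n, lo <= x n <= hi) ->
  exists l, (forall n, Rabs (x n - l) <= 2 * L * (1 / 2) ^ n) /\ lo <= l <= hi.
Proof.
intros H Hx; set (c n := 2 * L * (1 / 2) ^ n).
assert (Ic : forall n, c (S n) = c n / 2) by (intros; unfold c; simpl; field).
assert (S1 : forall n k, x n - c n <= x (k + n)%nat - c (k + n)%nat /\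
   x (k + n)%nat + c (k + n)%nat <= x n + c n).
{ intros n k; induction k as [|k IH]; simpl; [lra|].
  specialize (H (k + n)%nat); rewrite Ic; unfold c in *; split_Rabs; lra. }
assert (c0 : forall n, 0 <= c n).
{ intros n; specialize (H n); pose proof (Rabs_pos (x (S n) - x n)); unfold c; lra. }
assert (LU : forall n m, x n - c n <= x m + c m).
{ intros n m; destruct (S1 n m) as [A _]; destruct (S1 m n) as [_ B].
  rewrite (Nat.add_comm n m) in B; specialize (c0 (m + n)%nat); lra. }
destruct (completeness (fun y => exists n, y = x n - c n)) as [l [U1 U2]].
- exists (x 0%nat + c 0%nat); intros y [n ->]; apply LU.
- exists (x 0%nat - c 0%nat), 0%nat; easy.
- exists l.
  assert (B : forall n, Rabs (x n - l) <= c n).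
  { intros n; assert (x n - c n <= l) by (apply U1; now exists n).
    assert (l <= x n + c n) by (apply U2; intros y [m ->]; apply LU).
    split_Rabs; lra. }
  split; [exact B|split; apply le_epsilon; intros eps He;
    destruct (half_pow_small (2 * L) eps He) as [n Hn]; fold (c n) in Hn;
    specialize (B n); specialize (Hx n); split_Rabs; lra].
Qed.

Lemma Cmod_le_sum (z : C) : Cmod z <= Rabs (fst z) + Rabs (snd z).
Proof.
destruct z as [x y]; simpl.
replace ((x, y) : C) with (RtoC x + Ci * RtoC y)%C.
- eapply Rle_trans; [apply Cmod_triangle|].
  rewrite Cmod_mult, Cmod_Ci, !Cmod_R; lra.
- unfold Cplus, Cmult, Ci, RtoC; simpl; f_equal; ring.
Qed.

Lemma Rabs_fst_le (z : C) : Rabs (fst z) <= Cmod z.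
Proof. eapply Rle_trans; [|apply Rmax_Cmod]; apply Rmax_l. Qed.

Lemma Rabs_snd_le (z : C) : Rabs (snd z) <= Cmod z.
Proof. eapply Rle_trans; [|apply Rmax_Cmod]; apply Rmax_r. Qed.

(** Limits are taken coordinatewise. The constant 4 adds the factor 2 of [geometric_limit_R] for the
    real and for the imaginary part. *)
Lemma geometric_limit_C (a : nat -> C) L lo hi :
  (forall n, Cmod (a (S n) - a n) <= L * (1 / 2) ^ n) -> (forall n, box lo hi (a n)) ->
  exists l, (forall n, Cmod (a n - l) <= 4 * L * (1 / 2) ^ n) /\ box lo hi l.
Proof.
intros H Hb.
destruct (geometric_limit_R (fun n => fst (a n)) L (fst lo) (fst hi)) as [x [Hx Bx]].
{ intros n; eapply Rle_trans; [exact (Rabs_fst_le (a (S n) - a n)%C)|apply H]. }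
{ intros n; apply Hb. }
destruct (geometric_limit_R (fun n => snd (a n)) L (snd lo) (snd hi)) as [y [Hy By]].
{ intros n; eapply Rle_trans; [exact (Rabs_snd_le (a (S n) - a n)%C)|apply H]. }
{ intros n; apply Hb. }
exists (x, y); split; [|now split].
intros n; eapply Rle_trans; [apply Cmod_le_sum|].
specialize (Hx n); specialize (Hy n); simpl in *; unfold Rminus in *; lra.
Qed.

Section GoursatTheorem.

Context {V : CompleteNormedModule C_AbsRing}.

Lemma is_derive_quadratic (v l : V) (u z : C) :
  is_derive (K := C_AbsRing)
    (fun z => plus (scal (z - u)%C v) (scal (/ 2 * ((z - u) * (z - u)))%C l)) z
    (plus v (scal (z - u)%C l)).
Proof.
assert (D : is_derive (K := C_AbsRing) (V := C_NormedModule) (fun z => z - u)%C z (RtoC 1)).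
{ eapply is_derive_eq.
  - apply is_derive_minus_C; [apply is_derive_id_C|apply is_derive_const_C].
  - Ceq; ring. }
assert (D2 := is_derive_mult_C _ _ z _ _ D D).
assert (D3 := is_derive_mult_C (fun _ => / 2)%C _ z _ _ (is_derive_const_C (/ 2)%C z) D2).
assert (D4 := is_derive_scal_C (V := V) _ (fun _ => l) z _ _ D3 (is_derive_const (V := V) l z)).
assert (D1 := is_derive_scal_C (V := V) _ (fun _ => v) z _ _ D (is_derive_const (V := V) v z)).
eapply is_derive_eq; [exact (is_derive_plus (K := C_AbsRing) (V := V) _ _ z _ _ D1 D4)|].
vec V; field; intros E; apply RtoC_inj in E; lra.
Qed.

(** Affine functions have a quadratic primitive. Goursat's argument subtracts the first order
    expansion of [F] at no cost because of this. *)
Lemma contour_integral_affine (v l : V) (u : C) G : is_contour G ->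
  contour_integral (fun z => plus v (scal (z - u)%C l)) G = zero.
Proof.
intros HG; apply (contour_integral_derive (fun z => plus (scal (z - u)%C v)
   (scal (/ 2 * ((z - u) * (z - u)))%C l))); auto.
- intros z _; apply is_derive_quadratic.
- intros z _; apply (continuous_plus (V := V)); [apply continuous_const|].
  apply (continuous_scal_C (V := V)); [|apply continuous_const].
  apply continuous_minus_C; [apply continuous_id|apply continuous_const].
Qed.

Variables (F : C -> V) (lo hi : C).
Hypothesis HF : forall z, box lo hi z -> ex_derive (K := C_AbsRing) F z.

Let len (T : C * C * C) := let '(p, q, r) := T in contour_length (triangle_contour p q r).
Let J (T : C * C * C) := let '(p, q, r) := T in contour_integral F (triangle_contour p q r).
(** The square of the length is the scaling under which the inequality survives subdivision: a
    quarter triangle has half the length, and one of the four integrals is at least a quarter of the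
    whole. *)
Let bad eps (T : C * C * C) := let '(p, q, r) := T in
  (box lo hi p /\ box lo hi q /\ box lo hi r) /\ eps * (len T * len T) < norm (J T).

Lemma bad_triangle_step eps T : bad eps T -> exists T',
  bad eps T' /\ len T' = len T / 2 /\ Cmod (fst (fst T') - fst (fst T)) <= len T.
Proof.
destruct T as [[p q] r]; intros [[Hp [Hq Hr]] HJ].
set (m1 := segment_point (p, q) (1 / 2)); set (m2 := segment_point (q, r) (1 / 2)).
set (m3 := segment_point (r, p) (1 / 2)).
assert (T : 0 <= 1 / 2 <= 1) by lra.
assert (O1 : on_contour (triangle_contour p q r) m1)
  by (exists (p, q); split; [now left|now exists (1 / 2)]).
assert (O2 : on_contour (triangle_contour p q r) m2)
  by (exists (q, r); split; [now right; left|now exists (1 / 2)]).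
assert (O3 : on_contour (triangle_contour p q r) m3)
  by (exists (r, p); split; [now right; right; left|now exists (1 / 2)]).
assert (H1 := box_triangle lo hi p q r _ Hp Hq Hr O1).
assert (H2 := box_triangle lo hi p q r _ Hp Hq Hr O2).
assert (H3 := box_triangle lo hi p q r _ Hp Hq Hr O3).
destruct (length_triangle_subdivide p q r) as [L1 [L2 [L3 L4]]].
fold m1 m2 m3 in L1, L2, L3, L4.
assert (E := triangle_subdivide F lo hi HF p q r Hp Hq Hr).
cbv zeta in E; fold m1 m2 m3 in E.
apply NNPP; intros N.
assert (S : forall x y z, box lo hi x -> box lo hi y -> box lo hi z ->
  contour_length (triangle_contour x y z) = len (p, q, r) / 2 ->
  Cmod (x - p) <= len (p, q, r) ->
  norm (contour_integral F (triangle_contour x y z)) <= eps * (len (p, q, r) * len (p, q, r)) / 4).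
{ intros x y z Hx Hy Hz Hl Hd; apply Rnot_lt_le; intros HN; apply N.
  exists (x, y, z); split; [|now split].
  split; [exact (conj Hx (conj Hy Hz))|].
  unfold len at 1 2; rewrite Hl; unfold J; eapply Rle_lt_trans; [|exact HN].
  right; field. }
assert (Dp : Cmod (p - p) <= len (p, q, r)).
{ replace (p - p)%C with (RtoC 0) by ring; rewrite Cmod_0; apply contour_length_ge_0. }
assert (N1 := S p m1 m3 Hp H1 H3 L1 Dp).
assert (N2 := S m1 q m2 H1 Hq H2 L2 (dist_triangle _ _ _ _ O1)).
assert (N3 := S m3 m2 r H3 H2 Hr L3 (dist_triangle _ _ _ _ O3)).
assert (N4 := S m2 m3 m1 H2 H3 H1 L4 (dist_triangle _ _ _ _ O2)).
apply (Rlt_not_le _ _ HJ); unfold J; rewrite E.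
eapply Rle_trans; [apply (norm_triangle (V := V))|].
eapply Rle_trans; [apply Rplus_le_compat;
  (eapply Rle_trans; [apply (norm_triangle (V := V))|])|].
- apply Rplus_le_compat; [exact N1|exact N2].
- apply Rplus_le_compat; [exact N3|exact N4].
- right; field.
Qed.

Lemma Goursat_no_bad eps T : 0 < eps -> ~ bad eps T.
Proof.
intros He HT.
(* Stated for all triangles, with the triangle itself as dummy when it is not bad, so that [choice]
   yields a total function to iterate. *)
assert (St : forall T, exists T', bad eps T -> bad eps T' /\
  len T' = len T / 2 /\ Cmod (fst (fst T') - fst (fst T)) <= len T).
{ intros U; destruct (classic (bad eps U)) as [B|B].
  - destruct (bad_triangle_step eps U B) as [U' HU]; now exists U'.
  - exists U; tauto. }
apply choice in St; destruct St as [f Hf].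
set (t := fun n => Nat.iter n f T).
assert (Bt : forall n, bad eps (t n)).
{ induction n as [|n IH]; [exact HT|apply (Hf (t n) IH)]. }
assert (Lt : forall n, len (t n) = len T * (1 / 2) ^ n).
{ induction n as [|n IH]; [simpl; ring|].
  destruct (Hf (t n) (Bt n)) as [_ [E _]]; change (t (S n)) with (f (t n)).
  rewrite E, IH; simpl; field. }
destruct (geometric_limit_C (fun n => fst (fst (t n))) (len T) lo hi) as [u [Hu Bu]].
{ intros n; rewrite <- Lt; apply (Hf (t n) (Bt n)). }
{ intros n; specialize (Bt n); destruct (t n) as [[p q] r]; apply Bt. }
destruct (HF u Bu) as [l Hl].
(* A point of the n-th triangle, of length [L], is within [L] of its first vertex, which is within
   [4 L] of [u]. So [eps / 5] gives a remainder of at most [eps * L] on the triangle and an integral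
   of at most [eps * L * L]. *)
destruct (proj1 (is_derive_norm _ _ _) Hl (eps / 5)) as [d [d0 Hd]]; [lra|].
destruct (half_pow_small (5 * len T) d d0) as [n Hn].
specialize (Hu n); specialize (Bt n); specialize (Lt n).
destruct (t n) as [[p q] r]; destruct Bt as [[Hp [Hq Hr]] HB]; simpl in Hu.
set (L := len (p, q, r)) in *.
assert (D : forall z, on_contour (triangle_contour p q r) z -> Cmod (z - u) <= 5 * L).
{ intros z Hz; pose proof (Cmod_triangle_minus z p u).
  pose proof (dist_triangle p q r z Hz); change (contour_length _) with L in H0; lra. }
assert (L0 : 0 <= L) by apply contour_length_ge_0.
apply (Rlt_not_le _ _ HB); unfold J.
assert (CF : cont_on (on_contour (triangle_contour p q r)) F).
{ apply (Goursat_cont_on F lo hi HF); intros z; now apply box_triangle. }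
assert (CA : cont_on (on_contour (triangle_contour p q r))
    (fun z => plus (opp (F u)) (scal (z - u)%C (opp l)))).
{ intros z _; apply (continuous_plus (V := V)); [apply continuous_const|].
  apply (continuous_scal_C (V := V)); [|apply continuous_const].
  apply continuous_minus_C; [apply continuous_id|apply continuous_const]. }
assert (E : contour_integral F (triangle_contour p q r) =
  contour_integral (fun z => plus (F z) (plus (opp (F u)) (scal (z - u)%C (opp l))))
   (triangle_contour p q r)).
{ symmetry; etransitivity.
  { apply contour_integral_plus; now apply cont_on_integrable. }
  etransitivity; [apply f_equal, contour_integral_affine, is_contour_triangle|].
  apply (plus_zero_r (G := V)). }
rewrite E; eapply Rle_trans.
{ apply (norm_contour_integral_le _ _ (eps * L)).
  - intros z Hz; apply (continuous_plus (V := V)); [now apply CF|now apply CA].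
  - intros z Hz; specialize (D z Hz).
    assert (Hz' : Cmod (z - u) < d) by lra.
    replace (plus _ _) with (minus (minus (F z) (F u)) (scal (z - u)%C l)) by vec V.
    eapply Rle_trans; [apply Hd, Hz'|].
    apply Rle_trans with (eps / 5 * (5 * L)); [|right; field].
    apply Rmult_le_compat_l; lra. }
change (contour_length _) with L; right; ring.
Qed.

Lemma Goursat p q r : box lo hi p -> box lo hi q -> box lo hi r ->
  contour_integral F (triangle_contour p q r) = zero.
Proof.
intros Hp Hq Hr; apply (norm_eq_zero (V := V)).
apply Rle_antisym; [|apply (norm_ge_0 (V := V))].
set (L := contour_length (triangle_contour p q r)).
assert (P : 0 < L * L + 1) by (pose proof (Rle_0_sqr L); unfold Rsqr in *; lra).
apply le_epsilon; intros eps He; rewrite Rplus_0_l.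
assert (Pe : 0 < eps / (L * L + 1)) by now apply Rdiv_lt_0_compat.
apply Rle_trans with (eps / (L * L + 1) * (L * L)).
- apply Rnot_lt_le; intros HN; apply (Goursat_no_bad _ (p, q, r) Pe).
  split; [exact (conj Hp (conj Hq Hr))|exact HN].
- apply Rle_trans with (eps / (L * L + 1) * (L * L + 1)); [|right; field; lra].
  apply Rmult_le_compat_l; lra.
Qed.

(** Goursat's theorem for the triangle [z], [p], [q]: integration from a fixed base point [z] is a
    primitive along every segment of the box. *)
Lemma box_segment_integral p q z : box lo hi p -> box lo hi q -> box lo hi z ->
  segment_integral F (p, q) = minus (segment_integral F (z, q)) (segment_integral F (z, p)).
Proof.
intros Hp Hq Hz; pose proof (Goursat z p q Hz Hp Hq) as H.
unfold triangle_contour in H; simpl in H.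
pose proof (segment_integral_rev F (z, q)) as R; unfold segment_rev in R; simpl in R.
rewrite R in H.
2: { apply (Goursat_cont_on F lo hi HF); intros w; now apply box_segment. }
apply (f_equal (fun v => plus v (minus (segment_integral F (z, q)) (segment_integral F (z, p)))))
  in H.
etransitivity; [|etransitivity; [exact H|]]; vec V.
Qed.

Lemma box_contour_integral G : is_contour G ->
  (forall s, In s G -> box lo hi (fst s) /\ box lo hi (snd s)) ->
  contour_integral F G = zero.
Proof.
intros HG HB; destruct G as [|s0 G']; [easy|].
destruct (HB s0 (or_introl eq_refl)) as [Hz _].
apply (is_contour_telescope (fun w => segment_integral F (fst s0, w))); auto.
intros [p q] Hs; destruct (HB _ Hs); now apply box_segment_integral.
Qed.

Lemma is_derive_box_primitive z0 z d : box lo hi z0 -> 0 < d ->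
  (forall w, Cmod (w - z) < d -> box lo hi w) ->
  is_derive (K := C_AbsRing) (fun w => segment_integral F (z0, w)) z (F z).
Proof.
intros Hz0 d0 Hd.
assert (Hz : box lo hi z).
{ apply Hd; replace (z - z)%C with (RtoC 0) by ring; now rewrite Cmod_0. }
apply is_derive_norm; intros eps He.
destruct (HF z Hz) as [l Hl]; apply is_derive_continuous in Hl.
destruct (proj1 (continuous_C_norm _ _) Hl eps He) as [e [e0 H]].
exists (Rmin d e); split; [now apply Rmin_pos|]; intros w Hw.
assert (H1 : Cmod (w - z) < d) by (eapply Rlt_le_trans; [exact Hw|apply Rmin_l]).
assert (H2 : Cmod (w - z) < e) by (eapply Rlt_le_trans; [exact Hw|apply Rmin_r]).
specialize (Hd w H1).
assert (CF : cont_on (on_segment (z, w)) F).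
{ apply (Goursat_cont_on F lo hi HF); intros x; now apply box_segment. }
assert (E : minus (minus (segment_integral F (z0, w)) (segment_integral F (z0, z)))
    (scal (w - z)%C (F z)) = segment_integral (fun x => plus (F x) (opp (F z))) (z, w)).
{ symmetry; etransitivity.
  { apply segment_integral_plus; apply ex_segment_integral; [exact CF|].
    intros x _; apply continuous_const. }
  rewrite (segment_integral_const (opp (F z))), (box_segment_integral z w z0) by auto.
  simpl; vec V. }
match goal with |- norm ?u <= _ =>
  replace u with (segment_integral (fun x => plus (F x) (opp (F z))) (z, w))
    by exact (eq_sym E) end.
rewrite Rmult_comm.
apply (norm_segment_integral_le _ (z, w) eps).
- intros x Hx; apply (continuous_plus (V := V)); [now apply CF|apply continuous_const].
- intros x Hx; left; apply H.
  apply Rle_lt_trans with (Cmod (w - z)); [exact (dist_segment _ _ Hx)|exact H2].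
Qed.

End GoursatTheorem.

(** * Winding numbers of rectangles *)

Lemma is_linear_fst_realify :
  is_linear (K := R_AbsRing) (U := realify C_CompleteNormedModule) (V := R_NormedModule)
    (fun z : C => fst z).
Proof.
split.
- easy.
- intros k z; change (k * fst z - 0 * snd z = k * fst z); ring.
- exists 1; split; [lra|]; intros z; change (Rabs (fst z) <= 1 * Cmod z).
  pose proof (Rabs_fst_le z); lra.
Qed.

Lemma is_linear_snd_realify :
  is_linear (K := R_AbsRing) (U := realify C_CompleteNormedModule) (V := R_NormedModule)
    (fun z : C => snd z).
Proof.
split.
- easy.
- intros k z; change (k * snd z + 0 * fst z = k * snd z); ring.
- exists 1; split; [lra|]; intros z; change (Rabs (snd z) <= 1 * Cmod z).
  pose proof (Rabs_snd_le z); lra.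
Qed.

Section VerticalSegment.

Variables (w c : C) (p y1 y2 : R).
Hypotheses (Hc : c <> RtoC 0) (Hp : 0 < p).

(** The factor [c] is a rotation. Taken as [-Ci], [1], [Ci], [-1], it presents each side of a
    rectangle around [w] as a vertical segment at distance [p] to the right of the origin, and it
    cancels in the integrand. *)
Let s : C * C := ((w + c * (p, y1))%C, (w + c * (p, y2))%C).
Let y t := y1 + t * (y2 - y1).

Lemma vertical_segment_minus t : (segment_point s t - w = c * (p, y t))%C.
Proof.
replace ((p, y t) : C) with ((1 - RtoC t) * (p, y1) + RtoC t * (p, y2))%C.
- unfold segment_point, s; simpl fst; simpl snd; ring.
- unfold y, Cplus, Cminus, Cmult, Copp, RtoC; simpl; f_equal; ring.
Qed.

Lemma vertical_neq_0 (x : R) : ((p, x) : C) <> RtoC 0.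
Proof. intros E; injection E; lra. Qed.

Lemma vertical_sum_pos (x : R) : 0 < p * p + x * x.
Proof. pose proof (Rle_0_sqr x); pose proof (Rmult_lt_0_compat _ _ Hp Hp); unfold Rsqr in *; lra. Qed.

Lemma vertical_integrand t :
  scal (snd s - fst s)%C (/ (segment_point s t - w))%C =
  ((y2 - y1) * y t / (p * p + y t * y t), (y2 - y1) * p / (p * p + y t * y t)) :> C.
Proof.
change (scal (snd s - fst s)%C (/ (segment_point s t - w))%C)
  with ((snd s - fst s) * / (segment_point s t - w))%C.
rewrite vertical_segment_minus.
replace (snd s - fst s)%C with (c * (0%R, (y2 - y1)%R))%C.
2: { replace ((0%R, (y2 - y1)%R) : C) with (((p, y2) : C) - (p, y1))%C.
     - unfold s; simpl fst; simpl snd; ring.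
     - unfold Cminus, Cplus, Copp; simpl; f_equal; ring. }
replace (c * (0%R, (y2 - y1)%R) * / (c * (p, y t)))%C with ((0%R, (y2 - y1)%R) * / (p, y t))%C.
2: { field; split; [apply vertical_neq_0|exact Hc]. }
pose proof (vertical_sum_pos (y t)).
unfold Cmult, Cinv; simpl; f_equal; field; lra.
Qed.

Lemma vertical_cont : cont_on (V := C_CompleteNormedModule) (on_segment s) (fun z => / (z - w))%C.
Proof.
intros z [t [_ ->]]; apply continuous_inv_C.
- apply continuous_minus_C; [apply continuous_id|apply continuous_const].
- rewrite vertical_segment_minus; apply Cmult_neq_0; [exact Hc|apply vertical_neq_0].
Qed.

(** The real and the imaginary part of the integrand have the real primitives [ln] of the squared
    modulus, halved, and [atan]: the logarithm on the right half plane, written out. *)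
Lemma segment_integral_inv_vertical :
  segment_integral (V := C_CompleteNormedModule) (fun z => / (z - w))%C s =
  ((ln (p * p + y2 * y2) - ln (p * p + y1 * y1)) / 2, atan (y2 / p) - atan (y1 / p)) :> C.
Proof.
pose proof (RInt_correct (V := realify C_CompleteNormedModule) _ _ _
  (ex_segment_integral _ _ vertical_cont)) as HI.
fold (segment_integral (V := C_CompleteNormedModule) (fun z => / (z - w))%C s) in HI.
assert (H1 := is_RInt_linear (V := realify C_CompleteNormedModule) _ _ 0 1 _ is_linear_fst_realify HI).
assert (H2 := is_RInt_linear (V := realify C_CompleteNormedModule) _ _ 0 1 _ is_linear_snd_realify HI).
clear HI.
assert (E1 : is_RInt (V := R_NormedModule) (fun t => (y2 - y1) * y t / (p * p + y t * y t)) 0 1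
   (minus (ln (p * p + y 1 * y 1) / 2) (ln (p * p + y 0 * y 0) / 2))).
{ apply (is_RInt_derive (V := R_CompleteNormedModule) (fun t => ln (p * p + y t * y t) / 2)).
  - intros t _; pose proof (vertical_sum_pos (y t)); unfold y in *; auto_derive; [exact H|].
    field; lra.
  - intros t _; pose proof (vertical_sum_pos (y t)).
    apply (ex_derive_continuous (K := R_AbsRing) (V := R_NormedModule)).
    unfold y in *; auto_derive; lra. }
assert (E2 : is_RInt (V := R_NormedModule) (fun t => (y2 - y1) * p / (p * p + y t * y t)) 0 1
   (minus (atan (y 1 / p)) (atan (y 0 / p)))).
{ apply (is_RInt_derive (V := R_CompleteNormedModule) (fun t => atan (y t / p))).
  - intros t _; pose proof (vertical_sum_pos (y t)).
    unfold y in *; auto_derive; [easy|].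
    field; split; [|lra]. nra.
  - intros t _; pose proof (vertical_sum_pos (y t)).
    apply (ex_derive_continuous (K := R_AbsRing) (V := R_NormedModule)).
    unfold y in *; auto_derive; lra. }
apply (is_RInt_ext (V := R_NormedModule)
  _ (fun t => (y2 - y1) * y t / (p * p + y t * y t))) in H1.
2: { intros t _; now rewrite vertical_integrand. }
apply (is_RInt_ext (V := R_NormedModule)
  _ (fun t => (y2 - y1) * p / (p * p + y t * y t))) in H2.
2: { intros t _; now rewrite vertical_integrand. }
apply (is_RInt_unique (V := R_CompleteNormedModule)) in H1, H2, E1, E2.
rewrite H1 in E1; rewrite H2 in E2; clear H1 H2.
replace (y 1) with y2 in * by (unfold y; ring).
replace (y 0) with y1 in * by (unfold y; ring).
apply injective_projections; simpl.
- etransitivity; [exact E1|].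
  change (ln (p * p + y2 * y2) / 2 - ln (p * p + y1 * y1) / 2 =
    (ln (p * p + y2 * y2) - ln (p * p + y1 * y1)) / 2); field.
- exact E2.
Qed.

End VerticalSegment.

Definition corner (a b : C) : C := (fst a, snd b).

(** With [a] the lower left and [b] the upper right vertex, [corner b a] is the lower right one, and
    the boundary runs counterclockwise. *)
Definition rectangle (a b : C) : list (C * C) :=
  [(a, corner b a); (corner b a, b); (b, corner a b); (corner a b, a)].

Lemma is_contour_rectangle a b : is_contour (rectangle a b).
Proof. apply (Permutation_cons_append [corner b a; b; corner a b] a). Qed.

Lemma atan_div_add u v : 0 < u -> 0 < v -> atan (u / v) + atan (v / u) = PI / 2.
Proof.
intros Hu Hv.
replace (v / u) with (/ (u / v)) by (field; lra).
rewrite atan_inv by (now apply Rdiv_lt_0_compat); ring.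
Qed.

(** The logarithms at the four vertices cancel. The eight arctangents pair up at the vertices into
    four right angles by [atan_div_add]. *)
Lemma contour_integral_inv_rectangle a b w :
  fst a < fst w < fst b -> snd a < snd w < snd b ->
  contour_integral (V := C_CompleteNormedModule) (fun z => / (z - w))%C (rectangle a b) =
  (2 * PI * Ci)%C.
Proof.
intros [H1 H2] [H3 H4].
set (l := fst w - fst a); set (r := fst b - fst w).
set (d := snd w - snd a); set (u := snd b - snd w).
assert (Pl : 0 < l) by (unfold l; lra). assert (Pr : 0 < r) by (unfold r; lra).
assert (Pd : 0 < d) by (unfold d; lra). assert (Pu : 0 < u) by (unfold u; lra).
assert (N1 : RtoC 1 <> RtoC 0) by (intros E; apply RtoC_inj in E; lra).
assert (Ni : Ci <> RtoC 0) by (intros E; injection E; lra).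
assert (Nm : forall z, z <> RtoC 0 -> (- z)%C <> RtoC 0).
{ intros z Hz E; apply Hz; replace z with (- - z)%C by ring; rewrite E; ring. }
pose proof (segment_integral_inv_vertical w (- Ci)%C d (- l) r (Nm _ Ni) Pd) as S1.
pose proof (segment_integral_inv_vertical w (RtoC 1) r (- d) u N1 Pr) as S2.
pose proof (segment_integral_inv_vertical w Ci u (- r) l Ni Pu) as S3.
pose proof (segment_integral_inv_vertical w (- RtoC 1)%C l (- u) d (Nm _ N1) Pl) as S4.
assert (Q1 : (w + - Ci * (d, (- l)%R))%C = a) by
  (destruct w, a; unfold corner, Cplus, Cmult, Copp, Ci, l, d; simpl; f_equal; ring).
assert (Q2 : (w + - Ci * (d, r))%C = corner b a) by
  (destruct w, a; unfold corner, Cplus, Cmult, Copp, Ci, r, d; simpl; f_equal; ring).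
assert (Q3 : (w + RtoC 1 * (r, (- d)%R))%C = corner b a) by
  (destruct w, a; unfold corner, Cplus, Cmult, Copp, RtoC, r, d; simpl; f_equal; ring).
assert (Q4 : (w + RtoC 1 * (r, u))%C = b) by
  (destruct w, b; unfold corner, Cplus, Cmult, Copp, RtoC, r, u; simpl; f_equal; ring).
assert (Q5 : (w + Ci * (u, (- r)%R))%C = b) by
  (destruct w, b; unfold corner, Cplus, Cmult, Copp, Ci, r, u; simpl; f_equal; ring).
assert (Q6 : (w + Ci * (u, l))%C = corner a b) by
  (destruct w, a; unfold corner, Cplus, Cmult, Copp, Ci, l, u; simpl; f_equal; ring).
assert (Q7 : (w + - RtoC 1 * (l, (- u)%R))%C = corner a b) by
  (destruct w, a; unfold corner, Cplus, Cmult, Copp, RtoC, l, u; simpl; f_equal; ring).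
assert (Q8 : (w + - RtoC 1 * (l, d))%C = a) by
  (destruct w, a; unfold corner, Cplus, Cmult, Copp, RtoC, l, d; simpl; f_equal; ring).
rewrite Q1, Q2 in S1; rewrite Q3, Q4 in S2; rewrite Q5, Q6 in S3; rewrite Q7, Q8 in S4.
unfold rectangle; simpl contour_integral; rewrite S1, S2, S3, S4.
assert (A1 := atan_div_add l d Pl Pd); assert (A2 := atan_div_add r d Pr Pd).
assert (A3 := atan_div_add l u Pl Pu); assert (A4 := atan_div_add r u Pr Pu).
assert (An : forall x z, - x / z = - (x / z)) by (intros; unfold Rdiv; ring).
rewrite !An, !atan_opp.
apply injective_projections.
- match goal with |- _ = ?x => change ((ln (d * d + r * r) - ln (d * d + - l * - l)) / 2 +
    ((ln (r * r + u * u) - ln (r * r + - d * - d)) / 2 +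
    ((ln (u * u + l * l) - ln (u * u + - r * - r)) / 2 +
    ((ln (l * l + d * d) - ln (l * l + - u * - u)) / 2 + 0))) = x) end.
  rewrite !Rmult_opp_opp, (Rplus_comm (d * d) (l * l)), (Rplus_comm (r * r) (d * d)),
    (Rplus_comm (u * u) (r * r)), (Rplus_comm (l * l) (u * u)).
  simpl; field.
- match goal with |- _ = ?x => change (atan (r / d) - - atan (l / d) + (atan (u / r) - - atan (d / r) +
    (atan (l / u) - - atan (r / u) + (atan (d / l) - - atan (u / l) + 0))) = x) end.
  simpl; ring_simplify; lra.
Qed.

(** * Regularity of complex differentiable functions *)

Definition differentiable_on {V : CompleteNormedModule C_AbsRing} (U : C -> Prop) (F : C -> V) :=
  forall z, U z -> ex_derive (K := C_AbsRing) F z.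

Lemma differentiable_cont_on {V : CompleteNormedModule C_AbsRing} (U : C -> Prop) (F : C -> V) :
  differentiable_on U F -> cont_on U F.
Proof. intros HF z Hz; destruct (HF z Hz) as [l Hl]; exact (is_derive_continuous _ _ _ Hl). Qed.

Definition square_lo (z : C) (h : R) : C := (fst z - h, snd z - h).
Definition square_hi (z : C) (h : R) : C := (fst z + h, snd z + h).

Lemma in_square z h w : box (square_lo z h) (square_hi z h) w <->
  Rabs (fst w - fst z) <= h /\ Rabs (snd w - snd z) <= h.
Proof.
unfold box, square_lo, square_hi; simpl; split; intros [H1 H2]; split; split_Rabs; lra.
Qed.

Lemma in_square_Cmod z h w : Cmod (w - z) <= h -> box (square_lo z h) (square_hi z h) w.
Proof.
intros H; apply in_square; split.
- exact (Rle_trans _ _ _ (Rabs_fst_le (w - z)%C) H).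
- exact (Rle_trans _ _ _ (Rabs_snd_le (w - z)%C) H).
Qed.

Lemma open_square (U : C -> Prop) z : open U -> U z ->
  exists h, 0 < h /\ forall w, box (square_lo z h) (square_hi z h) w -> U w.
Proof.
intros HU Hz; destruct (open_Cmod U z HU Hz) as [d [d0 Hd]].
exists (d / 3); split; [lra|]; intros w Hw; apply Hd, in_square in Hw || apply Hd.
apply in_square in Hw; eapply Rle_lt_trans; [apply Cmod_le_sum|]; simpl.
unfold Rminus in Hw; lra.
Qed.

Lemma on_rectangle_side a b z : fst a <= fst b -> snd a <= snd b ->
  on_contour (rectangle a b) z ->
  box a b z /\ (fst z = fst a \/ fst z = fst b \/ snd z = snd a \/ snd z = snd b).
Proof.
intros H1 H2 [s [Hs [t [Ht ->]]]]; unfold rectangle, corner in Hs; simpl in Hs.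
unfold box; rewrite fst_segment_point, snd_segment_point.
destruct Hs as [<-|[<-|[<-|[<-|[]]]]]; simpl; (split; [split; nra|]).
- right; right; left; ring.
- right; left; ring.
- right; right; right; ring.
- left; ring.
Qed.

Lemma rectangle_box a b s : fst a <= fst b -> snd a <= snd b ->
  In s (rectangle a b) -> box a b (fst s) /\ box a b (snd s).
Proof.
intros H1 H2; unfold rectangle, corner, box; simpl.
intros [<-|[<-|[<-|[<-|[]]]]]; simpl; lra.
Qed.

Section Regularity.

Context {V : CompleteNormedModule C_AbsRing}.

(** The average is written over the segment from 0 to 1 in the plane, so that it is itself a contour
    integral and [contour_integral_fubini] can exchange it with the integral over [z]. *)
Lemma segment_integral_average (F : C -> V) w z : z <> w ->
  cont_on (on_segment (w, z)) F ->
  scal (/ (z - w))%C (segment_integral F (w, z)) =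
  segment_integral (fun u => F (w + u * (z - w))%C) (RtoC 0, RtoC 1).
Proof.
intros Hzw HF.
assert (N : (z - w)%C <> RtoC 0).
{ intros E; apply Hzw, Cmod_eq_minus; rewrite E; apply Cmod_0. }
assert (S : forall t, (segment_point (RtoC 0, RtoC 1) t = RtoC t)%C)
  by (intros t; unfold segment_point; simpl; ring).
assert (C0 : cont_on (on_segment (RtoC 0, RtoC 1)) (fun u => F (w + u * (z - w))%C)).
{ intros u [t [Ht ->]]; rewrite S.
  apply (continuous_comp (U := C_UniformSpace) (V := C_UniformSpace)
    (fun u => w + u * (z - w))%C F).
  - apply (continuous_plus (V := C_NormedModule)); [apply continuous_const|].
    apply continuous_mult_C; [apply continuous_id|apply continuous_const].
  - apply HF; now exists t. }
assert (E : segment_integral F (w, z) =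
  segment_integral (fun u => scal (z - w)%C (F (w + u * (z - w))%C)) (RtoC 0, RtoC 1)).
{ apply (RInt_ext (V := realify V)); intros t _; rewrite S; simpl fst; simpl snd.
  change (segment_point (w, z) t) with (w + RtoC t * (z - w))%C; vec V. }
rewrite E, (segment_integral_linear (fun v : V => scal (z - w)%C v)); auto.
2: exact (is_linear_scal_r (V := V) _ Cmult_comm).
vec V; field; exact N.
Qed.

(* [(P z - P w) / (z - w)] is the average of [F] over the segment from [w] to [z], so
   Fubini reduces the formula to Cauchy's theorem for [F]. *)
Lemma box_cauchy_formula (F : C -> V) lo hi P w :
  differentiable_on (box lo hi) F ->
  (forall u v, box lo hi u -> box lo hi v -> segment_integral F (u, v) = minus (P v) (P u)) ->
  cont_on (on_contour (rectangle lo hi)) P ->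
  fst lo < fst w < fst hi -> snd lo < snd w < snd hi ->
  contour_integral (fun z => scal (/ (z - w))%C (P z)) (rectangle lo hi) =
  scal (2 * PI * Ci)%C (P w).
Proof.
intros HF HP CP H1 H2.
assert (Bw : box lo hi w) by (unfold box; lra).
assert (Bz : forall z, on_contour (rectangle lo hi) z -> box lo hi z /\ z <> w).
{ intros z Hz; apply on_rectangle_side in Hz; [|lra|lra]; destruct Hz as [B S].
  split; auto; intros ->; lra. }
assert (CF := differentiable_cont_on _ _ HF).
set (G := rectangle lo hi) in *.
assert (CI : cont_on (V := C_CompleteNormedModule) (on_contour G) (fun z => / (z - w))%C).
{ intros z Hz; apply continuous_inv_C.
  - apply continuous_minus_C; [apply continuous_id|apply continuous_const].
  - intros E; apply (proj2 (Bz z Hz)), Cmod_eq_minus; rewrite E; apply Cmod_0. }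
assert (Bm : forall z u, box lo hi z -> on_segment (RtoC 0, RtoC 1) u ->
  box lo hi (w + u * (z - w))%C).
{ intros z u Hz [t [Ht ->]]; apply (box_segment lo hi (w, z)); auto.
  exists t; split; auto; unfold segment_point; simpl; ring. }
assert (Z : contour_integral (fun z => scal (/ (z - w))%C (plus (P z) (opp (P w)))) G = zero).
{ etransitivity.
  { apply contour_integral_ext; intros z Hz; destruct (Bz z Hz) as [B N].
    change (plus (P z) (opp (P w))) with (minus (P z) (P w)).
    rewrite <- (HP w z Bw B); apply segment_integral_average; auto.
    intros u Hu; apply CF; revert Hu; now apply box_segment. }
  set (k := fun z u : C => F (w + u * (z - w))%C).
  transitivity (contour_integral (fun z => contour_integral (k z) [(RtoC 0, RtoC 1)]) G).
  { apply contour_integral_ext; intros z _; symmetry; apply (plus_zero_r (G := V)). }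
  rewrite contour_integral_fubini.
  (* For fixed [u] the integrand is [F] after a contraction towards [w]. This maps the box into
     itself, so the integrand is differentiable on all of the box and its integral over the
     rectangle vanishes. *)
  - etransitivity; [|apply (contour_integral_zero [(RtoC 0, RtoC 1)])].
    apply contour_integral_ext; intros u Hu.
    apply on_contour_cons in Hu; destruct Hu as [Hu|[s [[] _]]].
    apply (box_contour_integral _ lo hi); [|apply is_contour_rectangle|].
    + intros z Hz; destruct (HF _ (Bm z u Hz Hu)) as [l Hl].
      exists (scal u l); unfold k.
      apply (is_derive_comp_C F (fun z => w + u * (z - w))%C); auto.
      apply (is_derive_ext (K := C_AbsRing) (V := C_NormedModule)
        (fun z => u * z - (u * w - w))%C); [intros; Ceq; ring|].
      eapply is_derive_eq.
      * apply is_derive_minus_C; [|apply is_derive_const_C].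
        apply is_derive_mult_C; [apply is_derive_const_C|apply is_derive_id_C].
      * Ceq; ring.
    + intros s; apply rectangle_box; lra.
  - intros z u Hz Hu; apply on_contour_cons in Hu; destruct Hu as [Hu|[s [[] _]]].
    unfold continuous2, k.
    apply (continuous_comp (U := prod_UniformSpace C_UniformSpace C_UniformSpace)
      (V := C_UniformSpace) (fun p : C * C => w + snd p * (fst p - w))%C F).
    + apply (continuous_plus (V := C_NormedModule)); [apply continuous_const|].
      apply continuous_mult_C; [apply (continuous_snd (U := C_UniformSpace) (V := C_UniformSpace))|].
      apply continuous_minus_C; [|apply continuous_const].
      apply (continuous_fst (U := C_UniformSpace) (V := C_UniformSpace)).
    + apply CF, Bm; auto; now apply Bz. }
assert (E : contour_integral (fun z => scal (/ (z - w))%C (plus (P z) (opp (P w)))) G =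
  plus (contour_integral (fun z => scal (/ (z - w))%C (P z)) G)
       (opp (scal (2 * PI * Ci)%C (P w)))).
{ etransitivity.
  { apply contour_integral_ext; intros z _; exact (scal_distr_l (V := V) _ _ _). }
  etransitivity.
  { apply contour_integral_plus; apply cont_on_integrable; intros z Hz;
      (apply (continuous_scal_C (V := V)); [now apply CI|]);
      [now apply CP|apply continuous_const]. }
  f_equal; rewrite (contour_integral_scal_l (fun z => / (z - w))%C) by exact CI.
  unfold G; rewrite contour_integral_inv_rectangle by auto; vec V. }
rewrite Z in E.
apply (f_equal (fun v => plus v (scal (2 * PI * Ci)%C (P w)))) in E.
etransitivity; [|etransitivity; [symmetry; exact E|]]; vec V.
Qed.

Lemma two_pi_i_neq_0 : (2 * PI * Ci)%C <> RtoC 0.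
Proof.
repeat apply Cmult_neq_0.
- intros E; apply RtoC_inj in E; lra.
- intros E; apply RtoC_inj in E; pose proof PI_RGT_0; lra.
- intros E; injection E; lra.
Qed.

(** The exponent 1 puts Cauchy's formula for the primitive into the shape that
    [is_derive_cauchy_type] differentiates. *)
Lemma box_primitive_cauchy (F : C -> V) lo hi z0 w :
  differentiable_on (box lo hi) F -> box lo hi z0 ->
  fst lo < fst w < fst hi -> snd lo < snd w < snd hi ->
  cont_on (on_contour (rectangle lo hi)) (fun z => segment_integral F (z0, z)) ->
  segment_integral F (z0, w) = scal (/ (2 * PI * Ci))%C (contour_integral
    (fun z => scal ((/ (z - w)) ^ 1)%C (segment_integral F (z0, z))) (rectangle lo hi)).
Proof.
intros HF Hz0 H1 H2 HC.
transitivity (scal (/ (2 * PI * Ci))%C (scal (2 * PI * Ci)%C (segment_integral F (z0, w)))).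
{ vec V; rewrite Cmult_1_r, Cinv_l; [easy|exact two_pi_i_neq_0]. }
f_equal; rewrite <- (box_cauchy_formula F lo hi (fun z => segment_integral F (z0, z))); auto.
- apply contour_integral_ext; intros z _; f_equal; ring.
- intros u v Hu Hv; now apply (box_segment_integral F lo hi).
Qed.

(* A primitive of [F] is an integral of Cauchy type, hence infinitely differentiable;
   the second and third derivatives of the primitive are those of [F]. *)
Lemma local_regularity (F : C -> V) (U : C -> Prop) (z0 : C) : open U -> U z0 -> differentiable_on U F ->
  exists (h : R) (F1 F2 : C -> V), 0 < h /\ forall w, Cmod (w - z0) < h ->
    is_derive (K := C_AbsRing) F w (F1 w) /\ is_derive (K := C_AbsRing) F1 w (F2 w).
Proof.
intros HU Hz0 HF.
destruct (open_square U z0 HU Hz0) as [H [H0 HB]].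
(* The primitive must be differentiable on the closed square with half side [h], its boundary
   included; each of its points has a ball of radius [h] inside the larger square. *)
set (h := H / 2).
assert (h0 : 0 < h) by (unfold h; lra).
set (lo := square_lo z0 h); set (hi := square_hi z0 h).
assert (HFB : differentiable_on (box (square_lo z0 H) (square_hi z0 H)) F)
  by (intros z Hz; apply HF, HB, Hz).
assert (Sub : forall z, box lo hi z -> box (square_lo z0 H) (square_hi z0 H) z).
{ unfold box, lo, hi, square_lo, square_hi, h; simpl; intros; lra. }
assert (HFb : differentiable_on (box lo hi) F) by (intros z Hz; apply HFB, Sub, Hz).
assert (B0 : box lo hi z0) by (unfold box, lo, hi, square_lo, square_hi; simpl; lra).
set (P := fun z => segment_integral F (z0, z)).
assert (DP : forall w, box lo hi w -> is_derive (K := C_AbsRing) P w (F w)).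
{ intros w Hw; apply (is_derive_box_primitive F _ _ HFB z0 w h); auto.
  intros v Hv; apply in_square; apply in_square in Hw.
  pose proof (Rabs_fst_le (v - w)%C); pose proof (Rabs_snd_le (v - w)%C); simpl in *.
  unfold h in *; split; split_Rabs; lra. }
assert (RB : forall z, on_contour (rectangle lo hi) z -> box lo hi z).
{ intros z; apply on_rectangle_side; unfold lo, hi, square_lo, square_hi; simpl; lra. }
assert (CP : cont_on (on_contour (rectangle lo hi)) P).
{ intros z Hz; exact (is_derive_continuous _ _ _ (DP z (RB z Hz))). }
set (K := fun n w => contour_integral (fun z => scal ((/ (z - w)) ^ n)%C (P z)) (rectangle lo hi)).
assert (In : forall w, Cmod (w - z0) < h ->
  (fst lo < fst w < fst hi) /\ (snd lo < snd w < snd hi)).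
{ intros w Hw; pose proof (Rabs_fst_le (w - z0)%C); pose proof (Rabs_snd_le (w - z0)%C).
  simpl in *; unfold lo, hi, square_lo, square_hi; simpl; split; split_Rabs; lra. }
assert (Nc : forall w, Cmod (w - z0) < h -> ~ on_contour (rectangle lo hi) w).
{ intros w Hw Hc; destruct (In w Hw); apply on_rectangle_side in Hc; lra. }
assert (DK : forall n w, Cmod (w - z0) < h ->
  is_derive (K := C_AbsRing) (K n) w (scal (RtoC (INR n)) (K (S n) w))).
{ intros n w Hw.
  apply (is_derive_eq _ _ _ _ (is_derive_cauchy_type n P (rectangle lo hi) w CP (Nc w Hw))).
  unfold K; rewrite <- contour_integral_scal.
  - apply contour_integral_ext; intros z _; vec V.
  - intros z Hz; apply (continuous_scal_C (V := V)); [|now apply CP].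
    apply continuous_kernel; intros ->; now apply (Nc w). }
assert (Sh : forall w, Cmod (w - z0) < h -> forall v, Cmod (v - w) < h - Cmod (w - z0) ->
  Cmod (v - z0) < h).
{ intros w Hw v Hv; pose proof (Cmod_triangle_minus v w z0); lra. }
(* [F] is the derivative of [P], and [P] is [K 1] up to the constant; uniqueness of derivatives
   expresses [F] by [K 2]. *)
assert (EF : forall w, Cmod (w - z0) < h ->
  F w = scal (/ (2 * PI * Ci))%C (scal (RtoC (INR 1)) (K 2%nat w))).
{ intros w Hw.
  apply (is_derive_C_unique P w).
  - apply DP; destruct (In w Hw); unfold box; lra.
  - apply (is_derive_ext_C (fun w => scal (/ (2 * PI * Ci))%C (K 1%nat w)) P w _
      (h - Cmod (w - z0))); [lra| |].
    + intros v Hv; destruct (In v (Sh w Hw v Hv)) as [I1 I2]; symmetry.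
      exact (box_primitive_cauchy F lo hi z0 v HFb B0 I1 I2 CP).
    + exact (is_derive_scal_const_C (V := V) _ _ _ _ (DK 1%nat w Hw)). }
(* Each differentiation of [K n] produces the factor [n] and raises the index by one. *)
exists h, (fun w => scal (/ (2 * PI * Ci))%C (scal (RtoC (INR 1)) (scal (RtoC (INR 2)) (K 3%nat w)))),
  (fun w => scal (/ (2 * PI * Ci))%C (scal (RtoC (INR 1)) (scal (RtoC (INR 2))
     (scal (RtoC (INR 3)) (K 4%nat w))))).
split; auto; intros w Hw; split.
- apply (is_derive_ext_C (fun w => scal (/ (2 * PI * Ci))%C (scal (RtoC (INR 1)) (K 2%nat w)))
    F w _ (h - Cmod (w - z0))); [lra| |].
  + intros v Hv; symmetry; apply EF; eauto.
  + exact (is_derive_scal_const_C (V := V) _ _ _ _ (is_derive_scal_const_C (V := V) _ _ _ _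
      (DK 2%nat w Hw))).
- exact (is_derive_scal_const_C (V := V) _ _ _ _ (is_derive_scal_const_C (V := V) _ _ _ _
    (is_derive_scal_const_C (V := V) _ _ _ _ (DK 3%nat w Hw)))).
Qed.

(** [local_regularity] yields a derivative on each small disc separately. One function is chosen
    globally, and uniqueness of derivatives identifies it with the local ones. *)
Lemma differentiable_derivative (F : C -> V) (U : C -> Prop) : open U -> differentiable_on U F ->
  exists F1 : C -> V, (forall z, U z -> is_derive (K := C_AbsRing) F z (F1 z)) /\
    differentiable_on U F1.
Proof.
intros HU HF.
assert (H : forall z, exists l, U z -> is_derive (K := C_AbsRing) F z l).
{ intros z; destruct (classic (U z)) as [Hz|Hz].
  - destruct (HF z Hz) as [l Hl]; now exists l.
  - exists zero; tauto. }
apply choice in H; destruct H as [F1 H1]; exists F1; split; auto.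
intros z Hz; destruct (local_regularity F U z HU Hz HF) as [h [G1 [G2 [h0 HG]]]].
destruct (open_Cmod U z HU Hz) as [d [d0 Hd]].
exists (G2 z); apply (is_derive_ext_C G1 F1 z _ (Rmin d h)); [now apply Rmin_pos| |].
- intros w Hw; apply (is_derive_C_unique F w).
  + apply HG; eapply Rlt_le_trans; [exact Hw|apply Rmin_r].
  + apply H1, Hd; eapply Rlt_le_trans; [exact Hw|apply Rmin_l].
- apply HG; replace (z - z)%C with (RtoC 0) by ring; now rewrite Cmod_0.
Qed.

Definition diff_quotient (F : C -> V) (w : C) (l : V) (z : C) : V :=
  if excluded_middle_informative (z = w) then l
  else scal (/ (z - w))%C (minus (F z) (F w)).

Lemma diff_quotient_eq F w l : diff_quotient F w l w = l.
Proof. unfold diff_quotient; destruct excluded_middle_informative; tauto. Qed.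

Lemma diff_quotient_neq F w l z : z <> w ->
  diff_quotient F w l z = scal (/ (z - w))%C (minus (F z) (F w)).
Proof. unfold diff_quotient; destruct excluded_middle_informative; tauto. Qed.

(** Away from [w] this is the quotient rule. At [w] the derivative is [l / 2], with [l] that of
    [F1]: integrating the remainder of [F1(u) - F1(w) - (u - w) l] from [w] to [z] gives the second
    order expansion of [F], which is divided by [z - w]. *)
Lemma differentiable_diff_quotient (F F1 : C -> V) (U : C -> Prop) (w : C) : open U -> U w ->
  (forall z, U z -> is_derive (K := C_AbsRing) F z (F1 z)) ->
  differentiable_on U F1 ->
  differentiable_on U (diff_quotient F w (F1 w)).
Proof.
intros HU Hw HF HF1 z Hz.
destruct (classic (z = w)) as [->|Hzw].
- destruct (HF1 w Hw) as [l Hl]; exists (scal (/ 2)%C l).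
  destruct (open_Cmod U w HU Hw) as [d [d0 Hd]].
  apply is_derive_norm; intros eps He.
  destruct (proj1 (is_derive_norm _ _ _) Hl eps He) as [e [e0 HE]].
  exists (Rmin d e); split; [now apply Rmin_pos|]; intros z Hz'.
  assert (H1 : Cmod (z - w) < d) by (eapply Rlt_le_trans; [exact Hz'|apply Rmin_l]).
  assert (H2 : Cmod (z - w) < e) by (eapply Rlt_le_trans; [exact Hz'|apply Rmin_r]).
  rewrite diff_quotient_eq.
  destruct (classic (z = w)) as [->|Hzw].
  { rewrite diff_quotient_eq; replace (w - w)%C with (RtoC 0) by ring; rewrite Cmod_0.
    match goal with |- norm ?x <= _ => replace x with (zero : V) by vec V end.
    eapply Rle_trans; [right; exact (norm_zero (V := V))|lra]. }
  rewrite diff_quotient_neq by exact Hzw.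
  assert (Nz : (z - w)%C <> RtoC 0).
  { intros E; apply Hzw, Cmod_eq_minus; rewrite E; apply Cmod_0. }
  assert (Pz : 0 < Cmod (z - w)) by now apply Cmod_gt_0.
  assert (Seg : forall u, on_segment (w, z) u -> Cmod (u - w) <= Cmod (z - w))
    by (intros u Hu; exact (dist_segment (w, z) u Hu)).
  set (g := fun u => plus (F1 u) (opp (plus (F1 w) (scal (u - w)%C l)))).
  assert (Cg : cont_on (on_segment (w, z)) g).
  { intros u Hu; specialize (Seg u Hu); apply (continuous_plus (V := V)).
    - destruct (HF1 u) as [m Hm]; [apply Hd; lra|exact (is_derive_continuous _ _ _ Hm)].
    - apply (continuous_opp (V := V)), (continuous_plus (V := V)); [apply continuous_const|].
      apply (continuous_scal_C (V := V)); [|apply continuous_const].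
      apply continuous_minus_C; [apply continuous_id|apply continuous_const]. }
  assert (E : segment_integral g (w, z) = plus (minus (F z) (F w))
     (opp (plus (scal (z - w)%C (F1 w)) (scal (/ 2 * ((z - w) * (z - w)))%C l)))).
  { rewrite (segment_integral_derive (fun u => plus (F u)
      (opp (plus (scal (u - w)%C (F1 w)) (scal (/ 2 * ((u - w) * (u - w)))%C l)))) g); auto.
    - simpl; vec V.
    - intros u Hu; specialize (Seg u Hu); apply (is_derive_plus (K := C_AbsRing) (V := V)).
      + apply HF, Hd; lra.
      + apply (is_derive_opp (K := C_AbsRing) (V := V)), is_derive_quadratic. }
  assert (N : norm (segment_integral g (w, z)) <= Cmod (z - w) * (eps * Cmod (z - w))).
  { apply (norm_segment_integral_le g (w, z)); auto.
    intros u Hu; specialize (Seg u Hu).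
    replace (g u) with (minus (minus (F1 u) (F1 w)) (scal (u - w)%C l)) by (unfold g; vec V).
    eapply Rle_trans; [apply HE; lra|].
    apply Rmult_le_compat_l; lra. }
  match goal with |- norm ?x <= _ =>
    replace x with (scal (/ (z - w))%C (segment_integral g (w, z))) end.
  2: { rewrite E; vec V; field; auto. }
  eapply Rle_trans; [apply (norm_scal_C (V := V))|].
  rewrite Cmod_inv by auto.
  apply Rmult_le_reg_l with (Cmod (z - w)); auto.
  rewrite <- Rmult_assoc, Rinv_r, Rmult_1_l by lra; exact N.
- assert (Nz : (z - w)%C <> RtoC 0).
  { intros E; apply Hzw, Cmod_eq_minus; rewrite E; apply Cmod_0. }
  assert (Pz : 0 < Cmod (z - w)) by now apply Cmod_gt_0.
  assert (D1 : is_derive (K := C_AbsRing) (V := C_NormedModule) (fun z => z - w)%C z (RtoC 1)).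
  { eapply is_derive_eq.
    - apply is_derive_minus_C; [apply is_derive_id_C|apply is_derive_const_C].
    - Ceq; ring. }
  assert (D2 := is_derive_comp_C (V := C_NormedModule) Cinv _ z _ _
    (is_derive_inv_C _ Nz) D1).
  assert (D3 := is_derive_minus (K := C_AbsRing) (V := V) F (fun _ => F w) z _ _
    (HF z Hz) (is_derive_const (V := V) (F w) z)).
  eexists; apply (is_derive_ext_C (fun z => scal (/ (z - w))%C (minus (F z) (F w))) _ z _
    (Cmod (z - w)) Pz).
  + intros u Hu; symmetry; apply diff_quotient_neq; intros ->.
    rewrite Cmod_minus_sym in Hu; lra.
  + exact (is_derive_scal_C (V := V) _ _ z _ _ D2 D3).
Qed.

End Regularity.

(** * Winding numbers *)

Definition winding_integral (G : list (C * C)) (w : C) : C :=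
  contour_integral (V := C_CompleteNormedModule) (fun z => / (z - w))%C G.

Lemma Cminus_neq_0 (z w : C) : z <> w -> (z - w)%C <> RtoC 0.
Proof. intros H E; apply H, Cmod_eq_minus; rewrite E; apply Cmod_0. Qed.

Lemma cont_on_inv (D : C -> Prop) w : ~ D w ->
  cont_on (V := C_CompleteNormedModule) D (fun z => / (z - w))%C.
Proof.
intros Hw z Hz; apply continuous_inv_C.
- apply continuous_minus_C; [apply continuous_id|apply continuous_const].
- apply Cminus_neq_0; intros ->; now apply Hw.
Qed.

Lemma is_derive_shift_inv w z : z <> w ->
  is_derive (K := C_AbsRing) (V := C_NormedModule) (fun z => / (z - w))%C z
    (- / ((z - w) * (z - w)))%C.
Proof.
intros Hz.
assert (D : is_derive (K := C_AbsRing) (V := C_NormedModule) (fun z => z - w)%C z (RtoC 1)).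
{ eapply is_derive_eq.
  - apply is_derive_minus_C; [apply is_derive_id_C|apply is_derive_const_C].
  - Ceq; ring. }
eapply is_derive_eq.
- exact (is_derive_comp_C (V := C_NormedModule) Cinv _ z _ _
    (is_derive_inv_C _ (Cminus_neq_0 _ _ Hz)) D).
- change (1 * (- / ((z - w) * (z - w))) = - / ((z - w) * (z - w)))%C; ring.
Qed.

Lemma differentiable_inv (D : C -> Prop) w : ~ D w ->
  differentiable_on (V := C_CompleteNormedModule) D (fun z => / (z - w))%C.
Proof.
intros Hw z Hz; eexists; apply is_derive_shift_inv; intros ->; now apply Hw.
Qed.

(** Differentiating the kernel gives [1 / (z - w)^2], which has the primitive [- 1 / (z - w)] along
    [G] and integrates to zero over a cycle. *)
Lemma is_derive_winding_integral G w : is_contour G -> ~ on_contour G w ->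
  is_derive (K := C_AbsRing) (V := C_NormedModule) (winding_integral G) w (RtoC 0).
Proof.
intros HG Hw.
assert (D := is_derive_cauchy_type (V := C_CompleteNormedModule) 1 (fun _ => RtoC 1) G w
  (fun z _ => continuous_const _ _) Hw).
apply (is_derive_ext_C (V := C_NormedModule) _ (winding_integral G) w _ 1 Rlt_0_1) in D.
2: { intros v _; apply (contour_integral_ext (V := C_CompleteNormedModule)); intros z _.
     change ((/ (z - v)) ^ 1 * 1 = / (z - v))%C; ring. }
apply (is_derive_eq _ _ _ _ D).
apply (contour_integral_derive (V := C_CompleteNormedModule) (fun z => - / (z - w))%C); auto.
- intros z Hz.
  assert (N : z <> w) by (intros ->; now apply Hw).
  apply (is_derive_ext (K := C_AbsRing) (V := C_NormedModule) (fun z => 0 - / (z - w))%C);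
    [intros; Ceq; ring|].
  eapply is_derive_eq.
  + apply is_derive_minus_C; [apply is_derive_const_C|now apply is_derive_shift_inv].
  + change (0 - - / ((z - w) * (z - w)) = (RtoC (INR 1) * (/ (z - w)) ^ 2) * 1)%C.
    simpl; field; now apply Cminus_neq_0.
- intros z Hz; apply (continuous_scal_C (V := C_NormedModule)); [|apply continuous_const].
  apply continuous_mult_C; [apply continuous_const|].
  apply continuous_kernel; intros ->; now apply Hw.
Qed.

Lemma Cmod_self (z : C) : Cmod (z - z) = 0.
Proof. replace (z - z)%C with (RtoC 0) by ring; apply Cmod_0. Qed.

Lemma winding_integral_locally_constant G w : is_contour G -> ~ on_contour G w ->
  exists d, 0 < d /\ forall v, Cmod (v - w) < d ->
    ~ on_contour G v /\ winding_integral G v = winding_integral G w.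
Proof.
intros HG Hw; destruct (contour_complement_open G w Hw) as [d [d0 Hd]].
exists d; split; auto; intros v Hv; split; [now apply Hd|].
assert (H := segment_integral_derive (V := C_CompleteNormedModule)
  (winding_integral G) (fun _ => RtoC 0) (w, v)).
rewrite segment_integral_const in H; simpl fst in H; simpl snd in H.
assert (E : ((v - w) * 0 = winding_integral G v - winding_integral G w)%C).
{ apply H.
  - intros z Hz; apply is_derive_winding_integral; auto; apply Hd.
    apply Rle_lt_trans with (Cmod (v - w)); auto; exact (dist_segment (w, v) z Hz).
  - intros z _; apply continuous_const. }
apply Cmod_eq_minus; rewrite <- E, Cmult_0_r; apply Cmod_0.
Qed.

Lemma winding_integral_outside G lo hi w : is_contour G ->
  (forall s, In s G -> box lo hi (fst s) /\ box lo hi (snd s)) -> ~ box lo hi w ->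
  winding_integral G w = RtoC 0.
Proof.
intros HG HB Hw; apply (box_contour_integral (V := C_CompleteNormedModule) _ lo hi); auto.
exact (differentiable_inv (box lo hi) w Hw).
Qed.

Lemma winding_number_integral G w c :
  winding_integral G w = (2 * PI * Ci * c)%C <-> winding_number G w = c.
Proof.
unfold winding_number; fold (winding_integral G w); pose proof two_pi_i_neq_0 as N; split.
- intros ->; rewrite Cmult_assoc, Cinv_l by exact N; ring.
- intros <-; rewrite Cmult_assoc, Cinv_r by exact N; ring.
Qed.

(** Compactness in the Heine-Borel form: bounded coordinates and open complement, the two properties
    that can be checked directly for spectra and hulls. *)
Definition compact_set (K : C -> Prop) : Prop :=
  (exists R, forall w, K w -> Rabs (fst w) <= R /\ Rabs (snd w) <= R) /\
  (forall w, ~ K w -> exists d, 0 < d /\ forall v, Cmod (v - w) < d -> ~ K v).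

(** An open set contains this hull exactly when [G] lies in it and is homologous to zero there, so
    singularities outside the hull do not affect integrals along [G]. *)
Definition contour_hull (G : list (C * C)) (w : C) : Prop :=
  on_contour G w \/ winding_integral G w <> RtoC 0.

Lemma contour_box G : exists R, 0 <= R /\ forall s, In s G ->
  box (- R, - R) (R, R) (fst s) /\ box (- R, - R) (R, R) (snd s).
Proof.
induction G as [|s G [R [R0 HR]]].
{ exists 0; split; [lra|]; intros s []. }
exists (R + Cmod (fst s) + Cmod (snd s)).
pose proof (Cmod_ge_0 (fst s)); pose proof (Cmod_ge_0 (snd s)).
split; [lra|]; intros r [<-|Hr].
- pose proof (Rabs_fst_le (fst s)); pose proof (Rabs_snd_le (fst s)).
  pose proof (Rabs_fst_le (snd s)); pose proof (Rabs_snd_le (snd s)).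
  unfold box; simpl; split_Rabs; lra.
- destruct (HR r Hr) as [H1 H2]; unfold box in *; simpl in *; lra.
Qed.

(** It is bounded because the winding number vanishes outside any box containing the contour, and
    its complement is open because the winding number is locally constant. *)
Lemma compact_contour_hull G : is_contour G -> compact_set (contour_hull G).
Proof.
intros HG; split.
- destruct (contour_box G) as [R [R0 HR]]; exists R; intros w Hw.
  assert (B : box (- R, - R) (R, R) w).
  { apply NNPP; intros N; destruct Hw as [[s [Hs Hz]]|Hw].
    - destruct (HR s Hs); apply N; now apply (box_segment _ _ s).
    - apply Hw; now apply (winding_integral_outside G (- R, - R) (R, R)). }
  unfold box in B; simpl in B; split; split_Rabs; lra.
- intros w Hw.
  assert (H1 : ~ on_contour G w) by (intros H; apply Hw; now left).
  assert (H2 : winding_integral G w = RtoC 0).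
  { apply NNPP; intros H; apply Hw; now right. }
  destruct (winding_integral_locally_constant G w HG H1) as [d [d0 Hd]].
  exists d; split; [exact d0|]; intros v Hv; destruct (Hd v Hv) as [D1 D2].
  intros [H|H]; [now apply D1|apply H; now rewrite D2].
Qed.

Lemma compact_union (K K' : C -> Prop) : compact_set K -> compact_set K' ->
  compact_set (fun w => K w \/ K' w).
Proof.
intros [[R HR] HK] [[R' HR'] HK']; split.
- exists (Rmax R R'); pose proof (Rmax_l R R'); pose proof (Rmax_r R R').
  intros w [Hw|Hw]; [destruct (HR w Hw)|destruct (HR' w Hw)]; lra.
- intros w Hw.
  destruct (HK w) as [d [d0 Hd]]; [tauto|]; destruct (HK' w) as [d' [d0' Hd']]; [tauto|].
  exists (Rmin d d'); split; [now apply Rmin_pos|]; intros v Hv.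
  pose proof (Rmin_l d d'); pose proof (Rmin_r d d').
  intros [Q|Q]; [apply (Hd v)|apply (Hd' v)]; auto; lra.
Qed.

(** The margin is taken in the maximum norm since it becomes the mesh of a grid: a cell of that size
    that meets [K] stays inside [U]. *)
Lemma compact_margin (K U : C -> Prop) : compact_set K -> open U -> (forall w, K w -> U w) ->
  exists d, 0 < d /\ forall w v, K w ->
    Rabs (fst v - fst w) <= d -> Rabs (snd v - snd w) <= d -> U v.
Proof.
intros [[M HR] HK] HU HKU.
(* If [w] in [K] is within [d] of [p] in each coordinate, then [|w - p| < 2 d], so the second clause
   forces [p] into [K]. A point within [d] of [w] in each coordinate is then at distance less than
   [4 d] from [p], and the first clause applies. *)
assert (H : forall p : R * R, exists d : posreal,
  (K p -> forall v, Cmod (v - p) < 4 * d -> U v) /\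
  (~ K p -> forall v, Cmod (v - p) < 2 * d -> ~ K v)).
{ intros p; destruct (classic (K p)) as [Hp|Hp].
  - destruct (open_Cmod U p HU (HKU p Hp)) as [d [d0 Hd]].
    assert (d4 : 0 < d / 4) by lra.
    exists (mkposreal _ d4); split; [|tauto]; intros _ v Hv; apply Hd; simpl in Hv; lra.
  - destruct (HK p Hp) as [d [d0 Hd]].
    assert (d2 : 0 < d / 2) by lra.
    exists (mkposreal _ d2); split; [tauto|]; intros _ v Hv; apply Hd; simpl in Hv; lra. }
apply choice in H; destruct H as [delta Hdelta].
destruct (compactness_value_2d (- M) M (- M) M (fun x y => delta (x, y))) as [d Hd].
exists d; split; [apply cond_pos|]; intros w v Hw H1 H2.
destruct (HR w Hw) as [B1 B2].
specialize (Hd (fst w) (snd w)).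
assert (X : forall a r, Rabs a <= r -> - r <= a <= r) by (intros; split_Rabs; lra).
specialize (Hd (X _ _ B1) (X _ _ B2)); apply NNPP in Hd.
destruct Hd as [x [y [_ [_ [H3 [H4 H5]]]]]].
destruct (Hdelta (x, y)) as [D1 D2].
assert (Kxy : K (x, y)).
{ apply NNPP; intros N; apply (D2 N w); auto.
  eapply Rle_lt_trans; [apply Cmod_le_sum|]; simpl; unfold Rminus in *; lra. }
apply (D1 Kxy); eapply Rle_lt_trans; [apply Cmod_le_sum|]; simpl.
assert (Rabs (fst v + - x) < 2 * delta (x, y)) by (split_Rabs; lra).
assert (Rabs (snd v + - y) < 2 * delta (x, y)) by (split_Rabs; lra).
lra.
Qed.

(** * Grid contours *)

Inductive side : Type := Bottom | Right | Top | Left.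

Definition opposite_side (s : side) : side :=
  match s with Bottom => Top | Right => Left | Top => Bottom | Left => Right end.

Definition neighbor (q : Z * Z) (s : side) : Z * Z :=
  let (i, j) := q in
  match s with
  | Bottom => (i, j - 1)%Z
  | Right => (i + 1, j)%Z
  | Top => (i, j + 1)%Z
  | Left => (i - 1, j)%Z
  end.

(** The same grid edge seen from the cell on its other side, whose boundary runs through it in the
    opposite direction. *)
Definition reverse_edge (e : (Z * Z) * side) : (Z * Z) * side :=
  (neighbor (fst e) (snd e), opposite_side (snd e)).

Lemma reverse_edge_involutive e : reverse_edge (reverse_edge e) = e.
Proof.
destruct e as [[i j] []]; unfold reverse_edge; simpl; f_equal; f_equal; lia.
Qed.

Definition sides : list side := [Bottom; Right; Top; Left].

Lemma filter_split_permutation {A : Type} (f : A -> bool) (l : list A) :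
  Permutation l (filter f l ++ filter (fun x => negb (f x)) l).
Proof.
induction l as [|x l IH]; simpl; [constructor|].
destruct (f x); simpl; [now constructor|].
etransitivity; [apply perm_skip, IH|apply Permutation_middle].
Qed.

Lemma NoDup_list_prod {A B : Type} (l : list A) (l' : list B) :
  NoDup l -> NoDup l' -> NoDup (list_prod l l').
Proof.
intros Hl Hl'; induction Hl as [|a l Ha Hl IH]; simpl; [constructor|].
apply NoDup_app; auto.
- apply Injective_map_NoDup; auto; intros x y E; now injection E.
- intros [x y] H1 H2; apply in_map_iff in H1; destruct H1 as [z [E _]].
  injection E as <- _; apply in_prod_iff in H2; tauto.
Qed.

Lemma is_contour_app G G' : is_contour G -> is_contour G' -> is_contour (G ++ G').
Proof. unfold is_contour; rewrite !map_app; now apply Permutation_app. Qed.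

Lemma is_contour_app_inv G G' : is_contour G -> is_contour (G ++ G') -> is_contour G'.
Proof.
unfold is_contour; rewrite !map_app; intros H1 H2.
apply (Permutation_app_inv_l (map fst G)).
etransitivity; [exact H2|]; apply Permutation_app_tail; now symmetry.
Qed.

Lemma is_contour_permutation G G' : Permutation G G' -> is_contour G -> is_contour G'.
Proof.
unfold is_contour; intros H HG.
etransitivity; [symmetry; apply Permutation_map, H|].
etransitivity; [exact HG|apply Permutation_map, H].
Qed.

Section Grid.

Variable h : R.
Hypothesis h0 : 0 < h.

Definition cell_lo (q : Z * Z) : C := (h * IZR (fst q), h * IZR (snd q)).
Definition cell_hi (q : Z * Z) : C := (h * (IZR (fst q) + 1), h * (IZR (snd q) + 1)).

Definition edge (e : (Z * Z) * side) : C * C :=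
  let (q, s) := e in
  let a := cell_lo q in
  let b := cell_hi q in
  match s with
  | Bottom => (a, corner b a)
  | Right => (corner b a, b)
  | Top => (b, corner a b)
  | Left => (corner a b, a)
  end.

Lemma edge_cell q : map edge (map (pair q) sides) = rectangle (cell_lo q) (cell_hi q).
Proof. reflexivity. Qed.

Lemma edge_reverse e : edge (reverse_edge e) = segment_rev (edge e).
Proof.
destruct e as [[i j] []]; unfold reverse_edge, segment_rev, edge, cell_lo, cell_hi, corner; simpl;
  repeat f_equal; rewrite ?minus_IZR, ?plus_IZR; ring.
Qed.

Lemma cell_lt q : fst (cell_lo q) < fst (cell_hi q) /\ snd (cell_lo q) < snd (cell_hi q).
Proof. unfold cell_lo, cell_hi; simpl; nra. Qed.

Definition in_cell (q : Z * Z) (z : C) : Prop := box (cell_lo q) (cell_hi q) z.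

Lemma on_edge_in_cell e z : on_segment (edge e) z -> in_cell (fst e) z.
Proof.
intros Hz; destruct (cell_lt (fst e)).
apply on_rectangle_side; try lra.
exists (edge e); split; auto.
rewrite <- edge_cell; apply in_map; destruct e as [q s]; apply in_map.
destruct s; simpl; tauto.
Qed.

Lemma on_edge_in_neighbor e z : on_segment (edge e) z -> in_cell (neighbor (fst e) (snd e)) z.
Proof.
intros Hz; apply (on_edge_in_cell (reverse_edge e)).
now rewrite edge_reverse, on_segment_rev.
Qed.

Lemma exists_cell z : exists q, in_cell q z.
Proof.
assert (H : forall x, exists i, h * IZR i <= x <= h * (IZR i + 1)).
{ intros x; destruct (archimed (x / h)) as [A1 A2]; exists (up (x / h) - 1)%Z.
  rewrite minus_IZR; replace x with (h * (x / h)) at 2 3 by (field; lra); nra. }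
destruct (H (fst z)) as [i Hi]; destruct (H (snd z)) as [j Hj].
exists (i, j); split; simpl; auto.
Qed.

Definition cell_edges (I : list (Z * Z)) : list (Z * Z * side) := list_prod I sides.

Lemma cell_edges_cons q I : cell_edges (q :: I) = map (pair q) sides ++ cell_edges I.
Proof. reflexivity. Qed.

Section Cells.

Variable I : list (Z * Z).
Hypothesis HI : NoDup I.

Let inner (e : Z * Z * side) : bool :=
  if in_dec (fun p q : Z * Z => ltac:(decide equality; apply Z.eq_dec)) (fst (reverse_edge e)) I
  then true else false.

(* The edges between two cells of [I] occur in both directions and cancel. *)
Definition boundary_edges : list (Z * Z * side) :=
  filter (fun e => negb (inner e)) (cell_edges I).

Let inner_edges : list (Z * Z * side) := filter inner (cell_edges I).

Lemma in_cell_edges e : In e (cell_edges I) <-> In (fst e) I.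
Proof.
destruct e as [q s]; unfold cell_edges; rewrite in_prod_iff; simpl.
destruct s; tauto.
Qed.

Lemma innerE e : inner e = true <-> In (fst (reverse_edge e)) I.
Proof. unfold inner; destruct in_dec; split; auto; discriminate. Qed.

Lemma in_boundary_edges e :
  In e boundary_edges <-> In (fst e) I /\ ~ In (neighbor (fst e) (snd e)) I.
Proof.
unfold boundary_edges; rewrite filter_In, in_cell_edges.
change (neighbor (fst e) (snd e)) with (fst (reverse_edge e)); rewrite <- innerE.
destruct (inner e); simpl; intuition discriminate.
Qed.

(** Reversal is an involution that exchanges an edge's cell with the neighbor across it; for inner
    edges both belong to [I]. *)
Lemma inner_edges_reverse : Permutation inner_edges (map reverse_edge inner_edges).
Proof.
assert (N : NoDup inner_edges).
{ apply NoDup_filter, NoDup_list_prod; auto.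
  repeat constructor; simpl; intuition discriminate. }
assert (R : forall e, In e inner_edges -> In (reverse_edge e) inner_edges).
{ intros e; unfold inner_edges; rewrite !filter_In, !in_cell_edges, !innerE.
  rewrite reverse_edge_involutive; tauto. }
apply NoDup_Permutation; auto.
- apply Injective_map_NoDup; auto; intros x y E.
  now rewrite <- (reverse_edge_involutive x), E, reverse_edge_involutive.
- intros e; rewrite in_map_iff; split.
  + intros He; exists (reverse_edge e); split; [apply reverse_edge_involutive|auto].
  + intros [e' [<- He']]; auto.
Qed.

Lemma map_edge_reverse l : map edge (map reverse_edge l) = map segment_rev (map edge l).
Proof. rewrite !map_map; apply map_ext, edge_reverse. Qed.

(** All edges of the cells form a cycle, rectangle by rectangle, and the inner edges form one since
    they are closed under reversal; removing a cycle from a cycle leaves a cycle. *)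
Lemma is_contour_boundary : is_contour (map edge boundary_edges).
Proof.
apply (is_contour_app_inv (map edge inner_edges)).
- unfold is_contour.
  etransitivity; [apply Permutation_map, Permutation_map, inner_edges_reverse|].
  rewrite map_edge_reverse, !map_map; apply Permutation_refl.
- rewrite <- map_app.
  apply (is_contour_permutation (map edge (cell_edges I))).
  { apply Permutation_map, filter_split_permutation. }
  clear HI inner inner_edges; induction I as [|q J IH]; [constructor|].
  rewrite cell_edges_cons, map_app.
  apply is_contour_app; [apply is_contour_rectangle|exact IH].
Qed.

(** By [inner_edges_reverse] the integral over the inner edges equals its own negative, hence is
    zero. *)
Lemma contour_integral_boundary {V : CompleteNormedModule C_AbsRing} (g : C -> V) :
  (forall q, In q I -> cont_on (on_contour (rectangle (cell_lo q) (cell_hi q))) g) ->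
  contour_integral g (map edge boundary_edges) =
  contour_integral g (map edge (cell_edges I)).
Proof.
intros Hg.
assert (Ci : cont_on (on_contour (map edge inner_edges)) g).
{ intros z [s [Hs Hz]]; apply in_map_iff in Hs; destruct Hs as [[q r] [<- He]].
  apply filter_In in He; destruct He as [He _]; apply in_cell_edges in He.
  apply (Hg q He); exists (edge (q, r)); split; auto.
  rewrite <- edge_cell; apply in_map, in_map; destruct r; simpl; tauto. }
rewrite (contour_integral_permutation g _ _
  (Permutation_map edge (filter_split_permutation inner (cell_edges I)))).
rewrite map_app, contour_integral_app.
fold inner_edges; fold boundary_edges.
assert (E := contour_integral_permutation g _ _ (Permutation_map edge inner_edges_reverse)).
rewrite map_edge_reverse, contour_integral_rev in E by exact Ci.
set (v := contour_integral g (map edge inner_edges)) in *.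
assert (Z : v = zero).
{ transitivity (scal (/ 2)%C (plus v v)); [vec V; field|].
  rewrite E at 2; vec V. }
rewrite Z; symmetry; apply (plus_zero_l (G := V)).
Qed.

Lemma contour_integral_cells {V : CompleteNormedModule C_AbsRing} (g : C -> V) :
  (forall q, In q I -> contour_integral g (rectangle (cell_lo q) (cell_hi q)) = zero) ->
  contour_integral g (map edge (cell_edges I)) = zero.
Proof.
clear HI inner inner_edges; induction I as [|q J IH]; intros H; [easy|].
rewrite cell_edges_cons, map_app, contour_integral_app.
rewrite edge_cell, H by now left.
rewrite (plus_zero_l (G := V)); apply IH; intros; apply H; now right.
Qed.

End Cells.

Lemma cell_contour_integral {V : CompleteNormedModule C_AbsRing} (g : C -> V) q :
  differentiable_on (in_cell q) g ->
  contour_integral g (rectangle (cell_lo q) (cell_hi q)) = zero.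
Proof.
intros Hg; destruct (cell_lt q).
apply (box_contour_integral g (cell_lo q) (cell_hi q) Hg); [apply is_contour_rectangle|].
intros s; apply rectangle_box; lra.
Qed.

Lemma interior_unique_cell q q' z :
  fst (cell_lo q) < fst z < fst (cell_hi q) -> snd (cell_lo q) < snd z < snd (cell_hi q) ->
  in_cell q' z -> q' = q.
Proof.
assert (H : forall (i j : Z) x, h * IZR i < x < h * (IZR i + 1) ->
  h * IZR j <= x <= h * (IZR j + 1) -> j = i).
{ intros i j x H1 H2.
  assert (A : h * IZR j < h * (IZR i + 1)) by lra.
  assert (B : h * IZR i < h * (IZR j + 1)) by lra.
  apply Rmult_lt_reg_l in A; auto; apply Rmult_lt_reg_l in B; auto.
  rewrite <- plus_IZR in A, B; apply lt_IZR in A, B; lia. }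
destruct q as [i j], q' as [i' j']; unfold in_cell, box, cell_lo, cell_hi; simpl.
intros H1 H2 [H3 H4]; f_equal; eapply H; eassumption.
Qed.

(** Only the cell with [w] in its interior contributes; over every other cell the kernel is
    differentiable and integrates to zero. *)
Lemma winding_integral_cells I q w : NoDup I -> In q I ->
  fst (cell_lo q) < fst w < fst (cell_hi q) -> snd (cell_lo q) < snd w < snd (cell_hi q) ->
  winding_integral (map edge (boundary_edges I)) w = (2 * PI * Ci)%C.
Proof.
intros HI Hq H1 H2; unfold winding_integral.
assert (Zq : forall q', q' <> q -> ~ in_cell q' w).
{ intros q' N Hw; apply N; now apply (interior_unique_cell q q' w). }
rewrite contour_integral_boundary; auto.
2: { intros q' _; apply cont_on_inv; intros Hw; destruct (cell_lt q').
     apply on_rectangle_side in Hw; [|lra|lra]; destruct Hw as [B S].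
     assert (E : q' = q) by now apply (interior_unique_cell q q' w).
     subst q'; lra. }
destruct (in_split _ _ Hq) as [l1 [l2 E]]; subst I.
assert (N := NoDup_remove_2 _ _ _ HI).
assert (App : forall l l', cell_edges (l ++ l') = cell_edges l ++ cell_edges l').
{ intros l l'; induction l as [|x l IH]; [easy|].
  simpl app; rewrite !cell_edges_cons, IH; apply app_assoc. }
rewrite App, map_app, contour_integral_app.
rewrite cell_edges_cons, map_app, contour_integral_app, edge_cell, contour_integral_inv_rectangle by auto.
rewrite !contour_integral_cells.
- change (0 + (2 * PI * Ci + 0) = 2 * PI * Ci)%C; ring.
- intros q' Hq'; apply cell_contour_integral, differentiable_inv, Zq.
  intros ->; apply N, in_or_app; now right.
- intros q' Hq'; apply cell_contour_integral, differentiable_inv, Zq.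
  intros ->; apply N, in_or_app; now left.
Qed.

Lemma exists_cells (K : C -> Prop) : compact_set K ->
  exists I, NoDup I /\ forall q, In q I <-> exists w, K w /\ in_cell q w.
Proof.
intros [[R HR] _].
(* A cell meeting the strip between [-R] and [R] has an index between [-|R| / h - 1] and [|R| / h],
   so indices from [-N] to [N] suffice. *)
set (N := Z.to_nat (up (Rabs R / h + 1))).
set (range := map (fun n => Z.of_nat n - Z.of_nat N)%Z (seq 0 (2 * N + 1))).
assert (Nr : NoDup range).
{ apply Injective_map_NoDup; [|apply seq_NoDup]; intros x y E; lia. }
assert (Inr : forall i x, Rabs x <= R -> h * IZR i <= x <= h * (IZR i + 1) -> In i range).
{ intros i x Hx Hi.
  destruct (archimed (Rabs R / h + 1)) as [A _].
  assert (P : 0 <= Rabs R / h) by (apply Rmult_le_pos; [apply Rabs_pos|apply Rlt_le, Rinv_0_lt_compat, h0]).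
  assert (UZ : (0 <= up (Rabs R / h + 1))%Z) by (apply le_IZR; lra).
  assert (Bx : - (h * (Rabs R / h)) <= x <= h * (Rabs R / h)).
  { replace (h * (Rabs R / h)) with (Rabs R) by (field; lra); split_Rabs; lra. }
  assert (B1 : IZR i <= Rabs R / h) by (apply Rmult_le_reg_l with h; lra).
  assert (B2 : - (Rabs R / h) <= IZR i + 1) by (apply Rmult_le_reg_l with h; lra).
  assert (C1 : (i < up (Rabs R / h + 1))%Z) by (apply lt_IZR; lra).
  assert (C2 : (- up (Rabs R / h + 1) < i)%Z) by (apply lt_IZR; rewrite opp_IZR; lra).
  apply in_map_iff; exists (Z.to_nat (i + Z.of_nat N)); unfold N; split; [lia|].
  apply in_seq; lia. }
set (test := fun q : Z * Z =>
  if excluded_middle_informative (exists w, K w /\ in_cell q w) then true else false).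
exists (filter test (list_prod range range)); split.
{ now apply NoDup_filter, NoDup_list_prod. }
assert (T : forall q, test q = true <-> exists w, K w /\ in_cell q w)
  by (intros q; unfold test; destruct excluded_middle_informative; split; auto; discriminate).
intros q; rewrite filter_In, T; split; [tauto|]; intros Hq; split; auto.
destruct Hq as [w [Hw [Bi Bj]]], q as [i j], (HR w Hw); simpl in *.
apply in_prod; eauto.
Qed.

End Grid.

Lemma towards_midpoint lo hi x t : lo < hi -> lo <= x <= hi -> 0 < t <= 1 / 2 ->
  lo < x + t * ((lo + hi) / 2 - x) < hi.
Proof.
intros H1 [H2 H3] [H4 H5].
assert (0 <= (1 - t) * (x - lo)) by (apply Rmult_le_pos; lra).
assert (0 <= (1 - t) * (hi - x)) by (apply Rmult_le_pos; lra).
assert (0 < t * (hi - lo)) by (apply Rmult_lt_0_compat; lra).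
lra.
Qed.

(** The contour bounds the union of the grid cells meeting [K], all contained in [U]. The last
    clause, Cauchy's theorem for this particular contour, holds cell by cell; Cauchy's theorem for
    general cycles is derived from it. *)
Lemma grid_contour (K U : C -> Prop) : compact_set K -> open U -> (forall w, K w -> U w) ->
  exists G, surrounds K U G /\
    forall (V : CompleteNormedModule C_AbsRing) (H : C -> V),
      differentiable_on U H -> contour_integral H G = zero.
Proof.
intros HK HU HKU.
destruct (compact_margin K U HK HU HKU) as [h [h0 Hh]].
destruct (exists_cells h h0 K HK) as [I [NI HI]].
assert (CU : forall q z, In q I -> in_cell h q z -> U z).
{ intros q z Hq Hz; apply HI in Hq; destruct Hq as [w [Hw Bw]]; apply (Hh w z Hw);
    destruct Bw as [W1 W2], Hz as [Z1 Z2]; unfold cell_lo, cell_hi in *; simpl in *;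
    split_Rabs; lra. }
set (G := map (edge h) (boundary_edges I)).
assert (HG : is_contour G) by now apply is_contour_boundary.
(* A boundary edge also lies in a neighboring cell that is not in [I], and every cell meeting [K] is
   in [I]; so the edge misses [K]. *)
assert (EG : forall z, on_contour G z -> U z /\ ~ K z).
{ intros z [s [Hs Hz]]; apply in_map_iff in Hs; destruct Hs as [e [<- He]].
  apply in_boundary_edges in He; destruct He as [H1 H2]; split.
  - apply (CU (fst e)); auto; now apply on_edge_in_cell.
  - intros Kz; apply H2, HI; exists z; split; auto; now apply on_edge_in_neighbor. }
assert (Z : forall (V : CompleteNormedModule C_AbsRing) (H : C -> V),
  differentiable_on U H -> contour_integral H G = zero).
{ intros V H DH.
  assert (DC : forall q, In q I -> differentiable_on (in_cell h q) H)
    by (intros q Hq z Hz; apply DH; eauto).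
  unfold G; rewrite contour_integral_boundary; auto.
  - apply contour_integral_cells; intros q Hq; apply cell_contour_integral; auto.
  - intros q Hq z Hz; destruct (cell_lt h h0 q).
    apply (differentiable_cont_on _ _ (DC q Hq)).
    apply on_rectangle_side in Hz; [|lra|lra]; apply Hz. }
exists G; split; [|exact Z].
split; [exact HG|split; [|split]].
- intros s t Hs Ht; apply EG; exists s; split; auto; now exists t.
- intros w Hw; apply winding_number_integral.
  destruct (exists_cell h h0 w) as [q Bq].
  assert (Hq : In q I) by (apply HI; now exists w).
  destruct (winding_integral_locally_constant G w HG) as [d [d0 Hd]].
  { intros Hc; now apply (EG w). }
  (* A point [w] of [K] may lie on a grid line, where [winding_integral_cells] is silent. It is
     moved slightly towards the center [c] of its cell, into the interior; [t] is small enough to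
     stay where the winding number is constant. *)
  set (c := ((fst (cell_lo h q) + fst (cell_hi h q)) / 2,
             (snd (cell_lo h q) + snd (cell_hi h q)) / 2) : C).
  set (t := Rmin (1 / 2) (d / (2 * (Cmod (c - w) + 1)))).
  pose proof (Cmod_ge_0 (c - w)) as N0.
  assert (t0 : 0 < t) by (apply Rmin_pos; [lra|apply Rdiv_lt_0_compat; lra]).
  assert (t1 : t <= 1 / 2) by apply Rmin_l.
  set (v := segment_point (w, c) t).
  assert (Hv : Cmod (v - w) < d).
  { replace (v - w)%C with (RtoC t * (c - w))%C by (unfold v, segment_point; simpl; ring).
    rewrite Cmod_mult, Cmod_R, Rabs_right by lra.
    apply Rle_lt_trans with (d / (2 * (Cmod (c - w) + 1)) * Cmod (c - w)).
    - apply Rmult_le_compat_r; auto; apply Rmin_r.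
    - apply Rmult_lt_reg_r with (2 * (Cmod (c - w) + 1)); [lra|].
      replace (d / (2 * (Cmod (c - w) + 1)) * Cmod (c - w) * (2 * (Cmod (c - w) + 1)))
        with (d * Cmod (c - w)) by (field; lra).
      nra. }
  destruct (Hd v Hv) as [_ <-].
  destruct (cell_lt h h0 q) as [L1 L2]; destruct Bq as [B1 B2].
  unfold G; rewrite (winding_integral_cells h h0 I q v); auto.
  + ring.
  + unfold v; rewrite fst_segment_point; now apply towards_midpoint.
  + unfold v; rewrite snd_segment_point; now apply towards_midpoint.
- intros w Hw; apply winding_number_integral; rewrite Cmult_0_r.
  apply (Z C_CompleteNormedModule), differentiable_inv, Hw.
Qed.

(** * Cauchy's theorem for cycles *)

Section Homology.

Context {V : CompleteNormedModule C_AbsRing}.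

(** The difference quotient of [F] at [w] is differentiable on all of [U], so its integral vanishes;
    splitting the numerator [F z - F w] gives the two sides. *)
Lemma cauchy_formula_of_null (U : C -> Prop) G (F : C -> V) w : open U ->
  (forall H : C -> V, differentiable_on U H -> contour_integral H G = zero) ->
  (forall z, on_contour G z -> U z) ->
  differentiable_on U F -> U w -> ~ on_contour G w ->
  contour_integral (fun z => scal (/ (z - w))%C (F z)) G = scal (winding_integral G w) (F w).
Proof.
intros HU HZ HG HF Uw Hw.
destruct (differentiable_derivative F U HU HF) as [F1 [H1 H2]].
assert (Z := HZ _ (differentiable_diff_quotient F F1 U w HU Uw H1 H2)).
assert (CI := cont_on_inv (on_contour G) w Hw).
assert (CF : cont_on (on_contour G) F)
  by (intros z Hz; apply (differentiable_cont_on _ _ HF), HG, Hz).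
assert (E : contour_integral (diff_quotient F w (F1 w)) G =
  plus (contour_integral (fun z => scal (/ (z - w))%C (F z)) G)
       (opp (scal (winding_integral G w) (F w)))).
{ transitivity (contour_integral (fun z => plus (scal (/ (z - w))%C (F z))
    (scal (/ (z - w))%C (opp (F w)))) G).
  { apply contour_integral_ext; intros z Hz.
    rewrite diff_quotient_neq by (intros ->; now apply Hw).
    exact (scal_distr_l (V := V) _ _ _). }
  etransitivity.
  { apply contour_integral_plus; apply cont_on_integrable; intros z Hz;
      (apply (continuous_scal_C (V := V)); [now apply CI|]);
      [now apply CF|apply continuous_const]. }
  rewrite (contour_integral_scal_l (fun z => / (z - w))%C) by exact CI.
  fold (winding_integral G w); vec V. }
rewrite Z in E.
apply (f_equal (fun v => plus v (scal (winding_integral G w) (F w)))) in E.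
etransitivity; [|etransitivity; [symmetry; exact E|]]; vec V.
Qed.

(* The Cauchy formula on a grid contour around the hull of [G] expresses [F] on [G];
   the winding number of [G] vanishes on that contour. *)
Lemma cauchy_homology (U : C -> Prop) G (F : C -> V) : open U -> is_contour G ->
  (forall z, on_contour G z -> U z) ->
  (forall w, ~ U w -> winding_integral G w = RtoC 0) ->
  differentiable_on U F -> contour_integral F G = zero.
Proof.
intros HU HG GU Hout HF.
assert (KU : forall w, contour_hull G w -> U w).
{ intros w [Hw|Hw]; [now apply GU|]; apply NNPP; intros N; now apply Hw, Hout. }
destruct (grid_contour (contour_hull G) U (compact_contour_hull G HG) HU KU)
  as [G0 [[HG0 [S1 [S2 S3]]] HZ]].
assert (G0U : forall z, on_contour G0 z -> U z /\ ~ contour_hull G z).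
{ intros z [s [Hs [t [Ht ->]]]]; now apply S1. }
set (c := (/ (2 * PI * Ci))%C).
set (k := fun z u : C => scal (c * / (u - z))%C (F u)).
transitivity (contour_integral (fun z => contour_integral (k z) G0) G).
{ apply contour_integral_ext; intros z Hz.
  assert (Kz : contour_hull G z) by now left.
  assert (Nz : ~ on_contour G0 z) by (intros N; now apply (G0U z N)).
  assert (E := cauchy_formula_of_null U G0 F z HU (HZ V) (fun z Hz => proj1 (G0U z Hz)) HF
    (KU z Kz) Nz).
  assert (W : winding_integral G0 z = (2 * PI * Ci)%C).
  { rewrite <- (Cmult_1_r (2 * PI * Ci)); now apply winding_number_integral, S2. }
  rewrite W in E.
  transitivity (scal c (scal (2 * PI * Ci)%C (F z))).
  - vec V; unfold c; rewrite Cmult_1_r, Cinv_l; [easy|exact two_pi_i_neq_0].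
  - rewrite <- E, <- contour_integral_scal.
    + apply contour_integral_ext; intros u _; unfold k; vec V.
    + intros u Hu; apply (continuous_scal_C (V := V)).
      * now apply (cont_on_inv (on_contour G0) z Nz).
      * apply (differentiable_cont_on _ _ HF), G0U, Hu. }
rewrite contour_integral_fubini.
- etransitivity; [|apply (contour_integral_zero G0)].
  apply contour_integral_ext; intros u Hu; destruct (G0U u Hu) as [Uu Nu].
  assert (Nc : ~ on_contour G u) by (intros N; apply Nu; now left).
  assert (W : winding_integral G u = RtoC 0) by (apply NNPP; intros N; apply Nu; now right).
  unfold k; transitivity (contour_integral (fun z => scal (/ (z - u))%C (scal (- c)%C (F u))) G).
  { apply contour_integral_ext; intros z Hz.
    assert (N : z <> u) by (intros ->; now apply Nc).
    vec V; field; split; apply Cminus_neq_0; auto. }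
  rewrite (contour_integral_scal_l (fun z => / (z - u))%C) by now apply cont_on_inv.
  change (contour_integral (V := C_CompleteNormedModule) (fun z => / (z - u))%C G)
    with (winding_integral G u).
  rewrite W; vec V.
- intros z u Hz Hu; unfold continuous2, k.
  apply (continuous_scal_C (T := prod_UniformSpace C_UniformSpace C_UniformSpace) (V := V)
    (fun p => c * / (snd p - fst p))%C (fun p => F (snd p))).
  + apply continuous_mult_C; [apply continuous_const|].
    apply continuous_inv_C.
    * apply continuous_minus_C.
      -- apply (continuous_snd (U := C_UniformSpace) (V := C_UniformSpace)).
      -- apply (continuous_fst (U := C_UniformSpace) (V := C_UniformSpace)).
    * simpl; apply Cminus_neq_0; intros ->; apply (proj2 (G0U z Hu)); now left.
  + apply (continuous_comp (U := prod_UniformSpace C_UniformSpace C_UniformSpace)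
      (V := C_UniformSpace) snd F).
    * apply (continuous_snd (U := C_UniformSpace) (V := C_UniformSpace)).
    * apply (differentiable_cont_on _ _ HF), G0U, Hu.
Qed.

End Homology.

Lemma surrounds_on_contour K (U : C -> Prop) G : surrounds K U G ->
  forall z, on_contour G z -> U z /\ ~ K z.
Proof. intros [_ [H _]] z [s [Hs [t [Ht ->]]]]; now apply H. Qed.

Lemma surrounds_inside K (U : C -> Prop) G w : surrounds K U G -> K w ->
  winding_integral G w = (2 * PI * Ci)%C.
Proof.
intros [_ [_ [H _]]] Hw; rewrite <- (Cmult_1_r (2 * PI * Ci)).
now apply winding_number_integral, H.
Qed.

Lemma surrounds_outside K (U : C -> Prop) G w : surrounds K U G -> ~ U w ->
  winding_integral G w = RtoC 0.
Proof.
intros [_ [_ [_ H]]] Hw; rewrite <- (Cmult_0_r (2 * PI * Ci)).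
now apply winding_number_integral, H.
Qed.

Lemma surrounds_mono (K K' U U' : C -> Prop) G : surrounds K U G ->
  (forall z, K' z -> K z) -> (forall z, U z -> U' z) -> surrounds K' U' G.
Proof.
intros [H1 [H2 [H3 H4]]] HK HU; split; [exact H1|split; [|split]].
- intros s t Hs Ht; destruct (H2 s t Hs Ht); split; auto.
- auto.
- auto.
Qed.

Lemma open_minus_compact (K U : C -> Prop) : compact_set K -> open U ->
  open (fun z => U z /\ ~ K z).
Proof.
intros [_ HK] HU z [Uz Kz]; apply locally_Cmod.
destruct (open_Cmod U z HU Uz) as [d [d0 Hd]]; destruct (HK z Kz) as [e [e0 He]].
exists (Rmin d e); split; [now apply Rmin_pos|]; intros w Hw.
pose proof (Rmin_l d e); pose proof (Rmin_r d e); split; [apply Hd|apply He]; lra.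
Qed.

Section Surrounds.

Context {V : CompleteNormedModule C_AbsRing}.

Lemma surrounds_contour_integral_zero K (U : C -> Prop) G (F : C -> V) : open U ->
  surrounds K U G -> differentiable_on U F -> contour_integral F G = zero.
Proof.
intros HU HG; apply cauchy_homology; [exact HU|apply HG| |].
- intros z Hz; now apply (surrounds_on_contour K U G HG).
- intros w; now apply (surrounds_outside K U G).
Qed.

Lemma surrounds_cauchy_formula K (U : C -> Prop) G (F : C -> V) w : open U ->
  surrounds K U G -> differentiable_on U F -> K w -> U w ->
  contour_integral (fun z => scal (/ (z - w))%C (F z)) G = scal (2 * PI * Ci)%C (F w).
Proof.
intros HU HG HF Kw Uw; rewrite <- (surrounds_inside K U G w HG Kw).
apply (cauchy_formula_of_null U); auto.
- intros H HH; now apply (surrounds_contour_integral_zero K U G H).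
- intros z Hz; now apply (surrounds_on_contour K U G HG).
- intros N; now apply (surrounds_on_contour K U G HG w N).
Qed.

(** The cycle [G] followed by the reversed [G'] lies in [U] minus [K] and winds around no point
    outside that set: the contributions cancel on [K], and both vanish outside [U]. *)
Lemma surrounds_contour_integral_eq K (U : C -> Prop) G G' (F : C -> V) :
  compact_set K -> open U -> surrounds K U G -> surrounds K U G' ->
  differentiable_on (fun z => U z /\ ~ K z) F ->
  contour_integral F G = contour_integral F G'.
Proof.
intros HK HU HG HG' HF.
set (D := fun z => U z /\ ~ K z).
assert (HD : open D) by now apply open_minus_compact.
assert (CG : forall H : list (C * C), surrounds K U H -> cont_on (on_contour H) F).
{ intros H HH z Hz; apply (differentiable_cont_on D F HF).
  exact (surrounds_on_contour K U H HH z Hz). }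
assert (Z : contour_integral F (G ++ map segment_rev G') = zero).
{ apply (cauchy_homology D); auto.
  - apply is_contour_app; [apply HG|].
    unfold is_contour; rewrite !map_map; symmetry; apply HG'.
  - intros z Hz; apply on_contour_app in Hz; rewrite on_contour_rev in Hz.
    destruct Hz as [Hz|Hz];
      [exact (surrounds_on_contour K U G HG z Hz)|exact (surrounds_on_contour K U G' HG' z Hz)].
  - intros w Hw; unfold winding_integral; rewrite contour_integral_app, contour_integral_rev.
    2: { apply cont_on_inv; intros N; apply Hw; exact (surrounds_on_contour K U G' HG' w N). }
    fold (winding_integral G w); fold (winding_integral G' w).
    destruct (classic (U w)) as [Uw|Uw].
    + assert (Kw : K w) by (apply NNPP; intros N; now apply Hw).
      rewrite (surrounds_inside K U G w HG Kw), (surrounds_inside K U G' w HG' Kw).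
      exact (plus_opp_r (G := C_AbelianGroup) _).
    + rewrite (surrounds_outside K U G w HG Uw), (surrounds_outside K U G' w HG' Uw).
      exact (plus_opp_r (G := C_AbelianGroup) _). }
rewrite contour_integral_app, contour_integral_rev in Z by auto.
apply (f_equal (fun v => plus v (contour_integral F G'))) in Z.
etransitivity; [|etransitivity; [exact Z|]]; vec V.
Qed.

End Surrounds.

Lemma exists_surrounds (K U : C -> Prop) : compact_set K -> open U -> (forall w, K w -> U w) ->
  exists G, surrounds K U G.
Proof. intros HK HU HKU; destruct (grid_contour K U HK HU HKU) as [G [HG _]]; now exists G. Qed.

(** * The Banach algebra of bounded operators *)

Ltac vec_op :=
  lazymatch goal with |- @eq ?t _ _ =>
    lazymatch eval hnf in t with BOp ?X => vec (@BOp_NormedModule X) end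
  end.

Section Algebra.

Context {X : CompleteNormedModule C_AbsRing}.
Implicit Types M N P Q S T Y : BOp X.

Lemma bop_comp_assoc S T Y : bop_comp S (bop_comp T Y) = bop_comp (bop_comp S T) Y.
Proof. apply bop_ext; easy. Qed.

Lemma bop_comp_id_l T : bop_comp bop_id T = T.
Proof. apply bop_ext; easy. Qed.

Lemma bop_comp_id_r T : bop_comp T bop_id = T.
Proof. apply bop_ext; easy. Qed.

Lemma opnorm_comp S T : opnorm (bop_comp S T) <= opnorm S * opnorm T.
Proof.
apply opnorm_le.
- apply Rmult_le_pos; apply opnorm_ge_0.
- intros x; simpl; eapply Rle_trans; [apply opnorm_bound|].
  rewrite Rmult_assoc; apply Rmult_le_compat_l; [apply opnorm_ge_0|apply opnorm_bound].
Qed.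

Lemma is_linear_comp_l S :
  is_linear (U := BOp_CompleteNormedModule) (V := BOp_CompleteNormedModule) (bop_comp S).
Proof.
split.
- intros T Y; apply bop_ext; intros x; exact (linear_plus _ (bop_linear S) _ _).
- intros c T; apply bop_ext; intros x; exact (linear_scal _ (bop_linear S) _ _).
- exists (opnorm S + 1); split; [pose proof (opnorm_ge_0 S); lra|]; intros T.
  change (opnorm (bop_comp S T) <= (opnorm S + 1) * opnorm T).
  pose proof (opnorm_comp S T); pose proof (opnorm_ge_0 T); lra.
Qed.

Lemma is_linear_comp_r S :
  is_linear (U := BOp_CompleteNormedModule) (V := BOp_CompleteNormedModule)
    (fun T => bop_comp T S).
Proof.
split.
- intros T Y; apply bop_ext; easy.
- intros c T; apply bop_ext; easy.
- exists (opnorm S + 1); split; [pose proof (opnorm_ge_0 S); lra|]; intros T.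
  change (opnorm (bop_comp T S) <= (opnorm S + 1) * opnorm T).
  pose proof (opnorm_comp T S); pose proof (opnorm_ge_0 T); lra.
Qed.

Lemma bop_comp_plus_r S T Y : bop_comp S (plus T Y) = plus (bop_comp S T) (bop_comp S Y).
Proof. exact (linear_plus _ (is_linear_comp_l S) T Y). Qed.

Lemma bop_comp_scal_r c S T : bop_comp S (scal c T) = scal c (bop_comp S T).
Proof. exact (linear_scal _ (is_linear_comp_l S) c T). Qed.

Lemma bop_comp_opp_r S T : bop_comp S (opp T) = opp (bop_comp S T).
Proof. exact (linear_opp _ T (is_linear_comp_l S)). Qed.

Lemma bop_comp_plus_l S T Y : bop_comp (plus S T) Y = plus (bop_comp S Y) (bop_comp T Y).
Proof. apply bop_ext; easy. Qed.

Lemma bop_comp_scal_l c S T : bop_comp (scal c S) T = scal c (bop_comp S T).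
Proof. apply bop_ext; easy. Qed.

Lemma bop_comp_opp_l S T : bop_comp (opp S) T = opp (bop_comp S T).
Proof. apply bop_ext; easy. Qed.

End Algebra.

(* The [change]s make all linear operations syntactically those of [BOp X]: the
   rewrite rules do not see through the other, convertible structures. *)
Ltac bop_expand := unfold minus;
  repeat match goal with
  | |- context [@plus ?G ?a ?b] =>
      lazymatch G with @BOp_AbelianMonoid _ => fail | _ => idtac end;
      change (@plus G a b) with (@plus BOp_AbelianMonoid a b)
  | |- context [@opp ?G ?a] =>
      lazymatch G with @BOp_AbelianGroup _ => fail | _ => idtac end;
      change (@opp G a) with (@opp BOp_AbelianGroup a)
  | |- context [@scal ?K ?G ?c ?a] =>
      lazymatch G with @BOp_ModuleSpace _ => fail | _ => idtac end;
      change (@scal K G c a) with (@scal C_Ring BOp_ModuleSpace c a)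
  end;
  repeat first
    [ rewrite bop_comp_plus_l | rewrite bop_comp_plus_r
    | rewrite bop_comp_opp_l | rewrite bop_comp_opp_r
    | rewrite bop_comp_scal_l | rewrite bop_comp_scal_r
    | rewrite bop_comp_id_l | rewrite bop_comp_id_r ].

Section Inverses.

Context {X : CompleteNormedModule C_AbsRing}.
Implicit Types M N P Q S T Y : BOp X.

Fixpoint bop_pow S (n : nat) : BOp X :=
  match n with O => bop_id | S m => bop_comp S (bop_pow S m) end.

Lemma bop_pow_comm S n : bop_comp S (bop_pow S n) = bop_comp (bop_pow S n) S.
Proof.
induction n as [|n IH]; simpl; [now rewrite bop_comp_id_l, bop_comp_id_r|].
now rewrite <- bop_comp_assoc, <- IH.
Qed.

Lemma opnorm_id : opnorm (bop_id (X := X)) <= 1.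
Proof. apply opnorm_le; [lra|]; intros x; simpl; lra. Qed.

Lemma opnorm_pow S n : opnorm (bop_pow S n) <= opnorm S ^ n.
Proof.
induction n as [|n IH]; simpl; [apply opnorm_id|].
eapply Rle_trans; [apply opnorm_comp|]; apply Rmult_le_compat_l; auto; apply opnorm_ge_0.
Qed.

Lemma is_series_linear {V W : NormedModule C_AbsRing} (L : V -> W) (a : nat -> V) (l : V) :
  is_linear L -> is_series a l -> is_series (fun n => L (a n)) (L l).
Proof.
intros HL H; unfold is_series in *.
eapply (filterlim_ext (fun n => L (sum_n a n))).
{ intros n; induction n as [|n IH]; [now rewrite !sum_O|].
  rewrite !sum_Sn, <- IH; apply (linear_plus _ HL). }
eapply filterlim_comp; [exact H|]; exact (linear_cont L _ HL).
Qed.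

(** The sum [P] of the powers of [S] satisfies [S P = P S = P - I], by shifting the series by one
    term. *)
Lemma neumann S : opnorm S < 1 -> exists P, is_inverse (minus bop_id S) P.
Proof.
intros HS.
assert (E : ex_series (V := BOp_CompleteNormedModule) (bop_pow S)).
{ apply (ex_series_le (V := BOp_CompleteNormedModule) _ (fun n => opnorm S ^ n)).
  - intros n; apply opnorm_pow.
  - apply ex_series_geom; rewrite Rabs_right; auto; apply Rle_ge, opnorm_ge_0. }
destruct E as [P HP]; exists P.
assert (H1 : is_series (V := BOp_CompleteNormedModule) (fun n => bop_pow S (Datatypes.S n))
  (plus P (opp bop_id))).
{ apply (is_series_incr_1 (V := BOp_CompleteNormedModule)).
  match goal with |- is_series _ ?v => replace v with P; [exact HP|] end.
  simpl; vec_op. }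
assert (H2 := is_series_linear _ _ _ (is_linear_comp_l S) HP).
assert (H3 := is_series_linear _ _ _ (is_linear_comp_r S) HP).
assert (E2 : plus P (opp bop_id) = bop_comp S P).
{ exact (filterlim_locally_unique (V := BOp_CompleteNormedModule) _ _ _ H1 H2). }
assert (E3 : plus P (opp bop_id) = bop_comp P S).
{ apply (filterlim_locally_unique (V := BOp_CompleteNormedModule) _ _ _ H1).
  apply (is_series_ext (V := BOp_CompleteNormedModule) _ _ _ (fun n => eq_sym (bop_pow_comm S n)) H3). }
split; bop_expand; [rewrite <- E3|rewrite <- E2]; vec_op.
Qed.

(** Factor [N] as [M (I - P (M - N))] and invert the second factor by a Neumann series. *)
Lemma is_inverse_perturbation M P N : is_inverse M P ->
  opnorm (minus M N) * opnorm P < 1 -> exists Q, is_inverse N Q.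
Proof.
intros [H1 H2] HN.
destruct (neumann (bop_comp P (minus M N))) as [Q [Q1 Q2]].
{ eapply Rle_lt_trans; [apply opnorm_comp|]; now rewrite Rmult_comm. }
assert (E : N = bop_comp M (minus bop_id (bop_comp P (minus M N)))).
{ bop_expand; rewrite !bop_comp_assoc, H2; bop_expand; vec_op. }
exists (bop_comp Q P); rewrite E; split.
- rewrite <- (bop_comp_assoc Q P), (bop_comp_assoc P M), H1, bop_comp_id_l; exact Q1.
- rewrite <- (bop_comp_assoc M), (bop_comp_assoc _ Q P), Q2, bop_comp_id_l; exact H2.
Qed.

Lemma continuous_inverse (M P : C -> BOp X) (z : C) d : 0 < d ->
  (forall w, Cmod (w - z) < d -> is_inverse (M w) (P w)) ->
  continuous (T := C_UniformSpace) M z -> continuous (T := C_UniformSpace) P z.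
Proof.
intros d0 HP HM; apply (continuous_C_norm (V := BOp_CompleteNormedModule)); intros eps He.
set (p := opnorm (P z)).
assert (p0 : 0 <= p) by apply opnorm_ge_0.
assert (Pp : 0 < 2 * p * p + p + 1) by nra.
(* All rests on [P(w) - P(z) = - P(w) (M(w) - M(z)) P(z)]. The first bound gives [m p <= 1/2], hence
   [|P(w)| <= 2 p]; the second then makes [2 p^2 m] smaller than [eps]. *)
set (e := Rmin (1 / (2 * (p + 1))) (eps / (2 * p * p + p + 1))).
assert (e0 : 0 < e) by (apply Rmin_pos; apply Rdiv_lt_0_compat; lra).
destruct (proj1 (continuous_C_norm (V := BOp_CompleteNormedModule) M z) HM e e0) as [d' [d0' Hd']].
exists (Rmin d d'); split; [now apply Rmin_pos|]; intros w Hw.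
assert (Iz : is_inverse (M z) (P z)) by (apply HP; rewrite Cmod_self; exact d0).
assert (Iw : is_inverse (M w) (P w)) by (apply HP; eapply Rlt_le_trans; [exact Hw|apply Rmin_l]).
assert (Dw : opnorm (minus (M w) (M z)) < e) by (apply Hd'; eapply Rlt_le_trans; [exact Hw|apply Rmin_r]).
assert (E : minus (P w) (P z) = opp (bop_comp (P w) (bop_comp (minus (M w) (M z)) (P z)))).
{ bop_expand; rewrite (bop_comp_assoc (P w) (M w)), (proj1 Iw), (proj2 Iz), bop_comp_id_l, bop_comp_id_r.
  vec_op. }
set (q := opnorm (P w)); set (m := opnorm (minus (M w) (M z))) in *.
assert (q0 : 0 <= q) by apply opnorm_ge_0.
assert (m0 : 0 <= m) by apply opnorm_ge_0.
assert (D : opnorm (minus (P w) (P z)) <= q * (m * p)).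
{ rewrite E, opnorm_opp; eapply Rle_trans; [apply opnorm_comp|].
  apply Rmult_le_compat_l; auto; apply opnorm_comp. }
assert (mp : m * p <= 1 / 2).
{ apply Rle_trans with (1 / (2 * (p + 1)) * (p + 1)); [|right; field; lra].
  apply Rmult_le_compat; auto; [|lra].
  apply Rlt_le; eapply Rlt_le_trans; [exact Dw|apply Rmin_l]. }
assert (Q2 : q <= 2 * p).
{ assert (T : q <= opnorm (minus (P w) (P z)) + p).
  { unfold q, p; replace (P w) with (plus (minus (P w) (P z)) (P z)) at 1
      by vec_op.
    apply opnorm_triangle. }
  assert (q * (m * p) <= q * (1 / 2)) by (apply Rmult_le_compat_l; auto).
  lra. }
change (opnorm (minus (P w) (P z)) < eps).
eapply Rle_lt_trans; [exact D|].
apply Rle_lt_trans with (m * (2 * p * p)).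
{ replace (m * (2 * p * p)) with (2 * p * (m * p)) by ring.
  apply Rmult_le_compat_r; [now apply Rmult_le_pos|exact Q2]. }
apply Rle_lt_trans with (e * (2 * p * p)); [apply Rmult_le_compat_r; nra|].
apply Rle_lt_trans with (eps / (2 * p * p + p + 1) * (2 * p * p)).
{ apply Rmult_le_compat_r; [nra|apply Rmin_r]. }
apply Rlt_le_trans with (eps / (2 * p * p + p + 1) * (2 * p * p + p + 1)); [|right; field; lra].
apply Rmult_lt_compat_l; [now apply Rdiv_lt_0_compat|lra].
Qed.

End Inverses.

Section Resolvent.

Context {X : CompleteNormedModule C_AbsRing}.
Variable T : BOp X.

Lemma resolvent_inverse z : ~ spectrum T z ->
  is_inverse (minus (scal z bop_id) T) (resolvent T z).
Proof.
intros Hz; apply NNPP in Hz.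
exact (epsilon_spec (inhabits bop_zero) (is_inverse (minus (scal z bop_id) T)) Hz).
Qed.

Lemma opnorm_shift (z w : C) :
  opnorm (minus (minus (scal z bop_id) T) (minus (scal w bop_id) T)) <= Cmod (z - w).
Proof.
replace (minus _ _) with (scal (z - w)%C (bop_id (X := X))) by vec_op.
eapply Rle_trans; [apply opnorm_scal|].
rewrite <- (Rmult_1_r (Cmod (z - w))) at 2.
apply Rmult_le_compat_l; [apply Cmod_ge_0|apply opnorm_id].
Qed.

Lemma spectrum_bound z : spectrum T z -> Cmod z <= opnorm T.
Proof.
intros Hz; apply Rnot_lt_le; intros N; apply Hz.
pose proof (opnorm_ge_0 T).
assert (z0 : z <> RtoC 0) by (apply Cmod_gt_0; lra).
apply (is_inverse_perturbation (scal z bop_id) (scal (/ z)%C bop_id)).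
- split; bop_expand; apply bop_ext; intros x; simpl; vec X; field; auto.
- replace (minus _ _) with T by vec_op.
  apply Rle_lt_trans with (opnorm T * / Cmod z).
  + apply Rmult_le_compat_l; auto.
    eapply Rle_trans; [apply opnorm_scal|]; rewrite Cmod_inv by auto.
    rewrite <- (Rmult_1_r (/ Cmod z)) at 2; apply Rmult_le_compat_l; [|apply opnorm_id].
    apply Rlt_le, Rinv_0_lt_compat; lra.
  + apply Rmult_lt_reg_r with (Cmod z); [lra|].
    rewrite Rmult_assoc, Rinv_l; lra.
Qed.

Lemma compact_spectrum : compact_set (spectrum T).
Proof.
split.
- exists (opnorm T); intros w Hw; apply spectrum_bound in Hw.
  pose proof (Rabs_fst_le w); pose proof (Rabs_snd_le w); lra.
- intros w Hw; apply resolvent_inverse in Hw.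
  set (r := opnorm (resolvent T w)).
  assert (r0 : 0 <= r) by apply opnorm_ge_0.
  exists (/ (r + 1)); split; [apply Rinv_0_lt_compat; lra|]; intros v Hv N; apply N.
  apply (is_inverse_perturbation _ _ _ Hw); fold r.
  apply Rle_lt_trans with (/ (r + 1) * r).
  + apply Rmult_le_compat_r; auto.
    eapply Rle_trans; [apply opnorm_shift|]; rewrite Cmod_minus_sym; lra.
  + apply Rmult_lt_reg_l with (r + 1); [lra|].
    rewrite <- Rmult_assoc, Rinv_r; lra.
Qed.

Lemma resolvent_identity z w : ~ spectrum T z -> ~ spectrum T w ->
  minus (resolvent T z) (resolvent T w) =
  scal (w - z)%C (bop_comp (resolvent T z) (resolvent T w)).
Proof.
intros Hz Hw; apply resolvent_inverse in Hz, Hw.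
destruct Hz as [Hz _], Hw as [_ Hw].
set (P := resolvent T z) in *; set (Q := resolvent T w) in *.
transitivity (minus (bop_comp P (bop_comp (minus (scal w bop_id) T) Q))
  (bop_comp (bop_comp P (minus (scal z bop_id) T)) Q)).
- rewrite Hz, Hw, bop_comp_id_l, bop_comp_id_r; easy.
- bop_expand; rewrite <- !bop_comp_assoc; vec_op.
Qed.

Lemma continuous_resolvent z : ~ spectrum T z ->
  continuous (T := C_UniformSpace) (resolvent T) z.
Proof.
intros Hz; destruct (proj2 compact_spectrum z Hz) as [d [d0 Hd]].
apply (continuous_inverse (fun z => minus (scal z bop_id) T) _ z d d0).
- intros w Hw; now apply resolvent_inverse, Hd.
- apply (continuous_C_norm (V := BOp_CompleteNormedModule)); intros eps He.
  exists eps; split; auto; intros w Hw; eapply Rle_lt_trans; [apply opnorm_shift|exact Hw].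
Qed.

(** By the resolvent identity the error of the approximation with derivative [- R(z)^2] is
    [(z - w) (R(w) - R(z)) R(z)], so continuity of the resolvent suffices. *)
Lemma differentiable_resolvent :
  differentiable_on (V := BOp_CompleteNormedModule) (fun z => ~ spectrum T z) (resolvent T).
Proof.
intros z Hz; exists (opp (bop_comp (resolvent T z) (resolvent T z))).
apply (is_derive_norm (V := BOp_CompleteNormedModule)); intros eps He.
set (r := opnorm (resolvent T z)).
assert (r0 : 0 <= r) by apply opnorm_ge_0.
destruct (proj2 compact_spectrum z Hz) as [d [d0 Hd]].
assert (e0 : 0 < eps / (r + 1)) by (apply Rdiv_lt_0_compat; lra).
destruct (proj1 (continuous_C_norm (V := BOp_CompleteNormedModule) _ z)
  (continuous_resolvent z Hz) _ e0) as [e [e0' HE]].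
exists (Rmin d e); split; [now apply Rmin_pos|]; intros w Hw.
assert (Nw : ~ spectrum T w) by (apply Hd; eapply Rlt_le_trans; [exact Hw|apply Rmin_l]).
assert (Ew : opnorm (minus (resolvent T w) (resolvent T z)) < eps / (r + 1))
  by (apply HE; eapply Rlt_le_trans; [exact Hw|apply Rmin_r]).
pose proof (resolvent_identity w z Nw Hz) as I.
match goal with |- norm ?x <= _ => replace x with
  (scal (z - w)%C (bop_comp (minus (resolvent T w) (resolvent T z)) (resolvent T z))) end.
2: { transitivity (minus (scal (z - w)%C (bop_comp (resolvent T w) (resolvent T z)))
       (scal (w - z)%C (opp (bop_comp (resolvent T z) (resolvent T z))))).
     - bop_expand; vec_op.
     - rewrite <- I; easy. }
eapply Rle_trans; [apply opnorm_scal|].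
rewrite (Rmult_comm eps), Cmod_minus_sym; apply Rmult_le_compat_l; [apply Cmod_ge_0|].
eapply Rle_trans; [apply opnorm_comp|]; fold r.
apply Rle_trans with (eps / (r + 1) * (r + 1)); [|right; field; lra].
apply Rmult_le_compat; auto; [apply opnorm_ge_0|lra|lra].
Qed.

End Resolvent.

(** * Generalized derivations and contour integrals *)

Section Derivations.

Context {X : CompleteNormedModule C_AbsRing}.
Implicit Types A B M N Y : BOp X.
Local Notation BX := (@BOp_CompleteNormedModule X).

Lemma continuous_bop_comp (F1 F2 : C -> BOp X) (z : C) :
  continuous (T := C_UniformSpace) F1 z -> continuous (T := C_UniformSpace) F2 z ->
  continuous (T := C_UniformSpace) (fun w => bop_comp (F1 w) (F2 w)) z.
Proof.
intros H1 H2; apply (continuous_C_norm (V := BX)); intros eps He.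
set (a := opnorm (F1 z)); set (b := opnorm (F2 z)).
assert (a0 : 0 <= a) by apply opnorm_ge_0; assert (b0 : 0 <= b) by apply opnorm_ge_0.
(* The increment of the product is [P Q + P F2(z) + F1(z) Q]. Since [e <= 1], the quadratic term is
   at most [e], and the sum at most [e (1 + a + b)]. *)
set (e := Rmin 1 (eps / (2 * (1 + a + b)))).
assert (e0 : 0 < e) by (apply Rmin_pos; [lra|apply Rdiv_lt_0_compat; lra]).
destruct (proj1 (continuous_C_norm (V := BX) F1 z) H1 e e0) as [d1 [p1 D1]].
destruct (proj1 (continuous_C_norm (V := BX) F2 z) H2 e e0) as [d2 [p2 D2]].
exists (Rmin d1 d2); split; [now apply Rmin_pos|]; intros w Hw.
assert (E1 : opnorm (minus (F1 w) (F1 z)) < e)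
  by (apply D1; eapply Rlt_le_trans; [exact Hw|apply Rmin_l]).
assert (E2 : opnorm (minus (F2 w) (F2 z)) < e)
  by (apply D2; eapply Rlt_le_trans; [exact Hw|apply Rmin_r]).
set (P := minus (F1 w) (F1 z)) in *; set (Q := minus (F2 w) (F2 z)) in *.
change (opnorm (minus (bop_comp (F1 w) (F2 w)) (bop_comp (F1 z) (F2 z))) < eps).
replace (minus (bop_comp (F1 w) (F2 w)) (bop_comp (F1 z) (F2 z))) with
  (plus (bop_comp P Q) (plus (bop_comp P (F2 z)) (bop_comp (F1 z) Q))).
2: { unfold P, Q; bop_expand; vec_op. }
eapply Rle_lt_trans; [apply opnorm_triangle|].
eapply Rle_lt_trans; [apply Rplus_le_compat; [apply opnorm_comp|apply opnorm_triangle]|].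
eapply Rle_lt_trans; [apply Rplus_le_compat; [apply Rle_refl|apply Rplus_le_compat; apply opnorm_comp]|].
fold a b.
pose proof (opnorm_ge_0 P) as P0; pose proof (opnorm_ge_0 Q) as Q0.
assert (e1 : e <= 1) by apply Rmin_l.
assert (e2 : e * (1 + a + b) <= eps / 2).
{ apply Rle_trans with (eps / (2 * (1 + a + b)) * (1 + a + b)); [|right; field; lra].
  apply Rmult_le_compat_r; [lra|apply Rmin_r]. }
assert (opnorm P * opnorm Q <= e * 1) by (apply Rmult_le_compat; lra).
assert (opnorm P * b <= e * b) by (apply Rmult_le_compat_r; lra).
assert (a * opnorm Q <= a * e) by (apply Rmult_le_compat_l; lra).
lra.
Qed.

Lemma is_linear_gderiv M N : is_linear (U := BX) (V := BX) (gderiv M N).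
Proof.
split.
- intros S T; unfold gderiv; change (@plus _ S T) with (@plus BOp_AbelianMonoid S T).
  bop_expand; vec_op.
- intros c S; unfold gderiv; bop_expand; vec_op.
- exists (opnorm M + opnorm N + 1).
  pose proof (opnorm_ge_0 M); pose proof (opnorm_ge_0 N); split; [lra|]; intros S.
  change (opnorm (gderiv M N S) <= (opnorm M + opnorm N + 1) * opnorm S).
  unfold gderiv, minus; eapply Rle_trans; [apply opnorm_triangle|]; rewrite opnorm_opp.
  pose proof (opnorm_comp M S); pose proof (opnorm_comp S N); pose proof (opnorm_ge_0 S).
  nra.
Qed.

Lemma inverse_comp_l M P a : is_inverse (minus (scal a bop_id) M) P ->
  bop_comp M P = minus (scal a P) bop_id.
Proof.
intros [_ H]; rewrite <- H; bop_expand; vec_op.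
Qed.

Lemma inverse_comp_r M P a : is_inverse (minus (scal a bop_id) M) P ->
  bop_comp P M = minus (scal a P) bop_id.
Proof.
intros [H _]; rewrite <- H; bop_expand; vec_op.
Qed.

(* Both equalities say [P Y - Y Q = P (M Y - Y N) Q], the first one using that [P]
   commutes with [M] and [Q] with [N]. *)
Lemma gderiv_inverse M N P Q Y a :
  is_inverse (minus (scal a bop_id) M) P -> is_inverse (minus (scal a bop_id) N) Q ->
  gderiv M N (bop_comp P (bop_comp Y Q)) = gderiv P Q Y /\
  bop_comp P (bop_comp (gderiv M N Y) Q) = gderiv P Q Y.
Proof.
intros HP HQ; unfold gderiv; split.
- rewrite bop_comp_assoc, (inverse_comp_l M P a HP), <- !(bop_comp_assoc _ _ N),
    (inverse_comp_r N Q a HQ).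
  bop_expand; rewrite ?bop_comp_assoc; vec_op.
- bop_expand; rewrite <- (bop_comp_assoc Y N Q), (inverse_comp_l N Q a HQ).
  rewrite <- (bop_comp_assoc M Y Q), (bop_comp_assoc P M), (inverse_comp_r M P a HP).
  bop_expand; rewrite ?bop_comp_assoc; vec_op.
Qed.

Section ContourFormula.

Variables (G : list (C * C)) (c : C) (phi alpha : C -> C) (A B M N : BOp X) (P Q : C -> BOp X).
Hypotheses
  (HP : forall z, on_contour G z -> is_inverse (minus (scal (alpha z) bop_id) M) (P z))
  (HQ : forall z, on_contour G z -> is_inverse (minus (scal (alpha z) bop_id) N) (Q z))
  (Cphi : cont_on (V := C_CompleteNormedModule) (on_contour G) phi)
  (CP : cont_on (V := BX) (on_contour G) P)
  (CQ : cont_on (V := BX) (on_contour G) Q)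
  (HA : A = scal c (contour_integral (V := BX) (fun z => scal (phi z) (P z)) G))
  (HB : B = scal c (contour_integral (V := BX) (fun z => scal (phi z) (Q z)) G)).

(** Composition with [Y] on either side is bounded and linear, so it goes under the integral. The
    derivation becomes a superposition of the derivations of [P(z)] and [Q(z)], to which
    [gderiv_inverse] applies pointwise. *)
Lemma gderiv_contour Y :
  gderiv A B Y = scal c (contour_integral (V := BX)
    (fun z => scal (phi z) (gderiv (P z) (Q z) Y)) G).
Proof.
assert (CPhi : forall F : C -> BOp X, cont_on (V := BX) (on_contour G) F ->
  cont_on (V := BX) (on_contour G) (fun z => scal (phi z) (F z))).
{ intros F HF z Hz; apply (continuous_scal_C (V := BX)); [now apply Cphi|now apply HF]. }
assert (EA : bop_comp A Y =
  scal c (contour_integral (V := BX) (fun z => scal (phi z) (bop_comp (P z) Y)) G)).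
{ rewrite HA; etransitivity; [apply bop_comp_scal_l|]; f_equal.
  etransitivity;
    [symmetry; exact (contour_integral_linear (V := BX) (W := BX) _ _ G (is_linear_comp_r Y) (CPhi P CP))|].
  apply (contour_integral_ext (V := BX)); intros z _; apply bop_comp_scal_l. }
assert (EB : bop_comp Y B =
  scal c (contour_integral (V := BX) (fun z => scal (phi z) (bop_comp Y (Q z))) G)).
{ rewrite HB; etransitivity; [apply bop_comp_scal_r|]; f_equal.
  etransitivity;
    [symmetry; exact (contour_integral_linear (V := BX) (W := BX) _ _ G (is_linear_comp_l Y) (CPhi Q CQ))|].
  apply (contour_integral_ext (V := BX)); intros z _; apply bop_comp_scal_r. }
unfold gderiv at 1; rewrite EA, EB.
transitivity (scal c (plus
  (contour_integral (V := BX) (fun z => scal (phi z) (bop_comp (P z) Y)) G)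
  (scal (- RtoC 1)%C (contour_integral (V := BX) (fun z => scal (phi z) (bop_comp Y (Q z))) G)))).
{ vec_op. }
assert (C1 : cont_on (V := BX) (on_contour G) (fun z => scal (phi z) (bop_comp (P z) Y))).
{ apply CPhi; intros z Hz; apply continuous_bop_comp; [now apply CP|apply continuous_const]. }
assert (C2 : cont_on (V := BX) (on_contour G) (fun z => scal (phi z) (bop_comp Y (Q z)))).
{ apply CPhi; intros z Hz; apply continuous_bop_comp; [apply continuous_const|now apply CQ]. }
f_equal; rewrite <- (contour_integral_scal (V := BX)) by exact C2.
rewrite <- (contour_integral_plus (V := BX)).
- apply (contour_integral_ext (V := BX)); intros z _; unfold gderiv.
  vec_op.
- now apply cont_on_integrable.
- apply cont_on_integrable; intros z Hz; apply (continuous_scal_r (V := BX)), C2, Hz.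
Qed.

(** The preimage is explicit: up to the factor [c] it is the integral of [phi(z) P(z) Z Q(z)], and
    the bounded map [gderiv M N] may be applied under the integral. *)
Lemma range_gderiv_contour Y : range (gderiv A B) Y -> range (gderiv M N) Y.
Proof.
intros [Z <-].
set (W := contour_integral (V := BX) (fun z => scal (phi z) (bop_comp (P z) (bop_comp Z (Q z)))) G).
exists (scal c W); rewrite gderiv_contour.
etransitivity; [exact (linear_scal _ (is_linear_gderiv M N) c W)|]; f_equal.
unfold W; rewrite <- (contour_integral_linear (V := BX) (W := BX) _ _ G (is_linear_gderiv M N)).
- apply (contour_integral_ext (V := BX)); intros z Hz.
  etransitivity; [exact (linear_scal _ (is_linear_gderiv M N) _ _)|]; f_equal.
  exact (proj1 (gderiv_inverse M N _ _ Z _ (HP z Hz) (HQ z Hz))).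
- intros z Hz; apply (continuous_scal_C (V := BX)); [now apply Cphi|].
  apply continuous_bop_comp; [now apply CP|].
  apply continuous_bop_comp; [apply continuous_const|now apply CQ].
Qed.

Lemma null_space_gderiv_contour Y :
  null_space (gderiv M N) Y -> null_space (gderiv A B) Y.
Proof.
unfold null_space; intros H; rewrite gderiv_contour.
transitivity (scal c (contour_integral (V := BX) (fun _ => zero) G)).
- apply (f_equal (fun v : BOp X => scal c v)), (contour_integral_ext (V := BX)); intros z Hz.
  rewrite <- (proj2 (gderiv_inverse M N _ _ Y _ (HP z Hz) (HQ z Hz))), H.
  apply bop_ext; intros x; simpl.
  rewrite (linear_zero _ (bop_linear (P z))); exact (scal_zero_r (V := X) _).
- rewrite (contour_integral_zero (V := BX)); exact (scal_zero_r (V := BX) _).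
Qed.

End ContourFormula.

End Derivations.

(** * The holomorphic functional calculus *)

Section Calculus.

Context {X : CompleteNormedModule C_AbsRing}.
Local Notation BX := (@BOp_CompleteNormedModule X).
Variable T : BOp X.

Definition calculus (G : list (C * C)) (phi : C -> C) : BOp X :=
  scal (/ (2 * PI * Ci))%C
    (contour_integral (V := BX) (fun z => scal (phi z) (resolvent T z)) G).

Lemma calculus_ext G phi psi : (forall z, on_contour G z -> phi z = psi z) ->
  calculus G phi = calculus G psi.
Proof.
intros H; apply (f_equal (fun v : BOp X => scal (/ (2 * PI * Ci))%C v)).
apply (contour_integral_ext (V := BX)); intros z Hz; now rewrite H.
Qed.

Lemma differentiable_scal {V : CompleteNormedModule C_AbsRing} (D : C -> Prop) (k : C -> C)
    (F : C -> V) :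
  differentiable_on (V := C_CompleteNormedModule) D k -> differentiable_on D F ->
  differentiable_on D (fun z => scal (k z) (F z)).
Proof.
intros Hk HF z Hz; destruct (Hk z Hz) as [dk Dk]; destruct (HF z Hz) as [dF DF].
eexists; exact (is_derive_scal_C (V := V) _ _ z _ _ Dk DF).
Qed.

Lemma differentiable_calculus (U : C -> Prop) phi :
  differentiable_on (V := C_CompleteNormedModule) U phi ->
  differentiable_on (V := BX) (fun z => U z /\ ~ spectrum T z)
    (fun z => scal (phi z) (resolvent T z)).
Proof.
intros Hphi; apply (differentiable_scal (V := BX)).
- intros z [Hz _]; now apply Hphi.
- intros z [_ Hz]; now apply differentiable_resolvent.
Qed.

Lemma calculus_contour (U : C -> Prop) G G' phi : open U ->
  differentiable_on (V := C_CompleteNormedModule) U phi ->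
  surrounds (spectrum T) U G -> surrounds (spectrum T) U G' ->
  calculus G phi = calculus G' phi.
Proof.
intros HU Hphi HG HG'; unfold calculus; f_equal.
apply (surrounds_contour_integral_eq (V := BX) (spectrum T) U); auto.
- apply compact_spectrum.
- now apply differentiable_calculus.
Qed.

(** [riesz] takes its contour from [epsilon]. The given [G] witnesses that a surrounding contour
    exists, so the chosen one surrounds the spectrum too, and the two integrals agree. *)
Lemma riesz_calculus (U : C -> Prop) G phi : open U ->
  differentiable_on (V := C_CompleteNormedModule) U phi ->
  surrounds (spectrum T) U G -> riesz U phi T = calculus G phi.
Proof.
intros HU Hphi HG.
assert (HE : surrounds (spectrum T) U (epsilon (inhabits nil) (surrounds (spectrum T) U)))
  by (apply epsilon_spec; now exists G).
exact (calculus_contour U _ G phi HU Hphi HE HG).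
Qed.

Lemma cont_on_resolvent (D : C -> Prop) : (forall z, D z -> ~ spectrum T z) ->
  cont_on (V := BX) D (resolvent T).
Proof. intros HD z Hz; apply continuous_resolvent, HD, Hz. Qed.

(** Take norms in [z R(z) = I + T R(z)] and solve for the norm of [R(z)]. *)
Lemma opnorm_resolvent_le z : opnorm T < Cmod z ->
  ~ spectrum T z /\ opnorm (resolvent T z) <= / (Cmod z - opnorm T).
Proof.
intros Hz.
assert (N : ~ spectrum T z) by (intros H; apply spectrum_bound in H; lra).
split; auto; pose proof (opnorm_ge_0 T) as T0.
assert (z0 : z <> RtoC 0) by (apply Cmod_gt_0; lra).
pose proof (inverse_comp_l T _ z (resolvent_inverse T z N)) as E.
set (P := resolvent T z) in *; pose proof (opnorm_ge_0 P) as P0.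
assert (E2 : P = scal (/ z)%C (plus bop_id (bop_comp T P))).
{ rewrite E; vec_op; now field. }
assert (H : Cmod z * opnorm P <= 1 + opnorm T * opnorm P).
{ apply Rle_trans with (Cmod z * (/ Cmod z * (1 + opnorm T * opnorm P))).
  - apply Rmult_le_compat_l; [lra|]; rewrite E2 at 1.
    eapply Rle_trans; [apply opnorm_scal|]; rewrite Cmod_inv by auto.
    apply Rmult_le_compat_l; [apply Rlt_le, Rinv_0_lt_compat; lra|].
    eapply Rle_trans; [apply opnorm_triangle|].
    apply Rplus_le_compat; [apply opnorm_id|apply opnorm_comp].
  - right; field; lra. }
apply Rmult_le_reg_l with (Cmod z - opnorm T); [lra|].
rewrite Rinv_r by lra; lra.
Qed.

Lemma Cmod_on_square n z : 0 <= n ->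
  on_contour (rectangle (- n, - n) (n, n)) z -> n <= Cmod z.
Proof.
intros Hn Hz; apply on_rectangle_side in Hz; simpl; try lra.
destruct Hz as [_ Hz]; simpl in Hz.
pose proof (Rabs_fst_le z); pose proof (Rabs_snd_le z).
unfold Rabs in *; repeat destruct Rcase_abs; lra.
Qed.

Lemma surrounds_square n : opnorm T < n ->
  surrounds (spectrum T) (fun _ => True) (rectangle (- n, - n) (n, n)).
Proof.
intros Hn; pose proof (opnorm_ge_0 T).
split; [apply is_contour_rectangle|split; [|split]].
- intros s t Hs Ht; split; auto; intros HT; apply spectrum_bound in HT.
  assert (Hc : on_contour (rectangle (- n, - n) (n, n)) (segment_point s t))
    by (exists s; split; auto; now exists t).
  apply Cmod_on_square in Hc; lra.
- intros w Hw; apply spectrum_bound in Hw; apply winding_number_integral.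
  pose proof (Rabs_fst_le w); pose proof (Rabs_snd_le w).
  unfold winding_integral; rewrite contour_integral_inv_rectangle.
  + ring.
  + simpl; unfold Rabs in *; repeat destruct Rcase_abs; lra.
  + simpl; unfold Rabs in *; repeat destruct Rcase_abs; lra.
- intros w Hw; now destruct Hw.
Qed.

Lemma open_all : open (fun _ : C => True).
Proof. intros z _; apply locally_Cmod; exists 1; split; [lra|easy]. Qed.

(* On the square of half side [n] the resolvent is [I / z + O(1 / n ^ 2)]. *)
Lemma calculus_one G U : surrounds (spectrum T) U G -> calculus G (fun _ => RtoC 1) = bop_id.
Proof.
intros HG.
assert (HG' : surrounds (spectrum T) (fun _ => True) G)
  by (apply (surrounds_mono _ _ _ _ _ HG); auto).
set (c := (/ (2 * PI * Ci))%C).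
pose proof (opnorm_ge_0 T) as T0.
assert (B : forall n, opnorm T < n ->
  opnorm (minus (calculus G (fun _ => RtoC 1)) bop_id) <=
  Cmod c * (8 * (opnorm T * / (n - opnorm T)))).
{ intros n Hn; set (R := rectangle (- n, - n) (n, n)).
  assert (HR := surrounds_square n Hn).
  assert (OR : forall z, on_contour R z -> n <= Cmod z).
  { intros z; apply Cmod_on_square; lra. }
  assert (Z0 : forall z, on_contour R z -> z <> RtoC 0).
  { intros z Hz; apply Cmod_gt_0; specialize (OR z Hz); lra. }
  assert (NS : forall z, on_contour R z -> ~ spectrum T z).
  { intros z Hz; apply opnorm_resolvent_le; specialize (OR z Hz); lra. }
  assert (CR := cont_on_resolvent (on_contour R) NS).
  assert (CI : cont_on (V := C_CompleteNormedModule) (on_contour R) Cinv).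
  { intros z Hz; apply (continuous_inv_C (fun z => z)); [apply continuous_id|now apply Z0]. }
  assert (E1 : calculus G (fun _ => RtoC 1) = calculus R (fun _ => RtoC 1)).
  { apply (calculus_contour (fun _ => True)); auto; [apply open_all|].
    intros z _; eexists; apply is_derive_const_C. }
  (* The difference between [R(z)] and [I / z], from [z R(z) = I + T R(z)]. The term [I / z]
     contributes [2 i pi I]. *)
  set (e := fun z => scal (/ z)%C (bop_comp T (resolvent T z))).
  assert (Ce : cont_on (V := BX) (on_contour R) e).
  { intros z Hz; apply (continuous_scal_C (V := BX)); [now apply CI|].
    apply continuous_bop_comp; [apply continuous_const|now apply CR]. }
  assert (E2 : contour_integral (V := BX) (fun z => scal (RtoC 1) (resolvent T z)) R =
    plus (scal (2 * PI * Ci)%C bop_id) (contour_integral (V := BX) e R)).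
  { transitivity (contour_integral (V := BX) (fun z => plus (scal (/ z)%C bop_id) (e z)) R).
    { apply (contour_integral_ext (V := BX)); intros z Hz; unfold e.
      rewrite (inverse_comp_l T _ z (resolvent_inverse T z (NS z Hz))).
      vec_op; field; now apply Z0. }
    rewrite (contour_integral_plus (V := BX)).
    - f_equal; rewrite (contour_integral_scal_l (V := BX) Cinv) by exact CI; f_equal.
      rewrite <- (contour_integral_inv_rectangle (- n, - n) (n, n) (RtoC 0)).
      + apply (contour_integral_ext (V := C_CompleteNormedModule)); intros z _.
        f_equal; ring.
      + simpl; lra.
      + simpl; lra.
    - apply cont_on_integrable; intros z Hz; apply (continuous_scal_C (V := BX));
        [now apply CI|apply continuous_const].
    - now apply cont_on_integrable. }
  assert (E3 : minus (calculus G (fun _ => RtoC 1)) bop_id =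
    scal c (contour_integral (V := BX) e R)).
  { rewrite E1; unfold calculus; rewrite E2; fold c; vec_op.
    assert (Hc : (c * (2 * PI * Ci) = 1)%C) by (apply Cinv_l, two_pi_i_neq_0).
    transitivity (c * (2 * PI * Ci) - 1)%C; [ring|rewrite Hc; ring]. }
  rewrite E3.
  eapply Rle_trans; [apply opnorm_scal|]; apply Rmult_le_compat_l; [apply Cmod_ge_0|].
  assert (L : contour_length R = 8 * n).
  { assert (C4 : forall x y, (y - x = RtoC (2 * n) \/ y - x = RtoC (- (2 * n)) \/
      y - x = Ci * RtoC (2 * n) \/ y - x = Ci * RtoC (- (2 * n)))%C -> Cmod (y - x) = 2 * n).
    { intros x y [-> | [-> | [-> | ->]]]; rewrite ?Cmod_mult, ?Cmod_Ci, Cmod_R;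
        unfold Rabs; destruct Rcase_abs; lra. }
    unfold R, rectangle, corner; simpl contour_length.
    rewrite !C4; [ring|..].
    - right; right; right; unfold Cminus, Cplus, Copp, Cmult, RtoC, Ci; simpl; f_equal; ring.
    - right; left; unfold Cminus, Cplus, Copp, Cmult, RtoC, Ci; simpl; f_equal; ring.
    - right; right; left; unfold Cminus, Cplus, Copp, Cmult, RtoC, Ci; simpl; f_equal; ring.
    - left; unfold Cminus, Cplus, Copp, Cmult, RtoC, Ci; simpl; f_equal; ring. }
  eapply Rle_trans.
  { apply (norm_contour_integral_le (V := BX) e R (/ n * (opnorm T * / (n - opnorm T))) Ce).
    intros z Hz; specialize (OR z Hz).
    destruct (opnorm_resolvent_le z) as [_ Rz]; [lra|].
    eapply Rle_trans; [apply (norm_scal_C (V := BX))|].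
    rewrite Cmod_inv by now apply Z0.
    apply Rmult_le_compat; [apply Rlt_le, Rinv_0_lt_compat; lra|apply (norm_ge_0 (V := BX))| |].
    - apply Rinv_le_contravar; lra.
    - eapply Rle_trans; [apply opnorm_comp|]; apply Rmult_le_compat_l; auto.
      eapply Rle_trans; [exact Rz|]; apply Rinv_le_contravar; lra. }
  rewrite L; right; field; lra. }
assert (Z : opnorm (minus (calculus G (fun _ => RtoC 1)) bop_id) = 0).
{ apply Rle_antisym; [|apply opnorm_ge_0].
  apply le_epsilon; intros eps He; rewrite Rplus_0_l.
  set (k := Cmod c * 8 * opnorm T).
  assert (k0 : 0 <= k) by (repeat apply Rmult_le_pos; try lra; apply Cmod_ge_0).
  assert (q0 : 0 < k / eps + 1).
  { assert (0 <= k / eps) by (apply Rmult_le_pos; [|apply Rlt_le, Rinv_0_lt_compat]; lra); lra. }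
  (* The half side is chosen so that the bound becomes [k / (k / eps + 1)], which is at most [eps],
     also when [k = 0]. *)
  eapply Rle_trans; [apply (B (opnorm T + (k / eps + 1))); lra|].
  replace (opnorm T + (k / eps + 1) - opnorm T) with (k / eps + 1) by ring.
  replace (Cmod c * (8 * (opnorm T * / (k / eps + 1)))) with (k * / (k / eps + 1))
    by (unfold k; ring).
  apply Rmult_le_reg_r with (k / eps + 1); auto.
  rewrite Rmult_assoc, Rinv_l by lra.
  replace (eps * (k / eps + 1)) with (k + eps) by (field; lra); lra. }
apply opnorm_eq_0 in Z.
transitivity (plus (minus (calculus G (fun _ => RtoC 1)) bop_id) bop_id); [vec_op|].
rewrite Z; vec_op.
Qed.

(** Since [z R(z) = T R(z) + I] and the constant [I] integrates to zero over a cycle, the claim is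
    [T] composed with [calculus_one]. *)
Lemma calculus_id G U : surrounds (spectrum T) U G -> calculus G (fun z => z) = T.
Proof.
intros HG.
assert (NS : forall z, on_contour G z -> ~ spectrum T z)
  by (intros z Hz; now apply (surrounds_on_contour _ _ _ HG)).
assert (CR := cont_on_resolvent (on_contour G) NS).
assert (C1 : cont_on (V := BX) (on_contour G) (fun z => scal (RtoC 1) (resolvent T z))).
{ intros z Hz; apply (continuous_scal_r (V := BX)), CR, Hz. }
pose proof (calculus_one G U HG) as E1; unfold calculus in E1 |- *.
transitivity (bop_comp T (scal (/ (2 * PI * Ci))%C
  (contour_integral (V := BX) (fun z => scal (RtoC 1) (resolvent T z)) G)));
  [|rewrite E1; apply bop_comp_id_r].
etransitivity; [|symmetry; apply bop_comp_scal_r]; f_equal.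
etransitivity; [|exact (contour_integral_linear (V := BX) (W := BX) _ _ G (is_linear_comp_l T) C1)].
transitivity (contour_integral (V := BX) (fun z => plus (bop_comp T (scal (RtoC 1) (resolvent T z)))
  bop_id) G).
{ apply (contour_integral_ext (V := BX)); intros z Hz.
  transitivity (plus (scal (RtoC 1) (bop_comp T (resolvent T z))) bop_id).
  - rewrite (inverse_comp_l T _ z (resolvent_inverse T z (NS z Hz))); vec_op.
  - f_equal; symmetry; apply bop_comp_scal_r. }
rewrite (contour_integral_plus (V := BX)).
- transitivity (plus (contour_integral (V := BX)
    (fun z => bop_comp T (scal (RtoC 1) (resolvent T z))) G) zero); [f_equal|vec_op].
  etransitivity; [|apply (contour_integral_affine (V := BX) bop_id zero (RtoC 0) G), HG].
  apply (contour_integral_ext (V := BX)); intros z _; vec_op.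
- apply cont_on_integrable; intros z Hz; apply continuous_bop_comp;
    [apply continuous_const|now apply C1].
- apply cont_on_integrable; intros z _; apply continuous_const.
Qed.

End Calculus.

Lemma compact_point (a : C) : compact_set (fun z => z = a).
Proof.
split.
- exists (Rmax (Rabs (fst a)) (Rabs (snd a))); intros w ->; split; [apply Rmax_l|apply Rmax_r].
- intros w Hw; exists (Cmod (w - a)); split; [now apply Cmod_gt_0, Cminus_neq_0|].
  intros v Hv ->; rewrite Cmod_minus_sym in Hv; lra.
Qed.

Lemma compact_box lo hi : compact_set (box lo hi).
Proof.
split.
- exists (Rabs (fst lo) + Rabs (fst hi) + Rabs (snd lo) + Rabs (snd hi)).
  intros w [H1 H2]; split; split_Rabs; lra.
- intros w Hw.
  assert (H : exists d, 0 < d /\ (fst w + d <= fst lo \/ fst hi <= fst w - d \/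
    snd w + d <= snd lo \/ snd hi <= snd w - d)).
  { destruct (Rlt_le_dec (fst w) (fst lo)); [exists (fst lo - fst w); lra|].
    destruct (Rlt_le_dec (fst hi) (fst w)); [exists (fst w - fst hi); lra|].
    destruct (Rlt_le_dec (snd w) (snd lo)); [exists (snd lo - snd w); lra|].
    destruct (Rlt_le_dec (snd hi) (snd w)); [exists (snd w - snd hi); lra|].
    exfalso; apply Hw; unfold box; lra. }
  destruct H as [d [d0 H]]; exists d; split; auto; intros v Hv [B1 B2].
  pose proof (Rabs_fst_le (v - w)%C); pose proof (Rabs_snd_le (v - w)%C); simpl in *.
  split_Rabs; lra.
Qed.

Lemma contour_hull_surrounds K (U : C -> Prop) G w :
  surrounds K U G -> K w \/ contour_hull G w -> (forall z, K z -> U z) -> U w.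
Proof.
intros HG [Hw|[Hw|Hw]] HKU; [auto|now apply (surrounds_on_contour K U G HG)|].
apply NNPP; intros N; now apply Hw, (surrounds_outside K U G).
Qed.

Notation diffC := (differentiable_on (V := C_CompleteNormedModule)).

Lemma differentiable_mult (U : C -> Prop) f g :
  diffC U f -> diffC U g -> diffC U (fun z => f z * g z)%C.
Proof. exact (differentiable_scal (V := C_CompleteNormedModule) U f g). Qed.

Lemma differentiable_const (U : C -> Prop) c : diffC U (fun _ => c).
Proof. intros z _; eexists; apply is_derive_const_C. Qed.

Lemma differentiable_id (U : C -> Prop) : diffC U (fun z => z).
Proof. intros z _; eexists; apply is_derive_id_C. Qed.

Lemma differentiable_minus (U : C -> Prop) f g :
  diffC U f -> diffC U g -> diffC U (fun z => f z - g z)%C.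
Proof.
intros Hf Hg z Hz; destruct (Hf z Hz) as [a Ha]; destruct (Hg z Hz) as [b Hb].
eexists; exact (is_derive_minus_C _ _ z _ _ Ha Hb).
Qed.

Lemma differentiable_Cinv (U : C -> Prop) f :
  diffC U f -> (forall z, U z -> f z <> RtoC 0) -> diffC U (fun z => / f z)%C.
Proof.
intros Hf H0 z Hz; destruct (Hf z Hz) as [a Ha].
eexists; exact (is_derive_comp_C (V := C_NormedModule) Cinv f z _ _
  (is_derive_inv_C _ (H0 z Hz)) Ha).
Qed.

Section Multiplicativity.

Context {X : CompleteNormedModule C_AbsRing}.
Local Notation BX := (@BOp_CompleteNormedModule X).
Variable T : BOp X.

Let sT := spectrum T.

(* The resolvent identity splits [R(u) R(z)]; the term with [R(u)] vanishes since [G1]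
   does not wind around the points [u] of [G2]. *)
Lemma calculus_comp_nested (U : C -> Prop) G1 G2 phi psi : open U ->
  (forall z, sT z -> U z) -> diffC U phi -> diffC U psi ->
  surrounds sT U G1 -> surrounds (fun w => sT w \/ contour_hull G1 w) U G2 ->
  bop_comp (calculus T G2 phi) (calculus T G1 psi) = calculus T G1 (fun z => phi z * psi z)%C.
Proof.
intros HU HT Hphi Hpsi HG1 HG2.
set (c := (/ (2 * PI * Ci))%C).
assert (O1 := surrounds_on_contour _ _ _ HG1); assert (O2 := surrounds_on_contour _ _ _ HG2).
assert (N1 : forall z, on_contour G1 z -> ~ sT z) by (intros z Hz; now apply O1).
assert (N2 : forall z, on_contour G2 z -> ~ sT z).
{ intros z Hz Hs; destruct (O2 z Hz) as [_ N]; apply N; now left. }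
assert (Nu : forall z u, on_contour G1 z -> on_contour G2 u -> u <> z).
{ intros z u Hz Hu ->; destruct (O2 z Hu) as [_ N]; apply N; right; now left. }
assert (CR1 := cont_on_resolvent T (on_contour G1) N1).
assert (CR2 := cont_on_resolvent T (on_contour G2) N2).
assert (Cphi1 : cont_on (V := C_CompleteNormedModule) (on_contour G1) phi)
  by (intros z Hz; apply (differentiable_cont_on _ _ Hphi), O1, Hz).
assert (Cphi2 : cont_on (V := C_CompleteNormedModule) (on_contour G2) phi)
  by (intros z Hz; apply (differentiable_cont_on _ _ Hphi), O2, Hz).
assert (Cpsi1 : cont_on (V := C_CompleteNormedModule) (on_contour G1) psi)
  by (intros z Hz; apply (differentiable_cont_on _ _ Hpsi), O1, Hz).
assert (C1 : cont_on (V := BX) (on_contour G1) (fun z => scal (psi z) (resolvent T z))).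
{ intros z Hz; apply (continuous_scal_C (V := BX)); [now apply Cpsi1|now apply CR1]. }
assert (C2 : cont_on (V := BX) (on_contour G2) (fun u => scal (phi u) (resolvent T u))).
{ intros z Hz; apply (continuous_scal_C (V := BX)); [now apply Cphi2|now apply CR2]. }
assert (Cq : forall z, on_contour G1 z ->
  cont_on (V := C_CompleteNormedModule) (on_contour G2) (fun u => / (u - z))%C).
{ intros z Hz; apply cont_on_inv; intros Hz2; now apply (Nu z z). }
set (k := fun z u => scal (- (c * psi z * phi u * / (u - z)))%C (resolvent T u) : BOp X).
(* Here [R(u) R(z) = (R(z) - R(u)) / (u - z)]. The part with [R(z)] is evaluated by Cauchy's formula
   for [phi] along [G2], which surrounds the points of [G1]. *)
assert (E1 : forall z, on_contour G1 z ->
  bop_comp (calculus T G2 phi) (resolvent T z) = plus (scal (phi z) (resolvent T z))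
    (scal (- c)%C (contour_integral (V := BX)
      (fun u => scal (phi u * / (u - z))%C (resolvent T u)) G2))).
{ intros z Hz.
  assert (CF : contour_integral (V := C_CompleteNormedModule) (fun u => phi u * / (u - z))%C G2 =
    (2 * PI * Ci * phi z)%C).
  { rewrite <- (surrounds_cauchy_formula (V := C_CompleteNormedModule) _ U G2 phi z HU HG2 Hphi
      (or_intror (or_introl Hz)) (proj1 (O1 z Hz)) : _ = (2 * PI * Ci * phi z)%C).
    apply (contour_integral_ext (V := C_CompleteNormedModule)); intros u _.
    apply Cmult_comm. }
  assert (Ck : cont_on (V := C_CompleteNormedModule) (on_contour G2) (fun u => phi u * / (u - z))%C).
  { intros u Hu; apply continuous_mult_C; [now apply Cphi2|now apply (Cq z Hz)]. }
  transitivity (scal c (contour_integral (V := BX)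
    (fun u => plus (scal (phi u * / (u - z))%C (resolvent T z))
      (scal (- RtoC 1)%C (scal (phi u * / (u - z))%C (resolvent T u)))) G2)).
  - unfold calculus; etransitivity; [apply bop_comp_scal_l|]; fold c; f_equal.
    etransitivity; [symmetry;
      exact (contour_integral_linear (V := BX) (W := BX) _ _ G2 (is_linear_comp_r (resolvent T z)) C2)|].
    apply (contour_integral_ext (V := BX)); intros u Hu.
    etransitivity; [apply bop_comp_scal_l|].
    transitivity (scal (phi u * / (u - z))%C (opp (minus (resolvent T u) (resolvent T z))));
      [|vec_op].
    rewrite (resolvent_identity T u z (N2 u Hu) (N1 z Hz)); vec_op.
    field; apply Cminus_neq_0; now apply Nu.
  - rewrite (contour_integral_plus (V := BX)).
    + rewrite (contour_integral_scal_l (V := BX) (fun u => phi u * / (u - z))%C), CF by exact Ck.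
      rewrite (contour_integral_scal (V := BX)).
      * vec_op; unfold c.
        assert (Hc : (/ (2 * PI * Ci) * (2 * PI * Ci) = 1)%C) by (apply Cinv_l, two_pi_i_neq_0).
        transitivity ((/ (2 * PI * Ci) * (2 * PI * Ci)) * phi z)%C; [|rewrite Hc]; ring.
      * intros u Hu; apply (continuous_scal_C (V := BX)); [now apply Ck|now apply CR2].
    + apply cont_on_integrable; intros u Hu; apply (continuous_scal_C (V := BX));
        [now apply Ck|apply continuous_const].
    + apply cont_on_integrable; intros u Hu; apply (continuous_scal_r (V := BX)).
      apply (continuous_scal_C (V := BX)); [now apply Ck|now apply CR2]. }
assert (Z : contour_integral (V := BX) (fun z => contour_integral (V := BX) (k z) G2) G1 = zero).
{ rewrite (contour_integral_fubini (V := BX)).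
  - etransitivity; [|apply (contour_integral_zero (V := BX) G2)].
    apply (contour_integral_ext (V := BX)); intros u Hu; destruct (O2 u Hu) as [Uu Ku].
    assert (Nh : ~ contour_hull G1 u) by (intros N; apply Ku; now right).
    (* On [D] the function [psi z / (z - u)] is differentiable, and [G1] is homologous to zero
       there: it winds neither around [u] nor around points outside [U]. So its integral along [G1]
       vanishes. *)
    set (D := fun z => U z /\ ~ z = u).
    assert (HD : diffC D (fun z => psi z * / (z - u))%C).
    { apply differentiable_mult.
      - intros z [Hz _]; now apply Hpsi.
      - apply differentiable_inv; intros [_ N]; now apply N. }
    transitivity (contour_integral (V := BX) (fun z => scal (psi z * / (z - u))%C
      (scal (c * phi u)%C (resolvent T u))) G1).
    { apply (contour_integral_ext (V := BX)); intros z Hz; unfold k; vec_op.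
      assert (u <> z) by now apply Nu.
      field; split; apply Cminus_neq_0; auto. }
    rewrite (contour_integral_scal_l (V := BX) (fun z => psi z * / (z - u))%C).
    + rewrite (cauchy_homology (V := C_CompleteNormedModule) D).
      * exact (scal_zero_l (V := BX) _).
      * apply open_minus_compact; [apply compact_point|exact HU].
      * apply HG1.
      * intros z Hz; split; [now apply O1|]; intros ->; apply Nh; now left.
      * intros w Hw; destruct (classic (w = u)) as [->|N].
        -- apply NNPP; intros N; apply Nh; now right.
        -- apply (surrounds_outside sT U G1 w HG1); intros Uw; now apply Hw.
      * exact HD.
    + intros z Hz; apply (differentiable_cont_on _ _ HD); split; [now apply O1|].
      intros ->; apply Nh; now left.
  - intros z u Hz Hu; unfold continuous2, k.
    apply (continuous_scal_C (T := prod_UniformSpace C_UniformSpace C_UniformSpace) (V := BX)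
      (fun p => - (c * psi (fst p) * phi (snd p) * / (snd p - fst p)))%C
      (fun p => resolvent T (snd p))).
    + apply (continuous_opp (V := C_NormedModule)).
      apply continuous_mult_C; [apply continuous_mult_C; [apply continuous_mult_C|]|].
      * apply continuous_const.
      * apply (continuous_comp (U := prod_UniformSpace C_UniformSpace C_UniformSpace)
          (V := C_UniformSpace) (W := C_UniformSpace) fst psi).
        -- apply (continuous_fst (U := C_UniformSpace) (V := C_UniformSpace)).
        -- now apply Cpsi1.
      * apply (continuous_comp (U := prod_UniformSpace C_UniformSpace C_UniformSpace)
          (V := C_UniformSpace) (W := C_UniformSpace) snd phi).
        -- apply (continuous_snd (U := C_UniformSpace) (V := C_UniformSpace)).
        -- now apply Cphi2.
      * apply continuous_inv_C.
        -- apply continuous_minus_C.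
           ++ apply (continuous_snd (U := C_UniformSpace) (V := C_UniformSpace)).
           ++ apply (continuous_fst (U := C_UniformSpace) (V := C_UniformSpace)).
        -- apply Cminus_neq_0; now apply Nu.
    + apply (continuous_comp (U := prod_UniformSpace C_UniformSpace C_UniformSpace)
        (V := C_UniformSpace) snd (resolvent T)).
      * apply (continuous_snd (U := C_UniformSpace) (V := C_UniformSpace)).
      * now apply CR2. }
assert (C3 : cont_on (V := BX) (on_contour G1)
  (fun z => bop_comp (calculus T G2 phi) (scal (psi z) (resolvent T z)))).
{ intros z Hz; apply continuous_bop_comp; [apply continuous_const|now apply C1]. }
assert (C4 : cont_on (V := BX) (on_contour G1) (fun z => scal (phi z * psi z)%C (resolvent T z))).
{ intros z Hz; apply (continuous_scal_C (V := BX)); [|now apply CR1].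
  apply continuous_mult_C; [now apply Cphi1|now apply Cpsi1]. }
assert (E2 : contour_integral (V := BX)
    (fun z => bop_comp (calculus T G2 phi) (scal (psi z) (resolvent T z))) G1 =
  plus (contour_integral (V := BX) (fun z => scal (phi z * psi z)%C (resolvent T z)) G1)
    (contour_integral (V := BX) (fun z => contour_integral (V := BX) (k z) G2) G1)).
{ assert (P : forall z, on_contour G1 z -> contour_integral (V := BX) (k z) G2 =
    plus (bop_comp (calculus T G2 phi) (scal (psi z) (resolvent T z)))
      (scal (- RtoC 1)%C (scal (phi z * psi z)%C (resolvent T z)))).
  { intros z Hz.
    transitivity (scal (- (c * psi z))%C (contour_integral (V := BX)
      (fun u => scal (phi u * / (u - z))%C (resolvent T u)) G2)).
    - rewrite <- (contour_integral_scal (V := BX)).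
      + apply (contour_integral_ext (V := BX)); intros u _; unfold k; vec_op.
      + intros u Hu; apply (continuous_scal_C (V := BX)); [|now apply CR2].
        apply continuous_mult_C; [now apply Cphi2|now apply (Cq z Hz)].
    - transitivity (plus (scal (psi z) (bop_comp (calculus T G2 phi) (resolvent T z)))
        (scal (- RtoC 1)%C (scal (phi z * psi z)%C (resolvent T z)))).
      + rewrite (E1 z Hz); vec_op.
      + f_equal; symmetry; apply bop_comp_scal_r. }
  rewrite (contour_integral_ext (V := BX) _ _ G1 P), (contour_integral_plus (V := BX)).
  - rewrite (contour_integral_scal (V := BX)) by exact C4; vec_op.
  - now apply cont_on_integrable.
  - apply cont_on_integrable; intros z Hz; apply (continuous_scal_r (V := BX)), C4, Hz. }
rewrite Z in E2.
unfold calculus at 2 3; fold c; etransitivity; [apply bop_comp_scal_r|]; f_equal.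
etransitivity; [symmetry;
  exact (contour_integral_linear (V := BX) (W := BX) _ _ G1 (is_linear_comp_l (calculus T G2 phi)) C1)|].
etransitivity; [exact E2|exact (plus_zero_r (G := BX) _)].
Qed.

(** One factor is moved to a contour around the hull of [G], which reduces the claim to the nested
    case. *)
Lemma calculus_mult (U : C -> Prop) G phi psi : open U -> (forall z, sT z -> U z) ->
  diffC U phi -> diffC U psi -> surrounds sT U G ->
  bop_comp (calculus T G phi) (calculus T G psi) = calculus T G (fun z => phi z * psi z)%C.
Proof.
intros HU HT Hphi Hpsi HG.
destruct (exists_surrounds (fun w => sT w \/ contour_hull G w) U) as [G2 HG2].
- apply compact_union; [apply compact_spectrum|apply compact_contour_hull, HG].
- exact HU.
- intros w Hw; now apply (contour_hull_surrounds sT U G w).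
- rewrite (calculus_contour T U G G2 phi); auto.
  + now apply (calculus_comp_nested U).
  + apply (surrounds_mono _ _ _ _ _ HG2); auto.
Qed.

Lemma calculus_inverse (U : C -> Prop) G phi : open U -> (forall z, sT z -> U z) ->
  diffC U phi -> (forall z, U z -> phi z <> RtoC 0) -> surrounds sT U G ->
  is_inverse (calculus T G phi) (calculus T G (fun z => / phi z)%C).
Proof.
intros HU HT Hphi H0 HG.
assert (Hi := differentiable_Cinv U phi Hphi H0).
split; rewrite (calculus_mult U) by auto; rewrite <- (calculus_one T G U HG);
  apply calculus_ext; intros z Hz; field; apply H0; now apply (surrounds_on_contour sT U G).
Qed.

Lemma calculus_const_minus (U : C -> Prop) G a phi : diffC U phi -> surrounds sT U G ->
  calculus T G (fun z => a - phi z)%C = minus (scal a bop_id) (calculus T G phi).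
Proof.
intros Hphi HG.
assert (O := surrounds_on_contour _ _ _ HG).
assert (CR := cont_on_resolvent T (on_contour G) (fun z Hz => proj2 (O z Hz))).
assert (C1 : cont_on (V := BX) (on_contour G) (fun z => scal (RtoC 1) (resolvent T z))).
{ intros z Hz; apply (continuous_scal_r (V := BX)), CR, Hz. }
assert (C2 : cont_on (V := BX) (on_contour G) (fun z => scal (phi z) (resolvent T z))).
{ intros z Hz; apply (continuous_scal_C (V := BX)); [|now apply CR].
  apply (differentiable_cont_on _ _ Hphi), O, Hz. }
rewrite <- (calculus_one T G U HG); unfold calculus.
transitivity (scal (/ (2 * PI * Ci))%C (contour_integral (V := BX) (fun z =>
  plus (scal a (scal (RtoC 1) (resolvent T z)))
    (scal (- RtoC 1)%C (scal (phi z) (resolvent T z)))) G)).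
- apply (f_equal (fun v : BOp X => scal (/ (2 * PI * Ci))%C v)).
  apply (contour_integral_ext (V := BX)); intros z _; vec_op.
- rewrite (contour_integral_plus (V := BX)).
  + rewrite (contour_integral_scal (V := BX) a), (contour_integral_scal (V := BX) (- RtoC 1)%C)
      by assumption.
    vec_op.
  + apply cont_on_integrable; intros z Hz; apply (continuous_scal_r (V := BX)), C1, Hz.
  + apply cont_on_integrable; intros z Hz; apply (continuous_scal_r (V := BX)), C2, Hz.
Qed.

End Multiplicativity.

(** * Injective holomorphic functions *)

Section Injective.

Variables (Omega : C -> Prop) (f df : C -> C).
Hypotheses (HO : open Omega)
  (Hf : forall z, Omega z -> is_derive (K := C_AbsRing) (V := C_NormedModule) f z (df z))
  (Hdf : diffC Omega df)
  (Hinj : forall z w, Omega z -> Omega w -> f z = f w -> z = w).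

(** The difference quotient [q] of [f] at [w] has no zero: off [w] by injectivity, at [w] because
    [df w] is nonzero. The integrand is [phi / q] divided by [z - w], so this is Cauchy's formula
    for [phi / q]. *)
Lemma residue_injective K G w phi : surrounds K Omega G -> K w -> Omega w ->
  df w <> RtoC 0 -> diffC Omega phi ->
  contour_integral (V := C_CompleteNormedModule) (fun z => phi z * / (f z - f w))%C G =
  (2 * PI * Ci * (phi w * / df w))%C.
Proof.
intros HG Kw Ow Dw Hphi.
set (q := diff_quotient (V := C_CompleteNormedModule) f w (df w)).
assert (Hq : diffC Omega q)
  by exact (differentiable_diff_quotient (V := C_CompleteNormedModule) f df Omega w HO Ow Hf Hdf).
assert (Eq : forall z, z <> w -> q z = (/ (z - w) * (f z - f w))%C)
  by (intros z Hz; exact (diff_quotient_neq (V := C_CompleteNormedModule) f w (df w) z Hz)).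
assert (Ew : q w = df w) by apply (diff_quotient_eq (V := C_CompleteNormedModule)).
assert (Nf : forall z, Omega z -> z <> w -> (f z - f w)%C <> RtoC 0).
{ intros z Oz Hz; apply Cminus_neq_0; intros E; apply Hz; now apply Hinj. }
assert (Q0 : forall z, Omega z -> q z <> RtoC 0).
{ intros z Oz; destruct (classic (z = w)) as [->|Hz]; [now rewrite Ew|].
  rewrite Eq by exact Hz; apply Cmult_neq_0; [|now apply Nf].
  intros E; apply (Cminus_neq_0 z w Hz).
  apply Cmod_eq_0; destruct (Req_dec (Cmod (z - w)) 0) as [Z|Z]; auto.
  exfalso; assert (P : (z - w)%C <> RtoC 0) by now apply Cminus_neq_0.
  apply (f_equal (Cmult (z - w)%C)) in E; rewrite Cinv_r, Cmult_0_r in E by exact P.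
  apply RtoC_inj in E; lra. }
assert (HF := differentiable_mult Omega phi _ Hphi (differentiable_Cinv Omega q Hq Q0)).
assert (E := surrounds_cauchy_formula (V := C_CompleteNormedModule) K Omega G _ w HO HG HF Kw Ow).
cbv beta in E; rewrite Ew in E; etransitivity; [|exact E].
apply (contour_integral_ext (V := C_CompleteNormedModule)); intros z Hz.
destruct (surrounds_on_contour K Omega G HG z Hz) as [Oz Kz].
assert (Hzw : z <> w) by (intros ->; now apply Kz).
change (phi z * / (f z - f w) = / (z - w) * (phi z * / q z))%C.
rewrite Eq by exact Hzw; field; split; [now apply Cminus_neq_0|now apply Nf].
Qed.

(* By [residue_injective] with [phi = 1], [1 / df w] is bounded for [w] near [a] with
   [df w <> 0]; if [df a = 0] then [df] vanishes near [a] and [f] is constant there. *)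
Lemma injective_derivative_neq_0 a : Omega a -> df a <> RtoC 0.
Proof.
intros Oa Da.
destruct (open_square Omega a HO Oa) as [h [h0 Hh]].
set (K := box (square_lo a h) (square_hi a h)).
destruct (exists_surrounds K Omega (compact_box _ _) HO Hh) as [G HG].
assert (O := surrounds_on_contour K Omega G HG).
assert (Ka : K a) by (apply in_square_Cmod; rewrite Cmod_self; lra).
assert (Cf : forall z, Omega z -> continuous (T := C_UniformSpace) (U := C_UniformSpace) f z)
  by (intros z Oz; exact (is_derive_continuous (V := C_NormedModule) _ _ _ (Hf z Oz))).
destruct (contour_bounded (V := C_CompleteNormedModule) (fun z => / (f z - f a))%C G)
  as [M [M0 HM]].
{ intros z Hz; destruct (O z Hz) as [Oz Kz]; apply continuous_inv_C.
  - apply continuous_minus_C; [now apply Cf|apply continuous_const].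
  - apply Cminus_neq_0; intros E; apply Kz; now rewrite (Hinj z a Oz Oa E). }
assert (HM' : forall z, on_contour G z -> / M <= Cmod (f z - f a)).
{ intros z Hz; destruct (O z Hz) as [Oz Kz].
  assert (N : (f z - f a)%C <> RtoC 0).
  { apply Cminus_neq_0; intros E; apply Kz; now rewrite (Hinj z a Oz Oa E). }
  specialize (HM z Hz); change (Cmod (/ (f z - f a)) <= M) in HM; rewrite Cmod_inv in HM by exact N.
  apply Cmod_gt_0 in N; rewrite <- (Rinv_inv (Cmod (f z - f a))).
  apply Rinv_le_contravar; auto; now apply Rinv_0_lt_compat. }
assert (iM : 0 < / M) by now apply Rinv_0_lt_compat.
(* On [G] the distance of [f z] from [f a] is at least [1 / M]; for [w] within [d1] of [a] its
   distance from [f w] is then at least [1 / (2 M)]. *)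
destruct (proj1 (continuous_C_norm (V := C_CompleteNormedModule) f a) (Cf a Oa) (/ M / 2))
  as [d1 [d10 Hd1]]; [lra|].
pose proof PI_RGT_0 as Pi.
assert (L0 := contour_length_ge_0 G).
(* If [df w] is nonzero, the residue formula bounds [2 pi / |df w|] by the length of [G] times
   [2 M], hence by [B]. The radius [d2] forces [|df w| < 2 pi / B], a contradiction; so [df]
   vanishes near [a]. *)
set (B := contour_length G * (2 * M) + 1).
assert (B0 : 0 < B) by (assert (0 <= contour_length G * (2 * M)) by (apply Rmult_le_pos; lra); unfold B; lra).
assert (Cdf : continuous (T := C_UniformSpace) (U := C_UniformSpace) df a)
  by exact (differentiable_cont_on _ _ Hdf a Oa).
destruct (proj1 (continuous_C_norm (V := C_CompleteNormedModule) df a) Cdf (2 * PI / B))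
  as [d2 [d20 Hd2]]; [apply Rdiv_lt_0_compat; lra|].
set (d := Rmin h (Rmin d1 d2)).
assert (d0 : 0 < d) by (repeat apply Rmin_pos; auto).
assert (Z : forall w, Cmod (w - a) < d -> Omega w /\ df w = RtoC 0).
{ intros w Hw.
  pose proof (Rmin_l h (Rmin d1 d2)); pose proof (Rmin_r h (Rmin d1 d2)).
  pose proof (Rmin_l d1 d2); pose proof (Rmin_r d1 d2); fold d in H, H0.
  assert (Kw : K w) by (apply in_square_Cmod; lra).
  assert (Ow : Omega w) by now apply Hh.
  split; auto; apply NNPP; intros Dw.
  specialize (Hd1 w ltac:(lra)); specialize (Hd2 w ltac:(lra)).
  change (Cmod (f w - f a) < / M / 2) in Hd1.
  change (Cmod (df w - df a) < 2 * PI / B) in Hd2.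
  rewrite Da in Hd2; replace (df w - 0)%C with (df w) in Hd2 by ring.
  assert (E := residue_injective K G w (fun _ => RtoC 1) HG Kw Ow Dw (differentiable_const _ _)).
  assert (Bd : Cmod (contour_integral (V := C_CompleteNormedModule)
    (fun z => 1 * / (f z - f w))%C G) <= contour_length G * (2 * M)).
  { apply (norm_contour_integral_le (V := C_CompleteNormedModule)).
    - intros z Hz; destruct (O z Hz) as [Oz Kz].
      apply continuous_mult_C; [apply continuous_const|]; apply continuous_inv_C.
      + apply continuous_minus_C; [now apply Cf|apply continuous_const].
      + apply Cminus_neq_0; intros E2; apply Kz; now rewrite (Hinj z w Oz Ow E2).
    - intros z Hz; destruct (O z Hz) as [Oz Kz].
      assert (N : (f z - f w)%C <> RtoC 0).
      { apply Cminus_neq_0; intros E2; apply Kz; now rewrite (Hinj z w Oz Ow E2). }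
      change (Cmod (1 * / (f z - f w)) <= 2 * M).
      rewrite Cmult_1_l, Cmod_inv by exact N.
      specialize (HM' z Hz); pose proof (Cmod_triangle_minus (f z) (f w) (f a)).
      replace (2 * M) with (/ (/ M / 2)) by (field; lra).
      apply Rinv_le_contravar; lra. }
  rewrite E in Bd.
  assert (pD : 0 < Cmod (df w)) by now apply Cmod_gt_0.
  rewrite Cmult_1_l, !Cmod_mult, Cmod_Ci, Cmod_inv, !Cmod_R, !Rabs_right in Bd by (auto; lra).
  assert (2 * PI <= Cmod (df w) * B).
  { apply Rmult_le_compat_l with (r := Cmod (df w)) in Bd; [|lra].
    replace (Cmod (df w) * (2 * PI * 1 * / Cmod (df w))) with (2 * PI) in Bd by (field; lra).
    unfold B; nra. }
  apply Rmult_lt_compat_r with (r := B) in Hd2; auto.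
  replace (2 * PI / B * B) with (2 * PI) in Hd2 by (field; lra); lra. }
(* A second point of the disc on which [df] vanishes; integrating [df] from [a] to [b] gives
   [f b = f a], against injectivity. *)
set (b := (a + RtoC (d / 2))%C).
assert (Eb : (b - a)%C = RtoC (d / 2)) by (unfold b; ring).
assert (Hb : Cmod (b - a) < d) by (rewrite Eb, Cmod_R, Rabs_right; lra).
assert (S := segment_integral_derive (V := C_CompleteNormedModule) f (fun _ => RtoC 0) (a, b)).
rewrite segment_integral_const in S.
assert (Efb : ((b - a) * 0 = f b - f a)%C).
{ apply S.
  - intros z Hz; apply dist_segment in Hz; simpl in Hz.
    destruct (Z z) as [Oz Ez]; [lra|]; rewrite <- Ez; now apply Hf.
  - intros z _; apply continuous_const. }
assert (Eab : b = a).
{ apply Hinj; [now apply Z|exact Oa|].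
  apply Cmod_eq_minus; rewrite <- Efb, Cmult_0_r; apply Cmod_0. }
rewrite Eab in Eb; replace (a - a)%C with (RtoC 0) in Eb by ring.
apply RtoC_inj in Eb; lra.
Qed.

Section InverseFormula.

Context {X : CompleteNormedModule C_AbsRing}.
Local Notation BX := (@BOp_CompleteNormedModule X).
Variables (T : BOp X) (K : C -> Prop) (G1 G2 : list (C * C)).
Hypotheses (KT : forall z, spectrum T z -> K z) (KO : forall z, K z -> Omega z)
  (HG1 : surrounds K Omega G1)
  (HG2 : surrounds (fun w => K w \/ contour_hull G1 w) Omega G2).

Let Hfd : diffC Omega f := fun z Hz => ex_intro _ (df z) (Hf z Hz).
Let HT1 : surrounds (spectrum T) Omega G1 :=
  surrounds_mono K (spectrum T) Omega Omega G1 HG1 KT (fun z Hz => Hz).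

(** By injectivity [f z - f w] vanishes on [Omega] only at [w = z]. As [z] is outside the hull, [G1]
    still surrounds the spectrum inside [Omega] minus [z], where [calculus_inverse] applies. *)
Lemma calculus_resolvent z : Omega z -> ~ (K z \/ contour_hull G1 z) ->
  is_inverse (minus (scal (f z) bop_id) (calculus T G1 f))
    (calculus T G1 (fun w => / (f z - f w))%C).
Proof.
intros Oz Nz.
set (U := fun w => Omega w /\ ~ w = z).
assert (HU : open U) by (apply open_minus_compact; [apply compact_point|exact HO]).
assert (TU : forall w, spectrum T w -> U w).
{ intros w Hw; split; [now apply KO, KT|]; intros ->; apply Nz; left; now apply KT. }
assert (GU : surrounds (spectrum T) U G1).
{ destruct HT1 as [S1 [S2 [S3 S4]]]; split; [exact S1|split; [|split]].
  - intros s t Hs Ht; destruct (S2 s t Hs Ht) as [S5 S6]; split; [split|]; auto.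
    intros E; apply Nz; right; left; exists s; split; auto; exists t; split; auto.
  - exact S3.
  - intros w Hw; destruct (classic (w = z)) as [->|N].
    + apply winding_number_integral; rewrite Cmult_0_r.
      apply NNPP; intros N; apply Nz; right; now right.
    + apply S4; intros Ow; now apply Hw. }
rewrite <- (calculus_const_minus T Omega G1 (f z) f Hfd HT1).
apply (calculus_inverse T U); auto.
- apply differentiable_minus; [apply differentiable_const|].
  intros w [Ow _]; now apply Hfd.
- intros w [Ow Nw]; apply Cminus_neq_0; intros E; apply Nw; symmetry; now apply Hinj.
Qed.

(* By [residue_injective] with [phi z = z * df z], integrating [z * df z / (f z - f w)]
   along [G2] gives [2 i pi w]. *)
Lemma calculus_inverse_formula :
  T = scal (/ (2 * PI * Ci))%C (contour_integral (V := BX)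
    (fun z => scal (z * df z)%C (calculus T G1 (fun w => / (f z - f w))%C)) G2).
Proof.
set (c := (/ (2 * PI * Ci))%C).
assert (O1 := surrounds_on_contour _ _ _ HT1); assert (O2 := surrounds_on_contour _ _ _ HG2).
assert (Nzw : forall z w, on_contour G2 z -> on_contour G1 w -> (f z - f w)%C <> RtoC 0).
{ intros z w Hz Hw; destruct (O2 z Hz) as [Oz Kz]; destruct (O1 w Hw) as [Ow _].
  apply Cminus_neq_0; intros E; apply Kz; right; left; now rewrite (Hinj z w Oz Ow E). }
assert (CR := cont_on_resolvent T (on_contour G1) (fun z Hz => proj2 (O1 z Hz))).
assert (Cf := differentiable_cont_on _ _ Hfd); assert (Cdf := differentiable_cont_on _ _ Hdf).
set (k := fun z w => scal (z * df z * c * / (f z - f w))%C (resolvent T w) : BOp X).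
transitivity (scal c (contour_integral (V := BX) (fun z => contour_integral (V := BX) (k z) G1) G2)).
2: { apply (f_equal (fun v : BOp X => scal c v)).
     apply (contour_integral_ext (V := BX)); intros z Hz; unfold calculus.
     transitivity (scal (z * df z * c)%C (contour_integral (V := BX)
       (fun w => scal (/ (f z - f w))%C (resolvent T w)) G1)); [|fold c; vec_op].
     rewrite <- (contour_integral_scal (V := BX)).
     - apply (contour_integral_ext (V := BX)); intros w _; unfold k; vec_op.
     - intros w Hw; apply (continuous_scal_C (V := BX)); [|now apply CR].
       apply continuous_inv_C; [|now apply Nzw].
       apply continuous_minus_C; [apply continuous_const|apply Cf, O1, Hw]. }
(* With the integral over [G2] now inside, it produces the scalar [w] for each [w] on [G1], and the
   outer integral is that of [calculus_id]. *)
rewrite (contour_integral_fubini (V := BX)).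
- etransitivity; [symmetry; exact (calculus_id T G1 Omega HT1)|].
  apply (f_equal (fun v : BOp X => scal c v)).
  apply (contour_integral_ext (V := BX)); intros w Hw; destruct (O1 w Hw) as [Ow _].
  assert (Ck : cont_on (V := C_CompleteNormedModule) (on_contour G2)
    (fun z => z * df z * / (f z - f w))%C).
  { intros z Hz; apply continuous_mult_C; [apply continuous_mult_C|].
    - apply continuous_id.
    - apply Cdf, O2, Hz.
    - apply continuous_inv_C; [|now apply Nzw].
      apply continuous_minus_C; [apply Cf, O2, Hz|apply continuous_const]. }
  transitivity (contour_integral (V := BX) (fun z => scal (z * df z * / (f z - f w))%C
    (scal c (resolvent T w))) G2).
  2: { apply (contour_integral_ext (V := BX)); intros z _; unfold k; vec_op. }
  rewrite (contour_integral_scal_l (V := BX) (fun z => z * df z * / (f z - f w))%C) by exact Ck.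
  assert (Dw := injective_derivative_neq_0 w Ow).
  rewrite (residue_injective _ G2 w (fun z => z * df z)%C HG2
    (or_intror (or_introl Hw)) Ow Dw).
  2: { apply differentiable_mult; [apply differentiable_id|exact Hdf]. }
  vec_op; unfold c.
  assert (Hc : (/ (2 * PI * Ci) * (2 * PI * Ci) = 1)%C) by (apply Cinv_l, two_pi_i_neq_0).
  transitivity ((/ (2 * PI * Ci) * (2 * PI * Ci)) * w * (df w * / df w))%C; [|ring].
  rewrite Hc, Cinv_r by exact Dw; ring.
- intros z w Hz Hw; unfold continuous2, k.
  apply (continuous_scal_C (T := prod_UniformSpace C_UniformSpace C_UniformSpace) (V := BX)
    (fun p => fst p * df (fst p) * c * / (f (fst p) - f (snd p)))%C
    (fun p => resolvent T (snd p))).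
  + assert (F1 := continuous_fst (U := C_UniformSpace) (V := C_UniformSpace) z w).
    assert (F2 := continuous_snd (U := C_UniformSpace) (V := C_UniformSpace) z w).
    apply continuous_mult_C; [apply continuous_mult_C; [apply continuous_mult_C|]|].
    * exact F1.
    * apply (continuous_comp (U := prod_UniformSpace C_UniformSpace C_UniformSpace)
        (V := C_UniformSpace) (W := C_UniformSpace) fst df); [exact F1|apply Cdf, O2, Hz].
    * apply continuous_const.
    * apply continuous_inv_C; [|now apply Nzw]; apply continuous_minus_C.
      -- apply (continuous_comp (U := prod_UniformSpace C_UniformSpace C_UniformSpace)
           (V := C_UniformSpace) (W := C_UniformSpace) fst f); [exact F1|apply Cf, O2, Hz].
      -- apply (continuous_comp (U := prod_UniformSpace C_UniformSpace C_UniformSpace)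
           (V := C_UniformSpace) (W := C_UniformSpace) snd f); [exact F2|apply Cf, O1, Hw].
  + apply (continuous_comp (U := prod_UniformSpace C_UniformSpace C_UniformSpace)
      (V := C_UniformSpace) snd (resolvent T)).
    * apply (continuous_snd (U := C_UniformSpace) (V := C_UniformSpace)).
    * now apply CR.
Qed.

(** Near a point of [G2] these operators invert [f z - f(T)], which depends continuously on [z];
    continuity comes from [continuous_inverse] rather than from the integral defining them. *)
Lemma cont_on_calculus_resolvent : compact_set K ->
  cont_on (V := BX) (on_contour G2) (fun z => calculus T G1 (fun w => / (f z - f w))%C).
Proof.
intros HK z Hz.
assert (HU := open_minus_compact _ Omega
  (compact_union K _ HK (compact_contour_hull G1 (proj1 HG1))) HO).
destruct (open_Cmod _ z HU (surrounds_on_contour _ _ _ HG2 z Hz)) as [d [d0 Hd]].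
apply (continuous_inverse (fun z => minus (scal (f z) bop_id) (calculus T G1 f)) _ z d d0).
- intros w Hw; destruct (Hd w Hw) as [Ow Nw]; now apply calculus_resolvent.
- apply (continuous_minus (V := BX)); [|apply continuous_const].
  apply (continuous_scal_C (V := BX)); [|apply continuous_const].
  apply (differentiable_cont_on _ _ Hfd), (surrounds_on_contour _ _ _ HG2 z Hz).
Qed.

End InverseFormula.

End Injective.

Lemma norm_closure_mono {X : CompleteNormedModule C_AbsRing} (E E' : BOp X -> Prop) :
  (forall Y, E Y -> E' Y) -> forall Y, norm_closure E Y -> norm_closure E' Y.
Proof.
intros H Y HY eps; destruct (HY eps) as [Z [HZ N]]; exists Z; split; [apply H, HZ|exact N].
Qed.

Lemma norm_closure_incl {X : CompleteNormedModule C_AbsRing} (E : BOp X -> Prop) Y :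
  E Y -> norm_closure E Y.
Proof.
intros HY eps; exists Y; split; [exact HY|].
rewrite minus_eq_zero; eapply Rle_lt_trans; [right; exact (norm_zero (V := BOp_NormedModule))|].
apply cond_pos.
Qed.

Theorem theorem7 (X : CompleteNormedModule C_AbsRing) (A B : BOp X)
    (Omega : C -> Prop) (f : C -> C) :
  (forall z, spectrum A z \/ spectrum B z -> Omega z) ->
  holomorphic_on Omega f ->
  let fA := riesz Omega f A in
  let fB := riesz Omega f B in
  ((forall Y : BOp X,
      range (gderiv fA fB) Y -> norm_closure (range (gderiv A B)) Y) /\
   (forall Y : BOp X,
      null_space (gderiv A B) Y -> null_space (gderiv fA fB) Y)) /\
  ((forall z w, Omega z -> Omega w -> f z = f w -> z = w) ->
   (forall Y : BOp X,
      norm_closure (range (gderiv fA fB)) Y <->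
      norm_closure (range (gderiv A B)) Y) /\
   (forall Y : BOp X,
      null_space (gderiv fA fB) Y <-> null_space (gderiv A B) Y)).
Proof.
intros HK [HO Hf] fA fB.
set (K := fun z => spectrum A z \/ spectrum B z) in HK.
assert (CK : compact_set K) by (apply compact_union; apply compact_spectrum).
destruct (exists_surrounds K Omega CK HO HK) as [G1 HG1].
assert (KA : forall z, spectrum A z -> K z) by (intros z Hz; now left).
assert (KB : forall z, spectrum B z -> K z) by (intros z Hz; now right).
assert (O1 := surrounds_on_contour K Omega G1 HG1).
assert (EA : fA = calculus A G1 f).
{ apply riesz_calculus; auto; now apply (surrounds_mono K _ Omega Omega G1 HG1). }
assert (EB : fB = calculus B G1 f).
{ apply riesz_calculus; auto; now apply (surrounds_mono K _ Omega Omega G1 HG1). }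
assert (NA : forall z, on_contour G1 z -> ~ spectrum A z)
  by (intros z Hz N; apply (O1 z Hz); now left).
assert (NB : forall z, on_contour G1 z -> ~ spectrum B z)
  by (intros z Hz N; apply (O1 z Hz); now right).
assert (Cf : cont_on (V := C_CompleteNormedModule) (on_contour G1) f)
  by (intros z Hz; apply (differentiable_cont_on Omega f Hf), O1, Hz).
assert (IA : forall z, on_contour G1 z -> is_inverse (minus (scal z bop_id) A) (resolvent A z))
  by (intros z Hz; now apply resolvent_inverse, NA).
assert (IB : forall z, on_contour G1 z -> is_inverse (minus (scal z bop_id) B) (resolvent B z))
  by (intros z Hz; now apply resolvent_inverse, NB).
assert (R1 : forall Y, range (gderiv fA fB) Y -> range (gderiv A B) Y).
{ intros Y; exact (range_gderiv_contour G1 _ f (fun z => z) fA fB A B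
    (resolvent A) (resolvent B) IA IB Cf (cont_on_resolvent A _ NA) (cont_on_resolvent B _ NB)
    EA EB Y). }
assert (N1 : forall Y, null_space (gderiv A B) Y -> null_space (gderiv fA fB) Y).
{ intros Y; exact (null_space_gderiv_contour G1 _ f (fun z => z) fA fB A B
    (resolvent A) (resolvent B) IA IB Cf (cont_on_resolvent A _ NA) (cont_on_resolvent B _ NB)
    EA EB Y). }
split; [split; auto; intros Y HY; now apply norm_closure_incl, R1|].
intros Hinj.
destruct (differentiable_derivative (V := C_CompleteNormedModule) f Omega HO Hf)
  as [df [Hd Hdf]].
(* Surrounding the hull of [G1] serves two ends: each [z] on [G2] satisfies the condition of
   [calculus_resolvent], and each [w] on [G1] is inside [G2] for the residue formula. *)
assert (C2 := compact_union K _ CK (compact_contour_hull G1 (proj1 HG1))).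
destruct (exists_surrounds _ Omega C2 HO
  (fun w Hw => contour_hull_surrounds K Omega G1 w HG1 Hw HK)) as [G2 HG2].
assert (O2 := surrounds_on_contour _ Omega G2 HG2).
set (S T z := calculus T G1 (fun w => / (f z - f w))%C : BOp X).
assert (JA : forall z, on_contour G2 z ->
  is_inverse (minus (scal (f z) bop_id) fA) (S A z)).
{ intros z Hz; rewrite EA; apply (calculus_resolvent Omega f df HO Hd Hinj A K G1); auto;
    now apply O2. }
assert (JB : forall z, on_contour G2 z ->
  is_inverse (minus (scal (f z) bop_id) fB) (S B z)).
{ intros z Hz; rewrite EB; apply (calculus_resolvent Omega f df HO Hd Hinj B K G1); auto;
    now apply O2. }
assert (Cphi : cont_on (V := C_CompleteNormedModule) (on_contour G2) (fun z => z * df z)%C).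
{ intros z Hz; apply continuous_mult_C; [apply continuous_id|].
  apply (differentiable_cont_on Omega df Hdf), O2, Hz. }
assert (FA := calculus_inverse_formula Omega f df HO Hd Hdf Hinj A K G1 G2 KA HG1 HG2).
assert (FB := calculus_inverse_formula Omega f df HO Hd Hdf Hinj B K G1 G2 KB HG1 HG2).
assert (CA := cont_on_calculus_resolvent Omega f df HO Hd Hinj A K G1 G2 KA HK HG1 HG2 CK).
assert (CB := cont_on_calculus_resolvent Omega f df HO Hd Hinj B K G1 G2 KB HK HG1 HG2 CK).
assert (R2 : forall Y, range (gderiv A B) Y -> range (gderiv fA fB) Y).
{ intros Y; exact (range_gderiv_contour G2 _ (fun z => z * df z)%C f A B fA fB
    (S A) (S B) JA JB Cphi CA CB FA FB Y). }
assert (N2 : forall Y, null_space (gderiv fA fB) Y -> null_space (gderiv A B) Y).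
{ intros Y; exact (null_space_gderiv_contour G2 _ (fun z => z * df z)%C f A B fA fB
    (S A) (S B) JA JB Cphi CA CB FA FB Y). }
split; intros Y; split; auto; now apply norm_closure_mono.
Qed.
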